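(* Let $n\ge 2$, and let $X\in C^{k,\alpha}(\overline B,\mathbb R^{n+2})$, with $k\ge3$ an integer and $\alpha\in(0,1)$, be a conformally parametrized immersion. Then there exists a weak normal Coulomb frame $N\in H^{1,2}(B)\cap L^\infty(B)$ of $X$ minimizing the functional $\mathcal T(N)$ of total torsion in the set of all weak normal frames of $X$ of class $H^{1,2}(B)\cap L^\infty(B)$.
   Context: $B=\{(u,v)\in\mathbb R^2: u^2+v^2<1\}$; $u^1=u$, $u^2=v$; $\cdot$ is the Euclidean inner product. $X$ is an immersion if $\mathrm{rank}\,DX=2$ on $\overline B$; it is conformally parametrized if $X_u\cdot X_u=X_v\cdot X_v=W>0$, $X_u\cdot X_v=0$ on $\overline B$. A (regular) normal frame is a tuple $N=(N_1,\dots,N_n)$ of maps $N_\sigma\in C^{k-1,\alpha}(\overline B,\mathbb R^{n+2})$ with $N_\sigma\cdot N_\vartheta=\delta_{\sigma\vartheta}$, $N_\sigma\cdot X_{u^i}=0$ and $\det(X_u,X_v,N_1,\dots,N_n)>0$ on $\overline B$. A weak normal frame of class $H^{1,2}(B)\cap L^\infty(B)$ is a tuple with $N_\sigma\in H^{1,2}(B,\mathbb R^{n+2})\cap L^\infty$ satisfying the same relations a.e.; equivalently $N_\sigma=\sum_{\vartheta}R_\sigma^\vartheta\widetilde N_\vartheta$ with a fixed regular normal frame $\widetilde N$ and $R\in H^{1,2}(B,SO(n))$. Torsion coefficients: $T_{\sigma,i}^\vartheta=N_{\sigma,u^i}\cdot N_\vartheta$ (weak derivatives). Total torsion (in conformal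 parameters): $$\mathcal T(N)=\sum_{i=1}^2\sum_{\sigma,\vartheta=1}^n\iint_B (T_{\sigma,i}^\vartheta)^2\,du\,dv .$$ A weak normal frame is a weak normal Coulomb frame if it is critical for $\mathcal T$, i.e. its torsion coefficients satisfy the weak Euler-Lagrange equations $\iint_B(\varphi_uT_{\sigma,1}^\vartheta+\varphi_vT_{\sigma,2}^\vartheta)\,du\,dv=0$ for all $\varphi\in C^\infty(\overline B)$ and all $\sigma,\vartheta=1,\dots,n$. *)

(* Defs.v *)
From HB Require Import structures.
From mathcomp Require Import all_boot all_order all_algebra.
From mathcomp Require Import all_classical all_reals all_analysis.

Set Implicit Arguments.
Unset Strict Implicit.
Unset Printing Implicit Defensive.
Import Order.TTheory GRing.Theory Num.Theory.
Import numFieldNormedType.Exports.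

Local Open Scope classical_set_scope.
Local Open Scope ring_scope.

(* The parameters u^1 = u and u^2 = v are indexed by 0 and 1 in 'I_2. *)

Section Plane.
Variable R : realType.
Implicit Types (f g phi : R * R -> R) (i : 'I_2) (p q : R * R).

Definition disc : set (R * R) := [set p | p.1 ^+ 2 + p.2 ^+ 2 < 1].

Definition cdisc : set (R * R) := closure disc.

(* [measurableTypeR R] is R with the Borel sigma-algebra carried by
   [lebesgue_measure]. *)
Definition leb2 :
    {measure set (measurableTypeR R * measurableTypeR R) -> \bar R} :=
  (@lebesgue_measure R \x @lebesgue_measure R)%E.

Definition dir i : R * R := if i == ord0 then (1, 0) else (0, 1).

(* Partial derivative, taken in the open disc and extended to the boundary by
   its limit from inside.  If the limit at p exists and p is in [disc], it is
   the ordinary partial derivative at p, since [within disc (nbhs p)] does not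
   exclude p itself. *)
Definition pd i f : R * R -> R :=
  fun p => lim ('D_(dir i) f q @[q --> within disc (nbhs p)]).

(* All partial derivatives up to order k exist in the open disc and extend
   continuously to the closed disc; values of f outside it are irrelevant. *)
Fixpoint Ck_cdisc (k : nat) f : Prop :=
  {within cdisc, continuous f} /\
  match k with
  | 0 => True
  | k'.+1 => forall i,
      (forall p, disc p -> is_derive p (dir i) f (pd i f p)) /\
      Ck_cdisc k' (pd i f)
  end.

Definition eucl_dist p q : R :=
  Num.sqrt ((p.1 - q.1) ^+ 2 + (p.2 - q.2) ^+ 2).

Definition hoelder_cdisc (a : R) f : Prop :=
  exists C : R, forall p q, cdisc p -> cdisc q ->
    `|f p - f q| <= C * eucl_dist p q `^ a.

(* All k-th order partial derivatives (one for each word w) are a-Hoelder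
   continuous; orders below k need no separate condition since the disc is
   convex and bounded. *)
Definition Cka_cdisc (k : nat) (a : R) f : Prop :=
  Ck_cdisc k f /\
  forall w : k.-tuple 'I_2, hoelder_cdisc a (foldr pd f w).

Definition smooth_cdisc f : Prop := forall k, Ck_cdisc k f.

Definition test_fun phi : Prop :=
  smooth_cdisc phi /\
  exists K : set (R * R),
    [/\ compact K, K `<=` disc & forall p, ~ K p -> phi p = 0].

(* L^r over the disc, through the extension by 0 to the plane. *)
Definition Lp_disc (r : \bar R) f : Prop := (f \_ disc) \in Lfun leb2 r.

Definition is_weak_pd i f g : Prop :=
  Lp_disc 2%:E g /\
  forall phi, test_fun phi ->
    \int[leb2]_(p in disc) (f p * pd i phi p) =
    - \int[leb2]_(p in disc) (g p * phi p).

Definition H12_disc f : Prop :=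
  Lp_disc 2%:E f /\ forall i, exists g, is_weak_pd i f g.

(* A weak derivative is unique up to a null set, so integrals do not depend on
   the representative chosen here. *)
Definition weak_pd i f : R * R -> R := xget (cst 0) [set g | is_weak_pd i f g].

End Plane.

Section Frames.
Variables (R : realType) (n : nat).
Local Notation vec := 'rV[R]_(2 + n).
Implicit Types (X : R * R -> vec) (N : 'I_n -> R * R -> vec).

Definition dot (x y : vec) : R := \sum_l x 0 l * y 0 l.

Definition entry X (l : 'I_(2 + n)) : R * R -> R := fun p => X p 0 l.

Definition vpd (i : 'I_2) X : R * R -> vec := fun p => \row_l pd i (entry X l) p.

Definition vweak_pd (i : 'I_2) X : R * R -> vec :=
  fun p => \row_l weak_pd i (entry X l) p.

Definition Cka_surface (k : nat) (a : R) X : Prop :=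
  forall l, Cka_cdisc k a (entry X l).

(* The rows of DX are X_u and X_v (the transpose of the Jacobian matrix). *)
Definition DX X (p : R * R) : 'M[R]_(2, 2 + n) := \matrix_i vpd i X p.

Definition immersion X : Prop := forall p, cdisc p -> \rank (DX X p) = 2%N.

Definition conformal X : Prop :=
  exists W : R * R -> R, forall p, cdisc p ->
    [/\ dot (vpd 0 X p) (vpd 0 X p) = W p,
        dot (vpd 1 X p) (vpd 1 X p) = W p,
        0 < W p
      & dot (vpd 0 X p) (vpd 1 X p) = 0].

(* The square matrix with rows X_u, X_v, N_1, ..., N_n. *)
Definition frame_mx X N (p : R * R) : 'M[R]_(2 + n) :=
  col_mx (DX X p) (\matrix_s N s p).

Definition normal_frame_at X N (p : R * R) : Prop :=
  [/\ forall s t : 'I_n, dot (N s p) (N t p) = (s == t)%:R,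
      forall (s : 'I_n) (i : 'I_2), dot (N s p) (vpd i X p) = 0
    & 0 < \det (frame_mx X N p)].

Definition weak_normal_frame X N : Prop :=
  (forall s l, H12_disc (entry (N s) l) /\ Lp_disc +oo%E (entry (N s) l)) /\
  {ae leb2 R, forall p, disc p -> normal_frame_at X N p}.

Definition torsion N (s t : 'I_n) (i : 'I_2) : R * R -> R :=
  fun p => dot (vweak_pd i (N s) p) (N t p).

Definition total_torsion N : \bar R :=
  (\sum_(i < 2) \sum_(s < n) \sum_(t < n)
     \int[leb2 R]_(p in @disc R) (torsion N s t i p ^+ 2)%:E)%E.

Definition weak_Coulomb_frame X N : Prop :=
  weak_normal_frame X N /\
  forall (phi : R * R -> R) (s t : 'I_n), smooth_cdisc phi ->
    \int[leb2 R]_(p in @disc R)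
      (pd 0 phi p * torsion N s t 0 p + pd 1 phi p * torsion N s t 1 p) = 0.

End Frames.

(* Main.v *)
(** Since N_s is normal, d_i N_s . X_j = - N_s . d_i X_j, so by Parseval the
    Dirichlet energy of a normal frame exceeds its total torsion by an integral
    that depends on X only; minimizing the torsion is minimizing the energy.
    Along a minimizing sequence the components are bounded by 1, hence some
    subsequence converges in L2 on the disc (Rellich) and, after a further
    extraction, almost everywhere; the pointwise constraints pass to the limit,
    the orientation because the determinant of a frame squares to W^2 > 0, and
    the energy is lower semicontinuous by convexity. The class of frames is not
    empty because tangent vectors can be moved to constant ones by products of
    reflections depending on the point in a C^1 way.
    The minimizer satisfies the Euler-Lagrange equations because rotating N_s
    and N_t by the angle e phi changes the energy by a quadratic polynomial in
    e whose linear coefficient is the weak divergence of the torsion. *)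

Require Import Defs.
From mathcomp Require Import all_boot all_order all_algebra.
From mathcomp Require Import all_classical all_reals all_analysis.
From mathcomp Require Import measurable_realfun ess_sup_inf ring lra zify.
Import Order.TTheory GRing.Theory Num.Theory.
Import numFieldNormedType.Exports.
Local Open Scope classical_set_scope.
Local Open Scope ring_scope.
Set Implicit Arguments.
Unset Strict Implicit.
Unset Printing Implicit Defensive.

(** The torsion is not a convex functional of the frame, whereas the Dirichlet energy is a convex
    quadratic functional of the gradient alone; hence the minimization of the energy. The obstacle
    is the calculus of weak derivatives: differentiating the constraints N_s . N_t = const and N_s .
    X_j = 0, and rotating a frame, both need the Leibniz rule for bounded functions with square
    integrable weak derivatives. There is no mollification. Weak derivatives are identified with
    absolute continuity on almost every line, where the Leibniz rule is a Fubini argument in one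
    variable; the test functions used for this are products of explicit functions of one variable.
    Compactness is proved only locally, as L1 estimates on rectangles with rational sides inside the
    disc. This suffices: almost everywhere convergence on countably many rectangles covering the
    disc is almost everywhere convergence on the disc, and the bound 1 lets dominated convergence
    reach the boundary. *)

Lemma aeS d (T : measurableType d) (R : realType) (m : {measure set T -> \bar R}) (P Q : T -> Prop) :
  (forall x, P x -> Q x) -> {ae m, forall x, P x} -> {ae m, forall x, Q x}.
Proof. by move=> PQ; apply: filterS. Qed.

Lemma aeI d (T : measurableType d) (R : realType) (m : {measure set T -> \bar R}) (P Q : T -> Prop) :
  {ae m, forall x, P x} -> {ae m, forall x, Q x} -> {ae m, forall x, P x /\ Q x}.
Proof. by move=> P1 Q1; apply: filterI. Qed.

(** * Integration along lines *)

Section PlaneMeasure.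
Variable R : realType.
Local Notation mu := (@lebesgue_measure R).
Local Notation D := (@disc R).

Local Notation plane := (measurableTypeR R * measurableTypeR R)%type.

(** The plane carries the product sigma-algebra, so an open set has to be exhibited as a countable
    union of measurable products: the rational boxes that it contains. *)
Lemma open_measurable_plane (A : set (R * R)) : open A -> measurable (A : set plane).
Proof.
move=> oA.
pose B (q : (rat * rat) * (rat * rat)) : set (R * R) :=
  if `[< ball (ratr q.1.1 : R) (ratr q.1.2) `*` ball (ratr q.2.1 : R) (ratr q.2.2) `<=` A >]
  then ball (ratr q.1.1 : R) (ratr q.1.2) `*` ball (ratr q.2.1 : R) (ratr q.2.2) else set0.
have -> : A = \bigcup_q B q.
  apply/seteqP; split=> [p Ap|p [q _]]; last first.
    by rewrite /B; case: ifPn => // /asboolP; exact.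
  have /nbhs_ballP[e /= e0 eA] : nbhs p A by exact: open_nbhs_nbhs.
  have p1 : p.1 \in (ball p.1 e : set R) by apply: mem_set; exact: ballxx.
  have p2 : p.2 \in (ball p.2 e : set R) by apply: mem_set; exact: ballxx.
  have [c1 [r1 [/= /set_mem c1p c1e]]] := open_subball_rat (ball_open p.1 e) p1.
  have [c2 [r2 [/= /set_mem c2p c2e]]] := open_subball_rat (ball_open p.2 e) p2.
  exists ((c1, r1), (c2, r2)) => //; rewrite /B ifT/=; first by split.
  by apply/asboolP => z [/= z1 z2]; apply: eA; split; [exact: c1e|exact: c2e].
apply: countable_bigcupT_measurable; [exact: countableP|move=> q].
rewrite /B; case: ifPn => _; last exact: measurable0.
by apply: measurableX; exact: measurable_ball.
Qed.

Lemma continuous_sqnorm : continuous (fun p : R * R => p.1 ^+ 2 + p.2 ^+ 2).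
Proof.
move=> p; apply: cvgD; rewrite expr2.
  by under eq_fun do rewrite expr2; apply: cvgM; exact: cvg_fst.
by under eq_fun do rewrite expr2; apply: cvgM; exact: cvg_snd.
Qed.

Lemma open_disc : open D.
Proof.
have -> : D = (fun p : R * R => p.1 ^+ 2 + p.2 ^+ 2) @^-1` [set x | x < 1] by [].
by apply: open_comp; [move=> x _; exact: continuous_sqnorm|exact: open_lt].
Qed.

Lemma measurable_disc : measurable (D : set plane).
Proof. exact: open_measurable_plane open_disc. Qed.

Lemma open_continuous_measurable_plane (A : set (R * R)) (f : R * R -> R) :
  open A -> (forall p, A p -> {for p, continuous f}) -> measurable_fun (A : set plane) f.
Proof.
move=> oA cf; apply: (measurability _ (RGenOInfty.measurableE R)).
move=> /= _ [_ [a ->]] <-; apply: open_measurable_plane.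
rewrite openE => p [Ap /= pa]; rewrite /interior.
apply: filterI; first exact: open_nbhs_nbhs.
have := cf _ Ap; apply; rewrite /= in_itv/= andbT in pa.
by rewrite set_itvE; apply: open_nbhs_nbhs; split => //; exact: open_gt.
Qed.

(** The point with coordinate x along axis i and y across it. It lets every argument on lines be
    written once for both axes. *)
Definition pt (i : 'I_2) (x y : R) : R * R := if i == ord0 then (x, y) else (y, x).

Lemma disc_pt i x y : D (pt i x y) <-> x ^+ 2 + y ^+ 2 < 1.
Proof. by rewrite /D /pt /disc; case: (_ == ord0) => //=; rewrite addrC. Qed.

Lemma measurable_pt i : measurable_fun setT (fun z : R * R => pt i z.1 z.2).
Proof.
rewrite /pt; case: (_ == ord0).
  by apply/measurable_fun_pairP; split; [exact: measurable_fst|exact: measurable_snd].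
by apply/measurable_fun_pairP; split; [exact: measurable_snd|exact: measurable_fst].
Qed.

Lemma measurable_ptl i y : measurable_fun setT (fun x => pt i x y).
Proof.
exact: (measurableT_comp (measurable_pt i) (measurable_pair2 y)).
Qed.

Lemma fubini_tonelli_pt (i : 'I_2) (f : R * R -> \bar R) :
  measurable_fun setT f -> (forall p, (0 <= f p)%E) ->
  (\int[leb2 R]_p f p = \int[mu]_y \int[mu]_x f (pt i x y))%E.
Proof.
move=> mf f0; rewrite /pt /leb2; case: (_ == ord0); first by rewrite fubini_tonelli2.
by rewrite fubini_tonelli1.
Qed.

Lemma fubini_pt (i : 'I_2) (f : R * R -> \bar R) :
  (leb2 R).-integrable setT f ->
  (\int[leb2 R]_p f p = \int[mu]_y \int[mu]_x f (pt i x y))%E.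
Proof.
move=> fi; rewrite /pt /leb2; case: (_ == ord0); first by rewrite -integral21_prod_meas1.
by rewrite -integral12_prod_meas1.
Qed.

Lemma integrable_ptP (i : 'I_2) (f : R * R -> \bar R) :
  measurable_fun setT f ->
  (leb2 R).-integrable setT f <-> (\int[mu]_y \int[mu]_x `|f (pt i x y)| < +oo)%E.
Proof.
move=> mf; rewrite /pt /leb2; case: (_ == ord0); first exact: integrable21ltyP.
exact: integrable12ltyP.
Qed.

Lemma ae_integrable_pt (i : 'I_2) (f : R * R -> \bar R) :
  (leb2 R).-integrable setT f ->
  {ae mu, forall y, mu.-integrable setT (fun x => f (pt i x y))}.
Proof.
move=> fi; rewrite /pt; case: (_ == ord0); first exact: ae_integrable2 fi.
exact: ae_integrable1 fi.
Qed.

Lemma measurable_fubini_pt (i : 'I_2) (f : R * R -> \bar R) :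
  measurable_fun setT f -> (forall p, (0 <= f p)%E) ->
  measurable_fun setT (fun y => \int[mu]_x f (pt i x y))%E.
Proof.
move=> mf f0; rewrite /pt; case: (_ == ord0); first exact: measurable_fun_fubini_tonelli_G.
exact: measurable_fun_fubini_tonelli_F.
Qed.

(** By Tonelli for the indicator of a null set, almost every slice of a null set is null. *)
Lemma ae_pt (i : 'I_2) (P : R * R -> Prop) : {ae leb2 R, forall p, P p} ->
  {ae mu, forall y, {ae mu, forall x, P (pt i x y)}}.
Proof.
move=> [A [mA A0 PA]].
have m1 : measurable_fun setT (EFin \o \1_A : R * R -> \bar R).
  by apply/measurable_EFinP; exact: measurable_indic.
have h0 p : (0 <= (EFin \o \1_A : R * R -> \bar R) p)%E by rewrite lee_fin.
have := fubini_tonelli_pt i m1 h0.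
rewrite integral_indic// setIT [X in X = _]A0 => /esym h.
have m2 := measurable_fubini_pt i m1 h0.
have : ae_eq mu setT (fun y => \int[mu]_x (\1_A (pt i x y))%:E)%E (cst 0%E).
  apply/ae_eq_integral_abs => //; rewrite -[RHS]h; apply: eq_integral => y _.
  by rewrite gee0_abs//; apply: integral_ge0.
apply: filterS => y /(_ I) hy.
exists ((fun x => pt i x y) @^-1` A); split.
- by rewrite -[X in measurable X]setTI; exact: measurable_ptl.
- have mB : measurable ((fun x => pt i x y) @^-1` A).
    by rewrite -[X in measurable X]setTI; exact: measurable_ptl.
  by have := integral_indic mu measurableT mB; rewrite setIT => <-.
- by move=> x /=; exact: PA.
Qed.

End PlaneMeasure.

Lemma cvg_cst_eq (R : realType) (u : nat -> R) (l c : R) :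
  u n @[n --> \oo] --> l -> (forall n, u n = c) -> l = c.
Proof.
move=> ul uc; apply: (cvg_unique _ ul) => //.
by rewrite (_ : u = (fun=> c)); [exact: cvg_cst|apply/funext].
Qed.

Section RealIntegral.
Context d (T : measurableType d) (R : realType) (m : {measure set T -> \bar R}).
Implicit Types (A : set T) (f g : T -> R).

Lemma ae_eq_Rintegral A f g : measurable A ->
  measurable_fun A f -> measurable_fun A g ->
  {ae m, forall x, A x -> f x = g x} -> \int[m]_(x in A) f x = \int[m]_(x in A) g x.
Proof.
move=> mA mf mg fg; rewrite /Rintegral; congr fine; apply: ae_eq_integral => //.
- exact/measurable_EFinP.
- exact/measurable_EFinP.
- by apply: filterS fg => x fgx Ax; rewrite fgx.
Qed.

Lemma EFin_Rintegral A f : measurable A -> m.-integrable A (EFin \o f) ->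
  (\int[m]_(x in A) f x)%:E = (\int[m]_(x in A) (f x)%:E)%E.
Proof. by move=> mA fi; rewrite fineK//; exact: integrable_fin_num. Qed.

Lemma integrable_bounded_mul A f g (C : R) : measurable A ->
  m.-integrable A (EFin \o f) -> measurable_fun A g ->
  (forall x, A x -> `|g x| <= C) -> m.-integrable A (EFin \o (fun x => f x * g x)).
Proof.
move=> mA fi mg gC; have mf : measurable_fun A f by apply/measurable_EFinP; exact: measurable_int fi.
apply: (@le_integrable _ _ _ _ _ mA _ (EFin \o (fun x => C * `|f x|))).
- by apply/measurable_EFinP; exact: measurable_funM.
- move=> x Ax /=; rewrite lee_fin normrM [`|C * _|]ger0_norm ?mulr_ge0//.
    by rewrite mulrC ler_wpM2r// gC.
  exact: le_trans (gC _ Ax).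
- by apply: eq_integrable (integrableZl mA C (integrable_norm fi)).
Qed.

Lemma integrable_RD A f g : measurable A ->
  m.-integrable A (EFin \o f) -> m.-integrable A (EFin \o g) -> m.-integrable A (EFin \o (fun x => f x + g x)).
Proof. by move=> mA fi gi; apply: eq_integrable (integrableD mA fi gi). Qed.

Lemma integrable_RB A f g : measurable A ->
  m.-integrable A (EFin \o f) -> m.-integrable A (EFin \o g) -> m.-integrable A (EFin \o (fun x => f x - g x)).
Proof. by move=> mA fi gi; apply: eq_integrable (integrableB mA fi gi). Qed.

Lemma integrable_RZ A f (k : R) : measurable A ->
  m.-integrable A (EFin \o f) -> m.-integrable A (EFin \o (fun x => k * f x)).
Proof. by move=> mA fi; apply: eq_integrable (integrableZl mA k fi). Qed.

Lemma integrable_mkcondR A f : measurable A ->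
  m.-integrable A (EFin \o f) <-> m.-integrable setT (EFin \o (f \_ A)).
Proof.
by move=> mA; rewrite -restrict_EFin; exact: integrable_mkcond.
Qed.
Lemma Rdominated_convergence A (f_ : nat -> T -> R) f g : measurable A ->
  (forall n, measurable_fun A (f_ n)) -> measurable_fun A f ->
  {ae m, forall x, A x -> f_ n x @[n --> \oo] --> f x} ->
  m.-integrable A (EFin \o g) ->
  {ae m, forall x, forall n, A x -> `|f_ n x| <= g x} ->
  [/\ m.-integrable A (EFin \o f),
      \int[m]_(x in A) `|f_ n x - f x| @[n --> \oo] --> 0
    & \int[m]_(x in A) f_ n x @[n --> \oo] --> \int[m]_(x in A) f x].
Proof.
move=> mA mf_ mf fnf gi fg.
have fnf' : {ae m, forall x, A x -> (EFin \o f_ n) x @[n --> \oo] --> (EFin \o f) x}.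
  by apply: aeS fnf => x h Ax; apply: cvg_EFin; [exact: nearW|exact: h].
have fg' : {ae m, forall x, forall n, A x -> (`|(EFin \o f_ n) x| <= (EFin \o g) x)%E}.
  by apply: aeS fg => x h n Ax; rewrite /= lee_fin; exact: h.
have mfn' n : measurable_fun A (EFin \o f_ n) by apply/measurable_EFinP.
have mf' : measurable_fun A (EFin \o f) by apply/measurable_EFinP.
have [fi c1 c2] := @dominated_convergence _ _ _ m A mA (fun n => EFin \o f_ n) (EFin \o f) (EFin \o g) mfn' mf' fnf' gi fg'.
split => //.
  have : (\int[m]_(x in A) (`|f_ n x - f x|)%:E)%E @[n --> \oo] --> (0 : R)%:E by exact: c1.
  exact: fine_cvg.
have : (\int[m]_(x in A) (f_ n x)%:E)%E @[n --> \oo] --> (\int[m]_(x in A) f x)%:E.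
  by rewrite EFin_Rintegral.
exact: fine_cvg.
Qed.
End RealIntegral.

Section Line.
Variable R : realType.
Local Notation mu := (@lebesgue_measure R).

Lemma Rfubini_pt (i : 'I_2) (f : R * R -> R) :
  (leb2 R).-integrable setT (EFin \o f) ->
  \int[leb2 R]_p f p = \int[mu]_y \int[mu]_x f (pt i x y).
Proof.
move=> fi; have mf := measurable_int _ fi.
rewrite /Rintegral (fubini_pt i fi); congr fine.
have aei := ae_integrable_pt i fi.
have mG : measurable_fun setT (fun y => \int[mu]_x (EFin \o f) (pt i x y))%E.
  rewrite /pt; case: (_ == ord0); first exact: measurable_fubini_G fi.
  exact: measurable_fubini_F fi.
apply: ae_eq_integral => //.
  by apply/measurable_EFinP; apply: measurableT_comp mG.
apply: (aeS _ aei) => y yi _ /=; rewrite fineK//.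
exact: integrable_fin_num.
Qed.

Lemma integrable_tensor (f g : R -> R) :
  mu.-integrable setT (EFin \o f) -> mu.-integrable setT (EFin \o g) ->
  (leb2 R).-integrable setT (EFin \o (fun p : R * R => f p.1 * g p.2)).
Proof.
move=> fi gi.
have mf : measurable_fun setT f by apply/measurable_EFinP; exact: measurable_int fi.
have mg : measurable_fun setT g by apply/measurable_EFinP; exact: measurable_int gi.
have mfg : measurable_fun setT (fun p : R * R => f p.1 * g p.2).
  by apply: measurable_funM; [apply: (measurableT_comp mf)|apply: (measurableT_comp mg)].
apply/(integrable_ptP ord0); first exact/measurable_EFinP.
rewrite /pt eqxx /=.
under eq_integral => y _.
  under eq_integral => x _ do rewrite normrM EFinM.
  rewrite integralZr//; last exact: (integrable_norm fi).
  over.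
rewrite /= -(EFin_Rintegral measurableT); last exact: (integrable_norm fi).
rewrite integralZl//; last exact: (integrable_norm gi).
rewrite -(EFin_Rintegral measurableT); last exact: (integrable_norm gi).
by rewrite ltry.
Qed.

Lemma Rintegral_itvoc (a x : R) (f : R -> R) : mu.-integrable `[a, x] (EFin \o f) ->
  \int[mu]_(t in `[a, x[) f t = \int[mu]_(t in `[a, x]) f t.
Proof. by move=> fi; apply: Rintegral_itv_bndo_bndc; apply: integrableS fi => //; apply: subset_itvl; rewrite bnd_simp. Qed.

Lemma indefinite_continuous (a b : R) (f : R -> R) : a <= b ->
  mu.-integrable `[a, b] (EFin \o f) ->
  {within `[a, b], continuous (fun x => \int[mu]_(t in `[a, x]) f t)}.
Proof. by move=> ab fi; exact: parameterized_integral_continuous. Qed.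

Lemma indefinite_bounded (a b : R) (f : R -> R) : 
  mu.-integrable `[a, b] (EFin \o f) ->
  forall x, x <= b -> `|\int[mu]_(t in `[a, x]) f t| <= \int[mu]_(t in `[a, b]) `|f t|.
Proof.
move=> fi x xb; have sub : `[a, x] `<=` `[a, b] by apply: subset_itvl; rewrite bnd_simp.
have fi' : mu.-integrable `[a, x] (EFin \o f) by apply: integrableS fi.
apply: le_trans (le_normr_Rintegral _ fi') _ => //.
rewrite -lee_fin EFin_Rintegral//; last exact: integrable_norm.
rewrite EFin_Rintegral//; last exact: (integrable_norm fi).
apply: ge0_subset_integral => //.
by apply/measurable_EFinP; apply: measurableT_comp => //; apply/measurable_EFinP; exact: measurable_int fi.
Qed.

(** The product of the integrals is the integral of f(x) g(y) over a square; cutting the square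
    along the diagonal and applying Fubini to each triangle gives integration by parts with merely
    integrable densities. *)
Lemma indefinite_prod (a b : R) (f g : R -> R) : a <= b ->
  mu.-integrable `[a, b] (EFin \o f) -> mu.-integrable `[a, b] (EFin \o g) ->
  (\int[mu]_(t in `[a, b]) f t) * (\int[mu]_(t in `[a, b]) g t) =
  \int[mu]_(t in `[a, b]) (f t * \int[mu]_(s in `[a, t]) g s) +
  \int[mu]_(t in `[a, b]) (g t * \int[mu]_(s in `[a, t]) f s).
Proof.
move=> ab fi gi.
pose f0 : R -> R := f \_ `[a, b]; pose g0 : R -> R := g \_ `[a, b].
have f0i : mu.-integrable setT (EFin \o f0) by exact: (integrable_mkcondR mu f (measurable_itv _)).1 fi.
have g0i : mu.-integrable setT (EFin \o g0) by exact: (integrable_mkcondR mu g (measurable_itv _)).1 gi.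
pose H (p : R * R) := f0 p.1 * g0 p.2.
have Hi : (leb2 R).-integrable setT (EFin \o H) by exact: integrable_tensor.
have mle : measurable [set p : R * R | p.1 <= p.2].
  rewrite -[X in measurable X]setTI; exact: measurable_fun_le.
have mlt : measurable [set p : R * R | p.2 < p.1].
  rewrite (_ : [set _ | _] = ~` [set p : R * R | p.1 <= p.2]); first exact: measurableC.
  by apply/seteqP; split => p /=; rewrite ltNge => /negP.
pose H1 := H \_ [set p : R * R | p.1 <= p.2].
pose H2 := H \_ [set p : R * R | p.2 < p.1].
have H1i : (leb2 R).-integrable setT (EFin \o H1).
  by apply: (@integrable_mkcondR _ _ _ (leb2 R) _ H mle).1; apply: integrableS Hi.
have H2i : (leb2 R).-integrable setT (EFin \o H2).
  by apply: (@integrable_mkcondR _ _ _ (leb2 R) _ H mlt).1; apply: integrableS Hi.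
have HE : H = (fun p => H1 p + H2 p).
  apply/funext => p; rewrite /H1 /H2 !patchE.
  have [le|lt] := leP p.1 p.2.
    rewrite mem_set// memNset/= ?addr0//.
    by apply/negP; rewrite -leNgt.
  rewrite memNset/= ?add0r ?mem_set//.
  by apply/negP; rewrite -ltNge.
have -> : (\int[mu]_(t in `[a, b]) f t) * (\int[mu]_(t in `[a, b]) g t) = \int[leb2 R]_p H p.
  rewrite (Rfubini_pt ord0 Hi) /pt eqxx /H /=.
  transitivity (\int[mu]_y ((\int[mu]_x f0 x) * g0 y)).
    by rewrite RintegralZl//; congr (_ * _); rewrite [LHS]Rintegral_mkcond.
  by apply: eq_Rintegral => y _; rewrite RintegralZr.
(* The triangle below the diagonal is sliced so that f is outside; as the diagonal belongs to the
   other triangle, the inner interval is half-open there. *)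
rewrite HE RintegralD//= addrC; congr (_ + _).
  rewrite (Rfubini_pt (lift ord0 ord0) H2i) /pt /= [RHS]Rintegral_mkcond.
  apply: eq_Rintegral => t _; rewrite patchE.
  case: ifPn => [/set_mem /=|tab].
    rewrite in_itv /= => /andP[at' tb].
    have gti : mu.-integrable `[a, t] (EFin \o g) by apply: integrableS gi => //; apply: subset_itvl; rewrite bnd_simp.
    rewrite -(Rintegral_itvoc gti) -RintegralZl//; last by apply: integrableS gti => //; apply: subset_itvl; rewrite bnd_simp.
    rewrite [RHS]Rintegral_mkcond; apply: eq_Rintegral => s _.
    rewrite /H2 /H /f0 /g0 !patchE /=.
    rewrite (_ : (t \in _) = true); last by apply: mem_set; rewrite /= in_itv/= at' tb.
    have [st|st] := ltP s t.
      rewrite mem_set//; have [as'|as'] := leP a s.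
        by rewrite !mem_set//= in_itv/= as' ?st// (le_trans (ltW st)).
      by rewrite !memNset ?mulr0//= in_itv/= leNgt as'.
    rewrite memNset /=; last by apply/negP; rewrite -leNgt.
    by rewrite memNset//= in_itv/= ltNge st andbF.
  rewrite (_ : (fun x => _) = cst 0); first by rewrite Rintegral_cst// mul0r.
  apply/funext => s; rewrite /H2 /H /f0 patchE; case: ifP => // _ /=.
  by rewrite patchE (negbTE tab) mul0r.
rewrite (Rfubini_pt ord0 H1i) /pt /= [RHS]Rintegral_mkcond.
apply: eq_Rintegral => t _; rewrite patchE.
case: ifPn => [/set_mem /=|tab].
  rewrite in_itv /= => /andP[at' tb].
  have fti : mu.-integrable `[a, t] (EFin \o f) by apply: integrableS fi => //; apply: subset_itvl; rewrite bnd_simp.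
  rewrite -RintegralZl//.
  rewrite [RHS]Rintegral_mkcond; apply: eq_Rintegral => s _.
  rewrite /H1 /H /f0 /g0 !patchE /=.
  rewrite (_ : (t \in _) = true); last by apply: mem_set; rewrite /= in_itv/= at' tb.
  have [st|st] := leP s t.
    rewrite mem_set//; have [as'|as'] := leP a s.
      by rewrite !mem_set//= ?in_itv/= ?as' ?st// ?(le_trans st)// mulrC.
    by rewrite !memNset ?mul0r//= in_itv/= leNgt as'.
  have sN : (s \in `[a, t]%classic) = false by rewrite mem_setE in_itv/= (leNgt s) st andbF.
  by rewrite sN memNset //=; apply/negP; rewrite -ltNge.
rewrite (_ : (fun x => _) = cst 0); first by rewrite Rintegral_cst// mul0r.
apply/funext => s; rewrite /H1 /H /g0 patchE; case: ifP => // _ /=.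
by rewrite patchE (negbTE tab) mulr0.
Qed.
Lemma measurable_indefinite (a b : R) (f : R -> R) : a <= b ->
  mu.-integrable `[a, b] (EFin \o f) ->
  measurable_fun `[a, b] (fun x => \int[mu]_(t in `[a, x]) f t).
Proof.
move=> ab fi; apply: subspace_continuous_measurable_fun => //.
exact: indefinite_continuous fi.
Qed.

Lemma integrable_mul_indefinite (a b c : R) (f g : R -> R) : a <= b ->
  mu.-integrable `[a, b] (EFin \o f) -> mu.-integrable `[a, b] (EFin \o g) ->
  mu.-integrable `[a, b] (EFin \o (fun t => f t * (c + \int[mu]_(s in `[a, t]) g s))).
Proof.
move=> ab fi gi.
apply: (@integrable_bounded_mul _ _ _ _ _ _ _ (`|c| + \int[mu]_(t in `[a, b]) `|g t|)) => //.
  by apply: measurable_funD => //; exact: measurable_indefinite.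
move=> x /=; rewrite in_itv/= => /andP[_ xb].
by apply: le_trans (ler_normD _ _) _; rewrite lerD2l; exact: indefinite_bounded.
Qed.

(** The product rule for absolutely continuous functions in integral form. The weak Leibniz rule and
    the integration by parts against test functions both reduce to it on lines. *)
Lemma ac_prod (a b c d : R) (f g : R -> R) : a <= b ->
  mu.-integrable `[a, b] (EFin \o f) -> mu.-integrable `[a, b] (EFin \o g) ->
  (c + \int[mu]_(t in `[a, b]) f t) * (d + \int[mu]_(t in `[a, b]) g t) =
  c * d + \int[mu]_(t in `[a, b]) (f t * (d + \int[mu]_(s in `[a, t]) g s) +
     g t * (c + \int[mu]_(s in `[a, t]) f s)).
Proof.
move=> ab fi gi.
rewrite RintegralD//; [|exact: integrable_mul_indefinite|exact: integrable_mul_indefinite].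
have H (h k : R -> R) (e : R) : mu.-integrable `[a, b] (EFin \o h) -> mu.-integrable `[a, b] (EFin \o k) ->
  \int[mu]_(t in `[a, b]) (h t * (e + \int[mu]_(s in `[a, t]) k s)) =
  e * \int[mu]_(t in `[a, b]) h t + \int[mu]_(t in `[a, b]) (h t * \int[mu]_(s in `[a, t]) k s).
  move=> hi ki; under eq_Rintegral do rewrite mulrDr [_ * e]mulrC.
  rewrite RintegralD//; first by rewrite RintegralZl.
    by apply: integrable_RZ.
  have := integrable_mul_indefinite 0 ab hi ki.
  by congr (_.-integrable _ _); apply/funext => t /=; rewrite add0r.
rewrite H// H// mulrDl mulrDr mulrDr (indefinite_prod ab fi gi); ring.
Qed.
End Line.

(** * Smooth test functions *)

Section Smooth.
Variable R : realType.
Local Notation mu := (@lebesgue_measure R).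

(** The derivative is a witness rather than a derivation operator, so that closure under sums,
    products and compositions is a plain induction. *)
Fixpoint smoothk (k : nat) (f : R -> R) : Prop :=
  match k with
  | 0 => continuous f
  | k'.+1 => exists f', (forall x, is_derive x (1 : R) f (f' x)) /\ smoothk k' f'
  end.

Lemma is_derive_continuous (f f' : R -> R) : (forall x, is_derive x (1 : R) f (f' x)) -> continuous f.
Proof. by move=> df x; apply: differentiable_continuous; apply/derivable1_diffP. Qed.

Lemma smoothkW k f : smoothk k.+1 f -> smoothk k f.
Proof.
elim: k f => [|k IH] f [f' [df]]; first by move=> _; exact: is_derive_continuous df.
by move=> sf; exists f'; split => //; exact: IH.
Qed.

Lemma smoothk_continuous k f : smoothk k f -> continuous f.
Proof. by case: k => [//|k [f' [df _]]]; exact: is_derive_continuous df. Qed.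

Lemma smoothkD k f g : smoothk k f -> smoothk k g -> smoothk k (fun x => f x + g x).
Proof.
elim: k f g => [|k IH] f g; first by move=> cf cg x; exact: cvgD (cf x) (cg x).
move=> [f' [df sf]] [g' [dg sg]]; exists (fun x => f' x + g' x); split; last exact: IH.
by move=> x; exact: is_deriveD.
Qed.

Lemma smoothk_cst k (c : R) : smoothk k (fun=> c).
Proof.
elim: k c => [|k IH] c; first by move=> x; exact: cvg_cst.
by exists (fun=> 0); split => // x; exact: is_derive_cst.
Qed.

Lemma smoothkM k f g : smoothk k f -> smoothk k g -> smoothk k (fun x => f x * g x).
Proof.
elim: k f g => [|k IH] f g; first by move=> cf cg x; exact: cvgM (cf x) (cg x).
move=> sf sg; move: (smoothkW sf) (smoothkW sg) => sf0 sg0.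
case: sf => f' [df sf]; case: sg => g' [dg sg].
exists (fun x => f x * g' x + g x * f' x); split.
  by move=> x; exact: is_deriveM.
by apply: smoothkD; exact: IH.
Qed.

Lemma smoothk_exp k f : smoothk k f -> smoothk k (fun x => expR (f x)).
Proof.
elim: k f => [|k IH] f; first by move=> cf x; apply: continuous_comp; [exact: cf|exact: continuous_expR].
move=> sf; have sf0 := smoothkW sf; case: sf => f' [df sf].
exists (fun x => f' x * expR (f x)); split; last by apply: smoothkM => //; exact: IH.
move=> x; rewrite mulrC; exact: (@is_derive1_comp _ expR f).
Qed.

Lemma smoothk_affine k f (c d : R) : smoothk k f -> smoothk k (fun x => f (c * x + d)).
Proof.
have da x : is_derive x (1 : R) (fun x => c * x + d) c.
  have -> : (fun x => c * x + d) = (c \*: (id : R -> R)) + cst d :> (R -> R) by apply/funext.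
  by apply: is_derive_eq; rewrite addr0 /GRing.scale /= mulr1.
elim: k f => [|k IH] f.
  by move=> cf x; apply: (@continuous_comp _ _ _ (fun x => c * x + d) f); [exact: is_derive_continuous da x|exact: cf].
move=> [f' [df sf]]; exists (fun x => f' (c * x + d) * c); split; last first.
  by apply: smoothkM; [exact: IH|exact: smoothk_cst].
by move=> x; exact: (@is_derive1_comp _ f (fun x => c * x + d)).
Qed.

(** The factors x^-n are included because this family, unlike exp(-1/x) alone, is closed under
    differentiation up to linear combinations. *)
Definition flat (n : nat) (x : R) : R := if 0 < x then x^-1 ^+ n * expR (- x^-1) else 0.

Lemma flat_ge0 n x : 0 <= flat n x.
Proof.
rewrite /flat; case: ifPn => // x0.
by rewrite mulr_ge0 ?expR_ge0// exprn_ge0// invr_ge0 ltW.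
Qed.

(** For positive h this is x^(n+1) / (n+1)! <= exp x at x = 1/h. As the difference quotient of
    [flat n] at 0 is [flat n.+1] on the right and 0 on the left, this linear bound gives the
    derivative 0 there. *)
Lemma flat_le n h : flat n h <= (n.+1)`!%:R * `|h|.
Proof.
rewrite /flat; case: ifPn => h0; last by rewrite mulr_ge0.
rewrite gtr0_norm// expRN ler_pdivrMr ?expR_gt0//.
have hi0 : 0 <= h^-1 by rewrite invr_ge0 ltW.
have h1 := expR_ge1Dxn n hi0.
have f0 : 0 < (n.+1)`!%:R :> R by rewrite ltr0n fact_gt0.
have : h^-1 ^+ n.+1 <= (n.+1)`!%:R * expR h^-1.
  rewrite mulrC -ler_pdivrMr//; apply: le_trans h1; by rewrite lerDr.
rewrite exprSr => h2; rewrite mulrAC -ler_pdivrMr//.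
Qed.

Lemma is_derive_flat n x : is_derive x (1 : R) (flat n) (flat n.+2 x - n%:R * flat n.+1 x).
Proof.
have [x0|x0|x0] := ltgtP x 0.
- rewrite /flat !(ltNge 0) ltW//= mulr0 subr0.
  have h0 : is_derive x (1 : R) (cst 0 : R -> R) 0 by exact: is_derive_cst.
  apply: near_eq_is_derive h0.
  near=> y; rewrite ifF//; apply/negbTE; rewrite -leNgt ltW//.
  by near: y; exact: lt_nbhsl.
- have nE : \near x, (fun y : R => y^-1 ^+ n * expR (- y^-1)) x = flat n x.
    near=> y; rewrite /flat ifT//.
    by near: y; exact: lt_nbhsr.
  have xn0 : x != 0 by rewrite gt_eqF.
  have dV : is_derive x (1 : R) (fun y : R => y^-1) (- x ^- 2).
    have := @is_deriveV R id x 1 1 xn0 (is_derive_id _ _).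
    by rewrite /GRing.scale /= mulr1.
  have dE : is_derive x (1 : R) (fun y => expR (- y^-1)) (expR (- x^-1) * x ^- 2).
    have dN : is_derive x (1 : R) (fun y : R => - y^-1) (x ^- 2).
      by have := @is_deriveN _ _ _ (fun y : R => y^-1) x 1 _ dV; rewrite opprK.
    exact: (@is_derive1_comp _ expR (fun y : R => - y^-1)).
  have dX : is_derive x (1 : R) (fun y : R => y^-1 ^+ n) ((n%:R * x^-1 ^+ n.-1) *: (- x ^- 2)).
    have h := @is_deriveX _ _ (fun y : R => y^-1) n x 1 _ dV.
    rewrite -mulr_natl mulr1 in h.
    have -> : (fun y : R => y^-1 ^+ n) = (fun y : R => y^-1) ^+ n by apply/funext => y; rewrite exprfctE.
    exact: h.
  have dM := @is_deriveM _ _ _ _ _ _ _ _ dX dE.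
  apply: (near_eq_is_derive nE); apply: (is_derive_eq dM); rewrite /flat x0 /GRing.scale /=.
  rewrite -!exprVn; case: n {dX nE dM} => [|n] /=; rewrite !exprS ?expr0; ring.
- rewrite x0 [in X in is_derive _ _ _ X]/flat ltxx mulr0 subr0.
  suff : h^-1 *: (flat n (h *: (1:R) + 0) - flat n 0) @[h --> 0^'] --> (0 : R).
    move=> h; split; first by apply/cvg_ex; exists 0.
    exact: cvg_lim h.
  apply/cvgr0Pnorm_lt => e e0; near=> h.
  have h0 : h != 0 by near: h; exact: nbhs_dnbhs_neq.
  have le : `|h^-1 *: (flat n (h *: (1:R) + 0) - flat n 0)| <= (n.+2)`!%:R * `|h|.
    rewrite [flat n 0]/flat ltxx subr0 addr0 /GRing.scale /= mulr1.
    have [hp|hn] := ltP 0 h.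
      have -> : h^-1 * flat n h = flat n.+1 h by rewrite /flat hp mulrA -exprS.
      by rewrite ger0_norm ?flat_ge0// flat_le.
    by rewrite /flat ltNge hn /= mulr0 normr0 mulr_ge0.
  apply: le_lt_trans le _; rewrite mulrC -ltr_pdivlMr ?ltr0n ?fact_gt0//.
  by near: h; apply: dnbhs0_lt; rewrite divr_gt0// ltr0n fact_gt0.
Unshelve. all: by end_near. Qed.

Lemma smoothk_flat k n : smoothk k (flat n).
Proof.
elim: k n => [|k IH] n; first exact: is_derive_continuous (is_derive_flat n).
exists (fun x => flat n.+2 x - n%:R * flat n.+1 x); split; first exact: is_derive_flat.
have -> : (fun x => flat n.+2 x - n%:R * flat n.+1 x) = (fun x => flat n.+2 x + (- n%:R) * flat n.+1 x).
  by apply/funext => x; rewrite mulNr.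
by apply: smoothkD => //; apply: smoothkM => //; exact: smoothk_cst.
Qed.

Definition hump (a b x : R) : R := flat 0 (x - a) * flat 0 (b - x).

Lemma smoothk_hump k a b : smoothk k (hump a b).
Proof.
apply: smoothkM.
  have := smoothk_affine 1 (- a) (smoothk_flat k 0).
  by congr smoothk; apply/funext => x; rewrite mul1r.
have := smoothk_affine (-1) b (smoothk_flat k 0).
by congr smoothk; apply/funext => x; rewrite mulN1r addrC.
Qed.

Lemma hump_ge0 a b x : 0 <= hump a b x.
Proof. by rewrite mulr_ge0// flat_ge0. Qed.

Lemma flat_gt0 n x : 0 < x -> 0 < flat n x.
Proof. by move=> x0; rewrite /flat x0 mulr_gt0 ?expR_gt0// exprn_gt0// invr_gt0. Qed.

Lemma hump_gt0 a b x : a < x -> x < b -> 0 < hump a b x.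
Proof. by move=> ax xb; rewrite mulr_gt0// flat_gt0// subr_gt0. Qed.

Lemma hump_out a b x : x <= a \/ b <= x -> hump a b x = 0.
Proof.
move=> [xa|bx]; rewrite /hump /flat.
  by rewrite (ltNge 0 (x - a)) subr_le0 xa/= mul0r.
by rewrite (ltNge 0 (b - x)) subr_le0 bx/= mulr0.
Qed.

(** Smooth functions with values in [0, 1] that vanish outside ]a, b[ and tend pointwise to its
    indicator as n grows; dominated convergence then turns weak identities into statements on
    rectangles. *)
Definition plateau (a b : R) (n : nat) (x : R) : R := 1 - expR (- (n%:R * hump a b x)).

Lemma smoothk_plateau k a b n : smoothk k (plateau a b n).
Proof.
have -> : plateau a b n = (fun x => 1 + (-1) * expR ((- n%:R) * hump a b x)).
  by apply/funext => x; rewrite /plateau mulN1r mulNr.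
apply: smoothkD; first exact: smoothk_cst.
apply: smoothkM; first exact: smoothk_cst.
by apply: smoothk_exp; apply: smoothkM; [exact: smoothk_cst|exact: smoothk_hump].
Qed.

Lemma plateau_bounds a b n x : 0 <= plateau a b n x <= 1.
Proof.
rewrite subr_ge0 gerBl expR_ge0 andbT -[leRHS]expR0 ler_expR oppr_le0.
by rewrite mulr_ge0// hump_ge0.
Qed.

Lemma plateau_out a b n x : x <= a \/ b <= x -> plateau a b n x = 0.
Proof. by move=> h; rewrite /plateau hump_out// mulr0 oppr0 expR0 subrr. Qed.

Lemma plateau_cvg a b x : plateau a b n x @[n --> \oo] --> (\1_`]a, b[ x : R).
Proof.
rewrite indicE; have [xab|xab] := boolP (x \in _).
  move: xab; rewrite inE /= in_itv /= => /andP[ax xb].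
  have bp := hump_gt0 ax xb.
  rewrite -[X in _ --> X]subr0; apply: cvgB; first exact: cvg_cst.
  have h : n%:R * hump a b x @[n --> \oo] --> +oo.
      exact: (cvg_comp _ _ cvgr_idn (gt0_cvgMly bp cvg_id)).
  exact: (cvg_comp _ _ h (@cvgr_expR R)).
have -> : (fun n => plateau a b n x) = (fun=> 0).
  apply/funext => n; apply: plateau_out.
  have [xa|ax] := leP x a; [by left|right; rewrite leNgt; apply: contra xab => xb].
  by rewrite inE /= in_itv /= ax.
exact: cvg_cst.
Qed.

Lemma smoothk_antiderivative (f : R -> R) (a b : R) :
  (forall k, smoothk k f) -> (forall x, x <= a -> f x = 0) ->
  exists F : R -> R, [/\ forall k, smoothk k F, forall x, is_derive x (1 : R) F (f x),
    forall x, x <= a -> F x = 0 & forall x, F x = \int[mu]_(t in `[a, x]) f t].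
Proof.
move=> sf f0; have cf := sf 0.
(* The base point lies strictly to the left of a, so that the fundamental theorem also applies at x
   = a; f vanishes on the added piece. *)
pose F x := \int[mu]_(t in `[(a - 1), x]) f t.
have fi c d : mu.-integrable `[c, d] (EFin \o f).
  by apply: continuous_compact_integrable; [exact: segment_compact|exact: continuous_subspaceT].
have F0 x : x <= a -> F x = 0.
  move=> xa; rewrite /F (_ : Rintegral _ _ _ = \int[mu]_(t in `[(a - 1), x]) 0).
    by rewrite Rintegral_cst// mul0r.
  apply: eq_Rintegral => t; rewrite inE /= in_itv /= => /andP[_ tx].
  by rewrite f0// (le_trans tx).
have dF x : is_derive x (1 : R) F (f x).
  have [xa|ax] := ltP x a.
    rewrite f0; last exact: ltW.
    have h0 : is_derive x (1 : R) (cst 0 : R -> R) 0 by exact: is_derive_cst.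
    apply: near_eq_is_derive h0.
    near=> y; rewrite F0//; apply: ltW.
    by near: y; exact: lt_nbhsl.
  have ax1 : a - 1 < x by rewrite (lt_le_trans _ ax)// gtrBl.
  have xx1 : x < x + 1 by rewrite ltrDl.
  have [e1 e2] := continuous_FTC1_closed xx1 (fi _ _) ax1 (cf x).
  by split; [exact: e1|rewrite -derive1E].
have FE x : F x = \int[mu]_(t in `[a, x]) f t.
  rewrite /F [LHS]Rintegral_mkcond [RHS]Rintegral_mkcond; apply: eq_Rintegral => t _.
  rewrite !patchE; have [at'|ta] := leP a t.
    suff -> : (t \in `[(a - 1), x]%classic) = (t \in `[a, x]%classic) by [].
    by rewrite !mem_setE !in_itv /= at' (le_trans _ at')// gerBl.
  by rewrite f0 ?ltW//; do 2 case: ifP.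
exists F; split => //.
case=> [|k]; first exact: is_derive_continuous dF.
by exists f.
Unshelve. all: by end_near. Qed.
End Smooth.

(** * Fundamental lemma of the calculus of variations on rectangles *)

Section NullDynkin.
Context d (T : measurableType d) (R : realType) (m : {measure set T -> \bar R}).
Variable h : T -> R.
Hypothesis hi : m.-integrable setT (EFin \o h).
Let hiS (E : set T) : measurable E -> m.-integrable E (EFin \o h).
Proof. by move=> mE; apply: integrableS hi. Qed.

(** The sets over whose preimages in S the integral of h vanishes form a Dynkin system, the
    complement being covered by the vanishing of the integral over S itself. *)
Lemma null_integral_dynkin d' (U : measurableType d') (pr : T -> U) (G : set (set U)) (S : set T) :
  measurable_fun setT pr -> measurable S ->
  @measurable _ U = <<s G >> -> setI_closed G ->
  (\int[m]_(x in S) (h x)%:E = 0)%E ->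
  (forall B, G B -> \int[m]_(x in S `&` pr @^-1` B) (h x)%:E = 0)%E ->
  forall B, measurable B -> (\int[m]_(x in S `&` pr @^-1` B) (h x)%:E = 0)%E.
Proof.
move=> mpr mS GE GI S0 G0 B mB.
have mpB (C : set U) : measurable C -> measurable (S `&` pr @^-1` C).
  by move=> mC; apply: measurableI => //; rewrite -[X in measurable X]setTI; exact: mpr.
apply: (@dynkin_induction _ U G (fun B => \int[m]_(x in S `&` pr @^-1` B) (h x)%:E = 0)%E GE GI) => //.
- by rewrite preimage_setT setIT.
- move=> C mC C0.
  have : (\int[m]_(x in (S `&` pr @^-1` C) `|` (S `&` pr @^-1` (~` C))) (h x)%:E = 0)%E.
    by rewrite -setIUr -preimage_setU setUv preimage_setT setIT.
  rewrite integral_setU //=; last 4 first.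
  - exact: mpB.
  - by apply: mpB; exact: measurableC.
  - by rewrite -setIUr -preimage_setU setUv preimage_setT setIT; exact: (measurable_int _ (hiS mS)).
  - by apply/disj_setPS => x [[_ /= Cx] [_ /= nCx]].
  by rewrite [X in (X + _)%E]C0 add0e.
- move=> F mF tF F0; rewrite preimage_bigcup setI_bigcupr integral_bigcup.
  + by apply: eseries0 => n _ _; exact: F0.
  + apply/trivIsetP => i j _ _ ij.
    have /trivIsetP /(_ i j I I ij) := tF.
    by move=> e; rewrite setIACA setIid -preimage_setI e preimage_set0 setI0.
  + by move=> n; exact: mpB.
  + by apply: hiS; apply: bigcup_measurable => n _; exact: mpB.
- by rewrite -GE.
Qed.
End NullDynkin.

Section Fundamental.
Variable R : realType.
Local Notation mu := (@lebesgue_measure R).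

Lemma setI_closed_itvoo : setI_closed [set A : set R | exists x y, A = `]x, y[%classic].
Proof.
move=> A B [x1 [y1 ->]] [x2 [y2 ->]]; exists (Num.max x1 x2), (Num.min y1 y2).
apply/seteqP; split => z /=; rewrite !in_itv/= gt_max lt_min.
  by move=> [/andP[-> ->] /andP[-> ->]].
by move=> /andP[/andP[-> ->] /andP[-> ->]].
Qed.

(** Plateaus converge to indicators of subrectangles, so the integrals of h over these vanish; the
    passage to all measurable sets is a Dynkin argument, and a function whose integral vanishes over
    every measurable set is 0 almost everywhere. *)
Lemma fundamental_rect (h : R * R -> R) (a1 b1 a2 b2 : R) :
  let Q : set (R * R) := [set` `]a1, b1[%R] `*` [set` `]a2, b2[%R] in
  (leb2 R).-integrable Q (EFin \o h) ->
  (forall x1 x2 y1 y2 n, a1 <= x1 -> x2 <= b1 -> a2 <= y1 -> y2 <= b2 ->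
    \int[leb2 R]_(p in Q) (h p * (plateau x1 x2 n p.1 * plateau y1 y2 n p.2)) = 0) ->
  {ae leb2 R, forall p, Q p -> h p = 0}.
Proof.
move=> Q hi H.
have mQ : measurable (Q : set (measurableTypeR R * measurableTypeR R)).
  by apply: measurableX; exact: measurable_itv.
pose h0 : R * R -> R := h \_ Q.
have h0i : (leb2 R).-integrable setT (EFin \o h0) by exact: (@integrable_mkcondR _ _ _ (leb2 R) Q h mQ).1.
have mfst : measurable_fun setT (fst : R * R -> R) by exact: measurable_fst.
have msnd : measurable_fun setT (snd : R * R -> R) by exact: measurable_snd.
have mrect (A B : set R) : measurable A -> measurable B -> measurable (snd @^-1` B `&` fst @^-1` A : set (measurableTypeR R * measurableTypeR R)).
  by move=> mA mB; apply: measurableI; rewrite -[X in measurable X]setTI; [exact: msnd|exact: mfst].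
have cplateau a b n : continuous (plateau a b n) by exact: (smoothk_plateau 0 a b n).
have mpl (a b : R) n (pr : R * R -> R) : measurable_fun setT pr -> measurable_fun setT (fun p => plateau a b n (pr p)).
  by move=> mpr; apply: measurableT_comp mpr; exact: continuous_measurable_fun.
have rect0' x1 x2 y1 y2 : a1 <= x1 -> x2 <= b1 -> a2 <= y1 -> y2 <= b2 ->
    (\int[leb2 R]_(p in snd @^-1` `]y1, y2[ `&` fst @^-1` `]x1, x2[) (h0 p)%:E = 0)%E.
  move=> h1 h2 h3 h4.
  have mE := mrect _ _ (measurable_itv `]x1, x2[) (measurable_itv `]y1, y2[).
  set E := (X in measurable X) in mE.
  pose fn n (p : R * R) := h p * (plateau x1 x2 n p.1 * plateau y1 y2 n p.2).
  pose f (p : R * R) := h p * (\1_`]x1, x2[ p.1 * \1_`]y1, y2[ p.2).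
  have mh : measurable_fun Q h by apply/measurable_EFinP; exact: measurable_int hi.
  have mfn n : measurable_fun Q (fn n).
    apply: measurable_funM => //; apply: (@measurable_funS _ _ _ _ setT) => //.
    by apply: measurable_funM; exact: mpl.
  have mf : measurable_fun Q f.
    apply: measurable_funM => //; apply: (@measurable_funS _ _ _ _ setT) => //.
    by apply: measurable_funM; apply: measurableT_comp => //; exact: measurable_indic.
  have fnf : {ae leb2 R, forall p, Q p -> fn n p @[n --> \oo] --> f p}.
    apply: aeW => p _.
    by apply: cvgM; [exact: cvg_cst|apply: cvgM; exact: plateau_cvg].
  have dom : {ae leb2 R, forall p n, Q p -> `|fn n p| <= `|h p|}.
    apply: aeW => p n _; rewrite /fn normrM ler_piMr//.
    have /andP[p1 p2] := plateau_bounds x1 x2 n p.1.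
    have /andP[p3 p4] := plateau_bounds y1 y2 n p.2.
    by rewrite ger0_norm ?mulr_ge0// mulr_ile1.
  have [fi _ cv] := @Rdominated_convergence _ _ _ (leb2 R) Q fn f (fun p => `|h p|) mQ mfn mf fnf (integrable_norm hi) dom.
  have z n : \int[leb2 R]_(p in Q) fn n p = 0 by exact: H.
  have : (\int[leb2 R]_(p in Q) (f p)%:E = 0)%E.
    rewrite -(EFin_Rintegral mQ fi); congr EFin.
    exact: cvg_cst_eq cv z.
  rewrite integral_mkcond => <-; rewrite [LHS]integral_mkcond; apply: eq_integral => p _.
  rewrite !patchE /f /h0 patchE.
  have -> : (p \in E) = (p.1 \in `]x1, x2[%classic) && (p.2 \in `]y1, y2[%classic).
    by apply/idP/andP; rewrite !inE => -[].
  rewrite !indicE; case: (p.1 \in _); case: (p.2 \in _); case: (p \in Q) => //=; rewrite ?mulr1 ?mulr0 ?mul0r ?mulr0//.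
(* Since [h0] vanishes outside Q, an arbitrary open rectangle may be cut down to Q. *)
have rect0 x1 x2 y1 y2 : (\int[leb2 R]_(p in snd @^-1` `]y1, y2[ `&` fst @^-1` `]x1, x2[) (h0 p)%:E = 0)%E.
  rewrite -(@rect0' (Num.max a1 x1) (Num.min x2 b1) (Num.max a2 y1) (Num.min y2 b2)); last 4 first.
  - by rewrite le_max lexx.
  - by rewrite ge_min lexx orbT.
  - by rewrite le_max lexx.
  - by rewrite ge_min lexx orbT.
  rewrite [LHS]integral_mkcond [RHS]integral_mkcond; apply: eq_integral => p _.
  rewrite !patchE /h0 patchE.
  have [pQ|pQ] := boolP (p \in Q); last by rewrite !if_same.
  congr (if _ then _ else _).
  move: pQ; rewrite inE /Q /= !in_itv/= => -[/andP[q1 q2] /andP[q3 q4]].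
  apply/idP/idP; rewrite !inE /= !in_itv /= !gt_max !lt_min q1 q2 q3 q4 ?andbT//.
(* The Dynkin argument is used three times: for the first coordinate, for the second one, and with
   the measurable rectangles as generators of the product sigma-algebra. *)
have GE := RGenOpens.measurableE R.
have S1 y1 y2 A : measurable A -> (\int[leb2 R]_(p in snd @^-1` `]y1, y2[ `&` fst @^-1` A) (h0 p)%:E = 0)%E.
  apply: (null_integral_dynkin h0i mfst _ GE setI_closed_itvoo).
  - by rewrite -[X in measurable X]setTI; exact: msnd.
  - rewrite -(rect0 a1 b1 y1 y2) [LHS]integral_mkcond [RHS]integral_mkcond; apply: eq_integral => p _.
    rewrite !patchE /h0 patchE.
    have [pQ|pQ] := boolP (p \in Q); last by rewrite !if_same.
    congr (if _ then _ else _).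
    by move: pQ; rewrite inE => -[/= q1 q2]; apply/idP/idP; rewrite !inE /= => k; [split|case: k].
  - by move=> B [x1 [x2 ->]]; exact: rect0.
have S2 A B : measurable A -> measurable B -> (\int[leb2 R]_(p in fst @^-1` A `&` snd @^-1` B) (h0 p)%:E = 0)%E.
  move=> mA; apply: (null_integral_dynkin h0i msnd _ GE setI_closed_itvoo).
  - by rewrite -[X in measurable X]setTI; exact: mfst.
  - rewrite -(S1 a2 b2 A mA) [LHS]integral_mkcond [RHS]integral_mkcond; apply: eq_integral => p _.
    rewrite !patchE /h0 patchE.
    have [pQ|pQ] := boolP (p \in Q); last by rewrite !if_same.
    congr (if _ then _ else _).
    by move: pQ; rewrite inE => -[/= q1 q2]; apply/idP/idP; rewrite !inE /= => k; [split|case: k].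
  - by move=> C [x1 [x2 ->]]; rewrite setIC; apply: S1.
have S3 E : measurable E -> (\int[leb2 R]_(p in E) (h0 p)%:E = 0)%E.
  move=> mE; rewrite -[E]setTI -[E]preimage_id.
  apply: (@null_integral_dynkin _ _ _ _ _ h0i _ _ id [set A `*` B | A in measurable & B in measurable] setT _ _ _ _ _ _ _ mE) => //.
  - exact: measurable_prod_measurableType.
  - move=> _ _ [A1 mA1 [B1 mB1 <-]] [A2 mA2 [B2 mB2 <-]].
    exists (A1 `&` A2); first exact: measurableI.
    by exists (B1 `&` B2); [exact: measurableI|rewrite setXI].
  - by have := S2 setT setT measurableT measurableT; rewrite !preimage_setT setIT.
  - by move=> _ [A mA [B mB <-]]; rewrite setTI preimage_id; exact: S2.
have : ae_eq (leb2 R) setT (EFin \o h0) (cst 0%E).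
  apply: integral_ae_eq => // E _ mE.
  by rewrite integral0; exact: S3.
apply: aeS => p /(_ I) [hp] Qp; move: hp; rewrite /h0 patchE mem_set//.
Qed.
End Fundamental.

(** * Test functions of product form and the boundary behaviour of [pd] *)

Section Tests.
Variable R : realType.
Local Notation mu := (@lebesgue_measure R).
Local Notation D := (@disc R).
Implicit Types (f g phi : R * R -> R) (i : 'I_2) (p q : R * R).

Lemma pt_shift i (h x y : R) : h *: dir R i + pt i x y = pt i (h *: (1 : R) + x) y.
Proof.
rewrite /pt /dir; case: (i == ord0); congr pair => /=; rewrite /GRing.scale /= ?mulr0 ?add0r//.
Qed.

Lemma pt_surj i p : exists x y, p = pt i x y.
Proof. by case: p => a b; rewrite /pt; case: (i == ord0); [exists a, b|exists b, a]. Qed.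

Lemma derive_growth_pt i f (x y : R) :
  (fun h : R => h^-1 *: ((f \o shift (pt i x y)) (h *: dir R i) - f (pt i x y))) =
  (fun h : R => h^-1 *: (((fun t => f (pt i t y)) \o shift x) (h *: (1 : R)) - f (pt i x y))).
Proof. by apply/funext => h /=; rewrite pt_shift. Qed.

Lemma is_derive_ptP i f (x y d : R) :
  is_derive (pt i x y) (dir R i) f d <-> is_derive x (1 : R) (fun t => f (pt i t y)) d.
Proof.
by split=> -[df dd]; split; rewrite /derivable /derive in df dd *; rewrite ?derive_growth_pt// -?derive_growth_pt// in df dd *; rewrite -derive_growth_pt.
Qed.

Lemma pd_disc_ext i f g : (forall p, D p -> f p = g p) -> pd i f = pd i g.
Proof.
move=> fg; apply/funext => p; rewrite /pd; congr (lim _).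
have H : forall f g, (forall p, D p -> f p = g p) -> forall q, D q -> 'D_(dir R i) f q = 'D_(dir R i) g q.
  move=> f1 g1 fg1 q Dq; apply: near_eq_derive.
  by apply: filterS (open_nbhs_nbhs (conj (@open_disc R) Dq)) => z; exact: fg1.
rewrite eqEsubset; split; apply: near_eq_cvg.
  by apply: (filterS _ (withinT D (nbhs_filter p))) => q Dq; apply: H => // z Dz; rewrite fg.
by apply: (filterS _ (withinT D (nbhs_filter p))) => q Dq; apply: H => // z Dz; rewrite fg.
Qed.

Lemma Ck_cdisc_ext k f g : (forall p, cdisc p -> f p = g p) -> Ck_cdisc k f -> Ck_cdisc k g.
Proof.
move=> fg; case: k => [|k] /= [cf df]; split => //.
- by apply: subspace_eq_continuous cf => p /set_mem; exact: fg.
- by apply: subspace_eq_continuous cf => p /set_mem; exact: fg.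
move=> i; have [d1 d2] := df i.
have fgD p : D p -> f p = g p by move=> Dp; apply: fg; exact: subset_closure.
rewrite -(pd_disc_ext i fgD); split => // p Dp.
apply: near_eq_is_derive (d1 p Dp).
by apply: filterS (open_nbhs_nbhs (conj (@open_disc R) Dp)) => z; exact: fgD.
Qed.

(** Makes the limit in the definition of [pd] unique at boundary points as well. *)
Lemma within_disc_proper p : cdisc p -> ProperFilter (within D (nbhs p)).
Proof.
move=> cp; apply: Build_ProperFilter_ex => B /cp [q [Dq]]; rewrite /within /=.
by exists q; exact: b.
Qed.

Lemma pd_cdiscE i f g p : (forall p, D p -> is_derive p (dir R i) f (g p)) ->
  {for p, continuous g} -> cdisc p -> pd i f p = g p.
Proof.
move=> df cg cp; have PF := within_disc_proper cp.
apply: cvg_lim => //.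
apply: (@cvg_trans _ (g q @[q --> within D (nbhs p)])).
  by apply: near_eq_cvg; apply: (filterS _ (withinT D (nbhs_filter p))) => q Dq; have [_ ->] := df q Dq.
by apply: cvg_within_filter; exact: cg.
Qed.

Lemma continuous_tensor (a b : R -> R) : continuous a -> continuous b ->
  continuous (fun p : R * R => a p.1 * b p.2).
Proof.
move=> ca cb p; apply: cvgM.
  by apply: (cvg_comp _ _ cvg_fst); exact: ca.
by apply: (cvg_comp _ _ cvg_snd); exact: cb.
Qed.

Lemma is_derive_tensor i (a b a' b' : R -> R) p :
  (forall x, is_derive x (1 : R) a (a' x)) -> (forall x, is_derive x (1 : R) b (b' x)) ->
  is_derive p (dir R i) (fun p : R * R => a p.1 * b p.2)
    (if i == ord0 then a' p.1 * b p.2 else a p.1 * b' p.2).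
Proof.
move=> da db; have [x [y ->]] := pt_surj i p; apply/is_derive_ptP.
rewrite /pt; case: (i == ord0) => /=.
  have -> : (fun t => a t * b y) = (fun t => b y * a t) by apply/funext => t; rewrite mulrC.
  by rewrite mulrC; exact: is_deriveZ.
exact: is_deriveZ.
Qed.

Lemma Ck_tensor k (a b : R -> R) : smoothk k a -> smoothk k b ->
  Ck_cdisc k (fun p : R * R => a p.1 * b p.2).
Proof.
elim: k a b => [|k IH] a b sa sb.
  by split => //; apply: continuous_subspaceT; exact: continuous_tensor.
have sa0 := smoothkW sa; have sb0 := smoothkW sb.
have ca := smoothk_continuous sa; have cb := smoothk_continuous sb.
case: sa => a' [da sa']; case: sb => b' [db sb'].
have ca' := smoothk_continuous sa'; have cb' := smoothk_continuous sb'.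
split; first by apply: continuous_subspaceT; exact: continuous_tensor.
move=> i; have dt p := is_derive_tensor i p da db.
have cg : continuous (fun p : R * R => if i == ord0 then a' p.1 * b p.2 else a p.1 * b' p.2).
  by case: (i == ord0); exact: continuous_tensor.
have E p : cdisc p -> pd i (fun p : R * R => a p.1 * b p.2) p = (if i == ord0 then a' p.1 * b p.2 else a p.1 * b' p.2).
  move=> cp; apply: (@pd_cdiscE i _ (fun p : R * R => if i == ord0 then a' p.1 * b p.2 else a p.1 * b' p.2)) => //; exact: (cg p).
split; first by move=> p Dp; rewrite E//; exact: subset_closure.
apply: Ck_cdisc_ext (fun p cp => esym (E p cp)) _.
by case: (i == ord0); exact: IH.
Qed.

Definition tensor i (a b : R -> R) : R * R -> R :=
  fun p => if i == ord0 then a p.1 * b p.2 else b p.1 * a p.2.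

Lemma tensor_pt i a b x y : tensor i a b (pt i x y) = a x * b y.
Proof. by rewrite /tensor /pt; case: (i == ord0) => //=; rewrite mulrC. Qed.

Lemma Ck_tensor_dir i k (a b : R -> R) : smoothk k a -> smoothk k b -> Ck_cdisc k (tensor i a b).
Proof. by rewrite /tensor; case: (i == ord0) => sa sb; exact: Ck_tensor. Qed.

Lemma pd_tensor_dir i (a b a' : R -> R) x y :
  (forall x, is_derive x (1 : R) a (a' x)) -> D (pt i x y) -> 
  (continuous a') -> continuous b ->
  pd i (tensor i a b) (pt i x y) = a' x * b y.
Proof.
move=> da Dp ca cb; rewrite -(tensor_pt i a' b); apply: pd_cdiscE; last exact: subset_closure.
  move=> p _; have [u [v ->]] := pt_surj i p; apply/is_derive_ptP; rewrite tensor_pt.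
  have -> : (fun t => tensor i a b (pt i t v)) = (fun t => b v * a t) by apply/funext => t; rewrite tensor_pt mulrC.
  by rewrite mulrC; exact: is_deriveZ.
by rewrite /tensor; case: (i == ord0); exact: continuous_tensor.
Qed.

Lemma compact_rect (a b c d : R) : compact (`[a, b]%classic `*` `[c, d]%classic : set (R * R)).
Proof. by apply: compact_setX; exact: segment_compact. Qed.

Lemma test_tensor i (a b : R -> R) (r s : R) :
  0 <= r -> 0 <= s -> r ^+ 2 + s ^+ 2 < 1 ->
  (forall k, smoothk k a) -> (forall k, smoothk k b) ->
  (forall x, r < `|x| -> a x = 0) -> (forall x, s < `|x| -> b x = 0) ->
  test_fun (tensor i a b).
Proof.
move=> r0 s0 rs sa sb a0 b0; split; first by move=> k; exact: Ck_tensor_dir.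
have sq (x t : R) : x \in `[- t, t] -> x ^+ 2 <= t ^+ 2.
  rewrite in_itv /= -ler_norml => h; rewrite -[x ^+ 2]real_normK ?num_real//.
  by rewrite ler_sqr ?nnegrE ?(le_trans _ h).
have nin (x t : R) : (x \notin `[- t, t]) = (t < `|x|) by rewrite in_itv /= -ler_norml -ltNge.
rewrite /tensor; case: (i == ord0).
  exists (`[- r, r]%classic `*` `[- s, s]%classic); split; first exact: compact_rect.
    by move=> p [/= p1 p2]; apply: le_lt_trans rs; rewrite lerD// sq.
  move=> p /= /not_andP[/negP|/negP]; rewrite nin => h; [rewrite (a0 _ h) mul0r|rewrite (b0 _ h) mulr0] => //.
exists (`[- s, s]%classic `*` `[- r, r]%classic); split; first exact: compact_rect.
  by move=> p [/= p1 p2]; apply: le_lt_trans rs; rewrite addrC lerD// sq.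
move=> p /= /not_andP[/negP|/negP]; rewrite nin => h; [rewrite (b0 _ h) mul0r|rewrite (a0 _ h) mulr0] => //.
Qed.

Lemma compact_cdisc : compact (@cdisc R).
Proof.
apply: (subclosed_compact _ (@compact_rect (-1) 1 (-1) 1)); first exact: closed_closure.
have cl : closed [set p : R * R | p.1 ^+ 2 + p.2 ^+ 2 <= 1].
  apply: (@closed_comp _ _ (fun p : R * R => p.1 ^+ 2 + p.2 ^+ 2) [set x | x <= 1]); last exact: closed_le.
  by move=> p _; exact: continuous_sqnorm.
have h1 : @cdisc R `<=` [set p : R * R | p.1 ^+ 2 + p.2 ^+ 2 <= 1].
  rewrite [X in _ `<=` X](closure_id _).1//; apply: closure_subset => p /=; exact: ltW.
move=> p /h1 /= hp; have sq (x y : R) : x ^+ 2 + y ^+ 2 <= 1 -> -1 <= x <= 1.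
  move=> h; rewrite -ler_norml -(@ler_sqr _ `|x| 1) ?nnegrE//.
  by rewrite real_normK ?num_real// expr1n; apply: le_trans h; rewrite lerDl sqr_ge0.
by split; rewrite /= in_itv/=; [apply: sq hp|apply: (sq _ p.1); rewrite addrC].
Qed.

Lemma within_cdisc_bounded f : {within (@cdisc R), continuous f} ->
  exists2 C, 0 <= C & forall p, cdisc p -> `|f p| <= C.
Proof.
move=> cf; have /compact_bounded[M [_ h]] := continuous_compact cf compact_cdisc.
exists (Num.max M 0 + 1); first by rewrite addr_ge0// le_max lexx orbT.
move=> p cp; apply: h; last by exists p.
by rewrite (le_lt_trans (_ : M <= Num.max M 0))// ?ltrDl// le_max lexx.
Qed.

Lemma within_cdisc_continuous f : {within (@cdisc R), continuous f} ->
  forall p, D p -> {for p, continuous f}.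
Proof.
move=> cf p Dp; have : {within D, continuous f}.
  by apply: continuous_subspaceW cf; exact: subset_closure.
rewrite continuous_open_subspace; last exact: open_disc.
by apply; exact: mem_set.
Qed.
End Tests.

(** * Weak derivatives and absolute continuity on lines *)

Section SquareIntegrable.
Variable R : realType.
Local Notation mu := (@lebesgue_measure R).
Local Notation D := (@disc R).
Local Notation plane := (measurableTypeR R * measurableTypeR R)%type.
Local Notation m2 := (leb2 R).
Implicit Types (f g phi : R * R -> R) (i : 'I_2) (p q : R * R).
Let mD : measurable (D : set plane) := @measurable_disc R.

Lemma leb2_disc_lty : (m2 D < +oo)%E.
Proof.
apply: (@le_lt_trans _ _ (m2 (`[-1, 1]%classic `*` `[-1, 1]%classic))).
  apply: le_measure; rewrite ?inE//; first by apply: measurableX; exact: measurable_itv.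
  move=> p Dp; have sq (x y : R) : x ^+ 2 + y ^+ 2 < 1 -> -1 <= x <= 1.
    move=> h; rewrite -ler_norml -(@ler_sqr _ `|x| 1) ?nnegrE//.
    by rewrite real_normK ?num_real// expr1n; apply: le_trans (ltW h); rewrite lerDl sqr_ge0.
  by split; rewrite /= in_itv/=; [apply: sq Dp|apply: (sq _ p.1); rewrite addrC].
pose I : set (measurableTypeR R) := `[-1, 1]%classic.
have -> : m2 (`[-1, 1]%classic `*` `[-1, 1]%classic) = (mu I * mu I)%E.
  by apply: product_measure1E; exact: measurable_itv.
have mI : (mu I < +oo)%E.
  by rewrite /I lebesgue_measure_itv/=; case: ifP => _; rewrite -?EFinB ltry.
by rewrite lte_mul_pinfty// ge0_fin_numE.
Qed.

Lemma integrable_cst_disc (c : R) : m2.-integrable D (EFin \o (fun=> c)).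
Proof.
apply/integrableP; split; first exact/measurable_EFinP.
under eq_integral do rewrite /=.
by rewrite integral_cst// lte_mul_pinfty// leb2_disc_lty.
Qed.

Lemma integrable_bounded_disc f (C : R) : measurable_fun (D : set plane) f ->
  {ae m2, forall p, D p -> `|f p| <= C} -> m2.-integrable D (EFin \o f).
Proof.
move=> mf fC; apply/integrableP; split; first exact/measurable_EFinP.
apply: (@le_lt_trans _ _ (\int[m2]_(p in D) `|C|%:E)%E); last first.
  by have /integrableP[_] := integrable_cst_disc `|C|; under eq_integral do rewrite /= normr_id.
apply: ae_ge0_le_integral => //.
- by apply/measurable_EFinP; exact: measurableT_comp.
- by apply: aeS fC => p h Dp; rewrite lee_fin (le_trans (h Dp))// ler_norm.
Qed.

(** Square integrability stated on the disc itself; [Lp_disc2P] identifies it with [Lp_disc 2],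
    which goes through the extension by 0. *)
Definition sqint f := measurable_fun (D : set plane) f /\ m2.-integrable D (EFin \o (fun p => f p ^+ 2)).

Lemma Lp_disc2P f : Lp_disc 2%:E f <-> sqint f.
Proof.
rewrite /Lp_disc /sqint; split => [h|[mf fi]].
  have mfD : measurable_fun (setT : set plane) (f \_ D).
    by move: h; rewrite inE => /andP[]; rewrite inE.
  split; first by apply/(measurable_restrictT f mD).
  have := Lfun2_integrable_sqr h.
  have -> : (fun x => (f \_ D) x ^+ 2) = (fun p => f p ^+ 2) \_ D.
    by apply/funext => p; rewrite !patchE; case: ifP => // _; rewrite expr0n.
  exact: (@integrable_mkcondR _ _ _ m2 D (fun p => f p ^+ 2) mD).2.
have mfD : measurable_fun (setT : set plane) (f \_ D) by apply/(measurable_restrictT f mD).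
rewrite inE; apply/andP; split; rewrite inE//= /finite_norm unlock.
apply: poweR_lty; under eq_integral => p _ do rewrite /= powR_mulrn// -normrX.
have /integrableP[_] := (@integrable_mkcondR _ _ _ m2 D (fun p => f p ^+ 2) mD).1 fi.
congr (_ < _)%E; apply: eq_integral => p _ /=; congr EFin; congr (`|_|).
by rewrite !patchE; case: ifP => // _; rewrite expr0n.
Qed.

Lemma sqint_mul f g : sqint f -> sqint g -> m2.-integrable D (EFin \o (fun p => f p * g p)).
Proof.
move=> [mf fi] [mg gi].
apply: (@le_integrable _ _ _ _ _ mD _ (EFin \o (fun p => f p ^+ 2 + g p ^+ 2))).
- by apply/measurable_EFinP; exact: measurable_funM.
- move=> p _ /=; rewrite lee_fin normrM [leRHS]ger0_norm ?addr_ge0 ?sqr_ge0//.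
  rewrite -[f p ^+ 2]real_normK ?num_real// -[g p ^+ 2]real_normK ?num_real//.
  have := sqr_ge0 (`|f p| - `|g p|); have := mulr_ge0 (normr_ge0 (f p)) (normr_ge0 (g p)); nra.
- exact: integrable_RD.
Qed.

Lemma sqint_bounded f (C : R) : measurable_fun (D : set plane) f ->
  {ae m2, forall p, D p -> `|f p| <= C} -> sqint f.
Proof.
move=> mf fC; split => //; apply: (@integrable_bounded_disc _ (C ^+ 2)).
  exact: measurable_funX.
apply: aeS fC => p h Dp; rewrite normrX ler_sqr ?nnegrE//; first exact: h.
by apply: le_trans (h Dp).
Qed.

Lemma sqint_cst (c : R) : sqint (fun=> c).
Proof. by apply: (@sqint_bounded _ `|c|) => //; exact: aeW. Qed.

Lemma sqint_integrable f : sqint f -> m2.-integrable D (EFin \o f).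
Proof.
move=> sf; have := sqint_mul sf (sqint_cst 1).
by congr (_.-integrable _ _); apply/funext => p /=; rewrite mulr1.
Qed.

Lemma sqintD f g : sqint f -> sqint g -> sqint (fun p => f p + g p).
Proof.
move=> sf sg; have := sqint_mul sf sg; case: sf => mf fi; case: sg => mg gi fg.
split; first exact: measurable_funD.
have := integrable_RD mD (integrable_RD mD fi gi) (integrable_RZ 2 mD fg).
by congr (_.-integrable _ _); apply/funext => p /=; congr EFin; rewrite sqrrD mulr_natl; ring.
Qed.

Lemma sqint_mul_bounded f g (C : R) : sqint f -> measurable_fun (D : set plane) g ->
  {ae m2, forall p, D p -> `|g p| <= C} -> sqint (fun p => f p * g p).
Proof.
move=> [mf fi] mg gC; split; first exact: measurable_funM.
apply/integrableP; split.
  by apply/measurable_EFinP; apply: measurable_funX; exact: measurable_funM.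
apply: (@le_lt_trans _ _ (\int[m2]_(p in D) (C ^+ 2 * f p ^+ 2)%:E)%E); last first.
  have /integrableP[_] := integrable_RZ (C ^+ 2) mD fi.
  congr (_ < _)%E; apply: eq_integral => p _ /=.
  by rewrite ger0_norm// mulr_ge0// sqr_ge0.
apply: ae_ge0_le_integral => //.
- by apply/measurable_EFinP; apply: measurableT_comp => //; apply: measurable_funX; exact: measurable_funM.
- by move=> p _; rewrite lee_fin mulr_ge0 ?sqr_ge0.
- by apply/measurable_EFinP; apply: measurable_funM => //; exact: measurable_funX.
- apply: aeS gC => p h Dp; rewrite lee_fin ger0_norm ?sqr_ge0// exprMn mulrC ler_wpM2r ?sqr_ge0//.
  rewrite -[g p ^+ 2]real_normK ?num_real// ler_sqr ?nnegrE; [exact: h| by []|].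
  by apply: le_trans (h Dp).
Qed.

Lemma sqintZ (c : R) f : sqint f -> sqint (fun p => c * f p).
Proof.
move=> sf; have := @sqint_mul_bounded _ (fun=> c) `|c| sf (measurable_cst _) (aeW _ (fun _ _ => lexx _)).
by congr sqint; apply/funext => p; rewrite mulrC.
Qed.

(** The closed segment [-r, r] of the line at height y lies in the open disc. One-dimensional
    statements are made on such compact segments, where continuous derivatives are bounded. *)
Definition chord (y r : R) := 0 < r /\ r ^+ 2 + y ^+ 2 < 1.

Lemma chord_disc i x y r : chord y r -> `[- r, r]%classic x -> D (pt i x y).
Proof.
move=> [r0 ry] /=; rewrite in_itv/= -ler_norml => xr; apply/disc_pt; apply: le_lt_trans ry.
by rewrite lerD2r -[x ^+ 2]real_normK ?num_real// ler_sqr ?nnegrE// ltW.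
Qed.

Lemma ae_chord_integrable i g : m2.-integrable D (EFin \o g) ->
  {ae mu, forall y, forall r, chord y r -> mu.-integrable `[- r, r] (EFin \o (fun x => g (pt i x y)))}.
Proof.
move=> gi; have gi0 := (@integrable_mkcondR _ _ _ m2 D g mD).1 gi.
apply: aeS (ae_integrable_pt i gi0) => y h r cy.
have : mu.-integrable `[- r, r] (EFin \o (fun x => (g \_ D) (pt i x y))).
  by apply: integrableS h.
apply: eq_integrable => // x /set_mem xr /=; rewrite patchE mem_set//.
exact: chord_disc cy xr.
Qed.

(* ACL: absolutely continuous on almost every line parallel to an axis. *)
Definition ACL i f g := {ae mu, forall y, forall r, chord y r ->
  exists c : R, {ae mu, forall x, `[- r, r]%classic x ->
    f (pt i x y) = c + \int[mu]_(s in `[- r, x]) g (pt i s y)}}.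
End SquareIntegrable.

Section WeakOfACL.
Variable R : realType.
Local Notation mu := (@lebesgue_measure R).
Local Notation D := (@disc R).
Local Notation plane := (measurableTypeR R * measurableTypeR R)%type.
Local Notation m2 := (leb2 R).
Implicit Types (f g phi : R * R -> R) (i : 'I_2) (p q : R * R).
Let mD : measurable (D : set plane) := @measurable_disc R.

Lemma measurable_Rfubini i f : m2.-integrable setT (EFin \o f) ->
  measurable_fun setT (fun y => \int[mu]_x f (pt i x y)).
Proof.
move=> fi; have mG : measurable_fun setT (fun y => \int[mu]_x (EFin \o f) (pt i x y))%E.
  rewrite /pt; case: (_ == ord0); first exact: measurable_fubini_G fi.
  exact: measurable_fubini_F fi.
exact: measurableT_comp mG.
Qed.

Lemma integrable_Rfubini i f : m2.-integrable setT (EFin \o f) ->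
  mu.-integrable setT (EFin \o (fun y => \int[mu]_x f (pt i x y))).
Proof.
move=> fi; have mG := measurable_Rfubini i fi.
apply/integrableP; split; first exact/measurable_EFinP.
have mf : measurable_fun (setT : set plane) (EFin \o f) by exact: measurable_int fi.
have := (integrable_ptP i mf).1 fi; apply: le_lt_trans.
apply: ae_ge0_le_integral => //.
- by apply: measurableT_comp => //; exact/measurable_EFinP.
- by move=> y _; exact: integral_ge0.
- apply: (@measurable_fubini_pt R i (fun p => `|(EFin \o f) p|%E)) => //; exact: measurableT_comp.
- apply: aeS (ae_integrable_pt i fi) => y hy _ /=.
  rewrite EFin_normr_Rintegral//.
  exact: (le_abse_integral _ measurableT (measurable_int _ hy)).
Qed.

Lemma Rfubini_eq0 i f : m2.-integrable setT (EFin \o f) ->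
  {ae mu, forall y, \int[mu]_x f (pt i x y) = 0} -> \int[m2]_p f p = 0.
Proof.
move=> fi f0; rewrite (Rfubini_pt i fi).
rewrite (@ae_eq_Rintegral _ _ _ mu setT _ (cst 0))//.
- by rewrite Rintegral_cst// mul0r.
- exact: measurable_Rfubini.
- by apply: aeS f0.
Qed.

Lemma continuous_pt i (y : R) : continuous (fun x => pt i x y).
Proof.
move=> x; rewrite /pt; case: (i == ord0).
  exact: (@cvg_pair _ _ _ (nbhs x) (nbhs x) (nbhs y) _ _ _ (fun z => z) (fun=> y) cvg_id (cvg_cst y)).
exact: (@cvg_pair _ _ _ (nbhs x) (nbhs y) (nbhs x) _ _ _ (fun=> y) (fun z => z) (cvg_cst y) cvg_id).
Qed.

Lemma is_derive_FTC2 (F F' : R -> R) (a b : R) : a <= b ->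
  (forall t, a <= t <= b -> is_derive t (1 : R) F (F' t)) ->
  (forall t, a <= t <= b -> {for t, continuous F'}) ->
  mu.-integrable `[a, b] (EFin \o F') /\ \int[mu]_(t in `[a, b]) F' t = F b - F a.
Proof.
move=> ab dF cF'.
have wF' : {within `[a, b], continuous F'}.
  apply/subspace_continuousP => t /=; rewrite in_itv /= => tab.
  by apply: cvg_within_filter; exact: cF'.
have F'i : mu.-integrable `[a, b] (EFin \o F').
  by apply: continuous_compact_integrable => //; exact: segment_compact.
split => //; move: ab; rewrite le_eqVlt => /predU1P[->|ab].
  by rewrite set_itv1 Rintegral_set1 subrr.
have cF t : a <= t <= b -> {for t, continuous F}.
  by move=> tab; apply: differentiable_continuous; apply/derivable1_diffP; have [] := dF t tab.
apply: EFin_inj; rewrite EFin_Rintegral// (@continuous_FTC2 _ _ F)//.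
- split.
  + by move=> t; rewrite in_itv /= => /andP[t1 t2]; have [] := dF t; rewrite ?ltW.
  + by apply: cvg_at_right_filter; apply: cF; rewrite lexx ltW.
  + by apply: cvg_at_left_filter; apply: cF; rewrite lexx ltW.
- move=> t; rewrite in_itv /= => /andP[t1 t2]; rewrite derive1E.
  have tab : a <= t <= b by rewrite !ltW.
  by have [_ ->] := dF t tab.
Qed.

Lemma chord_FTC i f f' (y r : R) : (forall p, D p -> is_derive p (dir R i) f (f' p)) ->
  (forall p, D p -> {for p, continuous f'}) -> chord y r ->
  mu.-integrable `[- r, r] (EFin \o (fun x => f' (pt i x y))) /\
  forall x, - r <= x <= r ->
  \int[mu]_(s in `[- r, x]) f' (pt i s y) = f (pt i x y) - f (pt i (- r) y).
Proof.
move=> df cf' cy; have r0 : 0 < r by case: cy.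
have H x : - r <= x <= r -> mu.-integrable `[- r, x] (EFin \o (fun x => f' (pt i x y))) /\
   \int[mu]_(s in `[- r, x]) f' (pt i s y) = f (pt i x y) - f (pt i (- r) y).
  move=> /andP[x1 x2]; apply: (@is_derive_FTC2 (fun t => f (pt i t y)) (fun t => f' (pt i t y))) => //.
    move=> t /andP[t1 t2]; apply/is_derive_ptP; apply: df; apply: chord_disc cy _.
    by rewrite /= in_itv /= t1 (le_trans t2).
  move=> t /andP[t1 t2]; apply: continuous_comp; first exact: continuous_pt.
  by apply: cf'; apply: chord_disc cy _; rewrite /= in_itv /= t1 (le_trans t2).
by split; [apply: (H r _).1; rewrite lexx andbT; lra|move=> x hx; exact: (H x hx).2].
Qed.

Lemma compact_disc_radius (K : set (R * R)) : compact K -> K `<=` D ->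
  exists2 rho : R, 0 < rho < 1 & forall p, K p -> p.1 ^+ 2 + p.2 ^+ 2 <= rho.
Proof.
move=> cK KD; have [->|/set0P[p0 Kp0]] := eqVneq K set0.
  by exists (2^-1); [rewrite invr_gt0 ltr0n invf_lt1// ltr1n|].
pose F (p : R * R) : R := p.1 ^+ 2 + p.2 ^+ 2.
have cF : {within K, continuous F} by apply: continuous_subspaceT; exact: continuous_sqnorm.
have [p /set_mem Kp pm] := compact_EVT_max (ex_intro _ p0 Kp0) cK cF.
have p1 : F p < 1 by exact: KD.
have p2 : 0 <= F p by rewrite addr_ge0// sqr_ge0.
(* The midpoint between the maximum and 1 is positive even if K contains only the origin. *)
exists ((1 + F p) / 2); first by rewrite /F in p1 p2 *; lra.
move=> q Kq; have := pm q (mem_set Kq); rewrite -/(F q); lra.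
Qed.

Lemma test_funP i phi : test_fun phi -> exists (rho C : R),
  [/\ 0 < rho < 1, (forall p, D p -> is_derive p (dir R i) phi (pd i phi p)) /\
      (forall p, D p -> {for p, continuous phi}) /\ (forall p, D p -> {for p, continuous (pd i phi)}),
      (forall p, D p -> `|phi p| <= C /\ `|pd i phi p| <= C) &
      forall p, D p -> rho < p.1 ^+ 2 + p.2 ^+ 2 -> phi p = 0 /\ pd i phi p = 0].
Proof.
move=> [sphi [K [cK KD phi0]]].
have [rho rho01 Krho] := compact_disc_radius cK KD.
have /= [c1 /(_ i)[d1 [c2 _]]] := sphi 1%N.
have [C1 C10 h1] := within_cdisc_bounded c1.
have [C2 C20 h2] := within_cdisc_bounded c2.
exists rho, (Num.max C1 C2); split => //.
- by split => //; split; exact: within_cdisc_continuous.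
- move=> p Dp; have cp : cdisc p by exact: subset_closure.
  by split; rewrite le_max; [rewrite h1|rewrite h2 ?orbT].
- move=> p Dp rp; have nK : ~ K p by move=> /Krho; rewrite leNgt rp.
  split; first exact: phi0.
  have [_ <-] := d1 p Dp.
  rewrite (@near_eq_derive _ _ _ _ (cst 0)); first exact: derive_cst.
  have oK : open (~` K) by apply: closed_openC; apply: compact_closed.
  by apply: filterS (open_nbhs_nbhs (conj oK nK)) => z; exact: phi0.
Qed.

(** On a line the integral of (f phi)' over a chord is a difference of boundary values, and phi
    vanishes at both ends; Fubini sums over the lines. *)
Lemma ACL_weak i f g : sqint f -> sqint g -> ACL i f g -> is_weak_pd i f g.
Proof.
move=> sf sg fg; split; first exact/Lp_disc2P.
move=> phi tphi; have [rho [C [rho01 [dphi [cphi cphi']] bphi phi0]]] := test_funP i tphi.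
have mphi : measurable_fun (D : set plane) phi by apply: open_continuous_measurable_plane => //; exact: open_disc.
have mphi' : measurable_fun (D : set plane) (pd i phi) by apply: open_continuous_measurable_plane => //; exact: open_disc.
have s1 : sqint phi by apply: (@sqint_bounded _ _ C) => //; apply: aeW => p Dp; exact: (bphi p Dp).1.
have s2 : sqint (pd i phi) by apply: (@sqint_bounded _ _ C) => //; apply: aeW => p Dp; exact: (bphi p Dp).2.
apply/eqP; rewrite -addr_eq0 -RintegralD//; [|exact: sqint_mul|exact: sqint_mul].
apply/eqP; rewrite Rintegral_mkcond.
have Hi := (@integrable_mkcondR _ _ _ m2 D (fun p => f p * pd i phi p + g p * phi p) mD).1
   (integrable_RD mD (sqint_mul sf s2) (sqint_mul sg s1)).
apply: (Rfubini_eq0 (i := i) Hi).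
have ae1 := ae_chord_integrable i (sqint_integrable sf).
have ae2 := ae_chord_integrable i (sqint_integrable sg).
apply: aeS (aeI fg (aeI ae1 ae2)) => y [fgy [fiy giy]].
(* The chord with r^2 + y^2 = rho' must lie in the disc, whence rho' < 1, and its ends must lie
   outside the support of phi, whence rho < rho'. Lines with y^2 >= rho' do not meet the support. *)
pose rho' := (1 + rho) / 2.
have rr : rho < rho' < 1 by rewrite /rho'; lra.
have zero x : rho' <= x ^+ 2 + y ^+ 2 -> 
   ((fun p => f p * pd i phi p + g p * phi p) \_ D) (pt i x y) = 0.
  move=> h; rewrite patchE; case: ifPn => [/set_mem Dp|//].
  have [] := phi0 (pt i x y) Dp; last by move=> -> ->; rewrite !mulr0 addr0.
  suff -> : (pt i x y).1 ^+ 2 + (pt i x y).2 ^+ 2 = x ^+ 2 + y ^+ 2 by lra.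
  by rewrite /pt; case: (i == ord0) => //=; rewrite addrC.
have [yr|yr] := leP rho' (y ^+ 2).
  rewrite (_ : (fun x => _) = cst 0); first by rewrite Rintegral_cst// mul0r.
  by apply/funext => x; apply: zero; apply: le_trans yr _; rewrite lerDr sqr_ge0.
pose r := Num.sqrt (rho' - y ^+ 2).
have r2 : r ^+ 2 = rho' - y ^+ 2 by rewrite sqr_sqrtr// subr_ge0 ltW.
have cy : chord y r.
  by split; [rewrite sqrtr_gt0 subr_gt0|rewrite r2; lra].
have r0 : 0 < r by case: cy.
have [c hc] := fgy r cy.
have [phi'i FTC] := chord_FTC dphi cphi' cy.
have p0 (x : R) : x ^+ 2 = r ^+ 2 -> phi (pt i x y) = 0.
  move=> xr; have Dp : D (pt i x y) by apply/disc_pt; rewrite xr r2; lra.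
  have [] := phi0 (pt i x y) Dp; last by [].
  suff -> : (pt i x y).1 ^+ 2 + (pt i x y).2 ^+ 2 = x ^+ 2 + y ^+ 2 by rewrite xr r2; lra.
  by rewrite /pt; case: (i == ord0) => //=; rewrite addrC.
have rr' : - r <= r by lra.
have gi := giy r cy.
have fi := fiy r cy.
transitivity (\int[mu]_(x in `[- r, r]) (f (pt i x y) * pd i phi (pt i x y) + g (pt i x y) * phi (pt i x y))).
  rewrite [RHS]Rintegral_mkcond; apply: eq_Rintegral => x _; rewrite [RHS]patchE.
  case: ifPn => [/set_mem xr|xr].
    by rewrite patchE mem_set//; exact: chord_disc cy xr.
  apply: zero; move: xr; rewrite mem_setE in_itv /= -ler_norml -ltNge => xr.
  have : r ^+ 2 <= x ^+ 2.
    by rewrite -[x ^+ 2]real_normK ?num_real// ler_sqr ?nnegrE// ltW.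
  by rewrite r2; lra.
(* The constant 0 belongs to phi, which vanishes at the left end and thus is the integral of its
   derivative; its vanishing at the right end kills the product on the left-hand side. *)
have := ac_prod c 0 rr' gi phi'i.
rewrite (FTC r) ?lexx ?andbT; last by lra.
rewrite !p0 ?sqrrN// subrr addr0 !mulr0 add0r => /esym E; rewrite -[RHS]E.
have mIf (h : R * R -> R) : measurable_fun (D : set plane) h -> measurable_fun (`[- r, r] : set R) (fun x => h (pt i x y)).
  move=> mh; apply: (@measurable_comp _ _ _ _ _ _ (D : set plane) h _ (fun x => pt i x y)) => //.
    by move=> _ [x xr <-]; exact: chord_disc cy xr.
  by apply: (@measurable_funS _ _ _ _ setT) => //; exact: measurable_ptl.
have mf := sf.1; have mg := sg.1.
apply: ae_eq_Rintegral => //.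
- by apply: measurable_funD; apply: measurable_funM; exact: mIf.
- have mi (h : R -> R) : mu.-integrable `[- r, r] (EFin \o h) -> measurable_fun (`[- r, r] : set R) (fun x => \int[mu]_(t in `[- r, x]) h t).
    by move=> hi; exact: (measurable_indefinite rr' hi).
  apply: measurable_funD; apply: measurable_funM; try exact: mIf.
    by apply: measurable_funD => //; exact: mi.
  by apply: measurable_funD => //; exact: mi.
- apply: aeS hc => x hx xr; rewrite (hx xr).
  move: xr => /=; rewrite in_itv /= => xr.
  by rewrite (FTC x xr) (p0 (- r)) ?sqrrN// subr0 add0r addrC; congr (_ + _); rewrite mulrC.
Qed.
End WeakOfACL.

(** * Lemma of du Bois-Reymond on lines *)

Section ACLOfWeak.
Variable R : realType.
Local Notation mu := (@lebesgue_measure R).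
Local Notation D := (@disc R).
Local Notation plane := (measurableTypeR R * measurableTypeR R)%type.
Local Notation m2 := (leb2 R).
Implicit Types (f g phi : R * R -> R) (i : 'I_2) (p q : R * R).
Let mD : measurable (D : set plane) := @measurable_disc R.

(** The moving end point is encoded by an indicator in a third variable; then the measurability half
    of Tonelli applies to the positive and the negative part. *)
Lemma measurable_partial_integral g (r : R) : measurable_fun (setT : set plane) g ->
  measurable_fun (setT : set plane) (fun z : R * R => \int[mu]_(s in `[- r, z.1]) g (s, z.2)).
Proof.
move=> mg.
pose S : set (plane * R) := [set w | - r <= w.2] `&` [set w | w.2 <= w.1.1].
have mS : measurable S.
  have k1 : measurable_fun setT (fun w : plane * R => w.1.1).
    by apply: measurableT_comp => //; exact: measurable_fst.
  have k2 : measurable_fun setT (fun w : plane * R => w.2) by exact: measurable_snd.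
  apply: measurableI; rewrite -[X in measurable X]setTI.
    by apply: measurable_fun_le.
  exact: measurable_fun_le k2 k1.
pose k0 : plane * R -> R := (fun w => g (w.2, w.1.2)) \_ S.
pose k : plane * R -> \bar R := EFin \o k0.
have mk : measurable_fun setT k.
  apply/measurable_EFinP/(measurable_restrictT _ mS); apply: (@measurable_funS _ _ _ _ setT) => //.
  apply: (measurableT_comp mg).
  apply/measurable_fun_pairP; split; first exact: measurable_snd.
  exact: (measurableT_comp measurable_snd measurable_fst).
have E z : \int[mu]_(s in `[- r, z.1]) g (s, z.2) = fine (\int[mu]_s k (z, s))%E.
  rewrite /Rintegral integral_mkcond; congr fine; apply: eq_integral => s _.
  rewrite /k /= /k0 !patchE.
  have -> : (s \in `[- r, z.1]%classic) = ((z, s) \in S).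
    apply/idP/idP; rewrite !inE /= in_itv /=; first by move=> /andP[h1 h2]; split.
    by move=> [h1 h2]; apply/andP.
  by case: ifP.
under eq_fun do rewrite E.
apply: (@measurableT_comp _ _ _ _ _ _ fine) => //.
have -> : (fun z : plane => \int[mu]_s k (z, s))%E =
   (fun z => \int[mu]_s (k^\+ (z, s)) - \int[mu]_s (k^\- (z, s)))%E.
  apply/funext => z; rewrite integralE.
  by congr (_ - _)%E; apply: eq_integral => s _; rewrite ?funeposE ?funenegE.
apply: emeasurable_funB.
  apply: (measurable_fun_fubini_tonelli_F (m2 := mu) (k^\+)%E) => //.
  exact: measurable_funepos.
apply: (measurable_fun_fubini_tonelli_F (m2 := mu) (k^\-)%E) => //.
exact: measurable_funeneg.
Qed.

(** The primitive on a line is bounded by the integral of |g| over that line, and this function of y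
    is integrable by Fubini. *)
Lemma integrable_partial_integral g (r : R) : m2.-integrable setT (EFin \o g) ->
  m2.-integrable setT (EFin \o (fun z : R * R => \1_`[- r, r] z.1 * \int[mu]_(s in `[- r, z.1]) g (s, z.2))).
Proof.
move=> gi; have mg : measurable_fun (setT : set plane) g by apply/measurable_EFinP; exact: measurable_int gi.
have gi' := integrable_norm gi.
have aeg := ae_integrable_pt ord0 gi'.
have mN := measurable_Rfubini ord0 gi'.
have Ni : mu.-integrable setT (EFin \o (fun y => \int[mu]_x `|g (x, y)|)).
  exact: (integrable_Rfubini ord0 gi').
have Ii : mu.-integrable setT (EFin \o (\1_`[- r, r] : R -> R)).
  exact: integrable_indic_itv.
have T := integrable_tensor Ii Ni.
apply/integrableP; split.
  apply/measurable_EFinP; apply: measurable_funM; last exact: measurable_partial_integral.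
  by apply: measurableT_comp; [exact: measurable_indic|exact: measurable_fst].
have /integrableP[_] := T; apply: le_lt_trans.
apply: ae_ge0_le_integral => //.
- apply/measurable_EFinP; apply: measurableT_comp => //; apply: measurable_funM; last exact: measurable_partial_integral.
  by apply: measurableT_comp; [exact: measurable_indic|exact: measurable_fst].
- by apply: measurableT_comp => //; exact: measurable_int T.
- have aeg2 : {ae m2, forall z, mu.-integrable setT (EFin \o (fun s : R => g (s, z.2)))}.
    have [N [mN' N0 subN]] := ae_integrable_pt ord0 gi.
    exists (setT `*` N); split.
    + exact: measurableX.
    + transitivity (mu setT * mu N)%E; first exact: product_measure1E.
      by rewrite N0 mule0.
    + by move=> z /= h; split => //; apply: subN => /= h'; exact: h.
  apply: aeS aeg2 => z hz _; rewrite lee_fin !normrM ler_wpM2l//.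
  rewrite [leRHS]ger0_norm ?Rintegral_ge0//.
  have hi : mu.-integrable `[- r, z.1] (EFin \o (fun s : R => g (s, z.2))) by apply: integrableS hz.
  apply: le_trans (le_normr_Rintegral _ hi) _ => //.
  rewrite -lee_fin EFin_Rintegral//; last exact: integrable_norm.
  rewrite EFin_Rintegral//; last exact: integrable_norm hz.
  apply: ge0_subset_integral => //.
  by apply/measurable_EFinP; apply: measurableT_comp => //; apply/measurable_EFinP; exact: measurable_int hz.
Qed.

Lemma plateau_abs_out (r x1 x2 x : R) n : - r <= x1 -> x2 <= r -> r <= `|x| -> plateau x1 x2 n x = 0.
Proof.
move=> h1 h2 h; apply: plateau_out; have [x0|x0] := leP 0 x.
  by right; apply: le_trans h2 _; move: h; rewrite ger0_norm.
by left; move: h; rewrite ltr0_norm//; lra.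
Qed.

(* The test functions are primitives of I a - c be, with be a fixed bump and
   I, c the integrals of be, a: their support is compact. *)
Lemma dubois_reymond f g (r s : R) : sqint f -> sqint g -> 0 < r -> 0 < s -> r ^+ 2 + s ^+ 2 < 1 ->
  (forall a a' b : R -> R, (forall k, smoothk k a) -> (forall k, smoothk k a') -> (forall k, smoothk k b) ->
    (forall x, is_derive x (1 : R) a (a' x)) ->
    (forall x, r <= `|x| -> a x = 0) -> (forall x, r <= `|x| -> a' x = 0) -> (forall x, s <= `|x| -> b x = 0) ->
    \int[m2]_(z in D) (f z * (a' z.1 * b z.2)) = - \int[m2]_(z in D) (g z * (a z.1 * b z.2))) ->
  {ae mu, forall y, `|y| < s -> exists c : R, {ae mu, forall x, `[- r, r]%classic x ->
    f (x, y) = c + \int[mu]_(t in `[- r, x]) g (t, y)}}.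
Proof.
move=> sf sg r0 s0 rs weak.
pose Q : set plane := `[- r, r]%classic `*` `[- s, s]%classic.
have mQ : measurable Q by apply: measurableX; exact: measurable_itv.
have QD : Q `<=` D.
  move=> z [/= z1 z2]; apply: le_lt_trans rs.
  by move: z1 z2; rewrite !in_itv/= -!ler_norml => z1 z2; rewrite lerD// -[leLHS]real_normK ?num_real// ler_sqr ?nnegrE// ltW.
pose f0 : R * R -> R := f \_ Q; pose g0 : R * R -> R := g \_ Q.
have f0i : m2.-integrable setT (EFin \o f0).
  apply: (@integrable_mkcondR _ _ _ m2 Q f mQ).1.
  exact: integrableS (sqint_integrable sf).
have g0i : m2.-integrable setT (EFin \o g0).
  apply: (@integrable_mkcondR _ _ _ m2 Q g mQ).1.
  exact: integrableS (sqint_integrable sg).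
(* G is the primitive of g along the lines. The aim is that f - G does not depend on x inside the
   rectangle. *)
pose G (z : R * R) := \1_`[- r, r] z.1 * \int[mu]_(t in `[- r, z.1]) g0 (t, z.2).
have Gi : m2.-integrable setT (EFin \o G) by exact: integrable_partial_integral.
have rr : - r <= r by lra.
pose be := hump (- r) r.
have be0 x : r <= `|x| -> be x = 0.
  move=> h; apply: hump_out; have [x0|x0] := leP 0 x; first by right; move: h; rewrite ger0_norm.
  by left; move: h; rewrite ltr0_norm//; lra.
have cbe : continuous be by exact: (smoothk_hump 0 (- r) r).
have sbe k : smoothk k be by exact: smoothk_hump.
pose I := \int[mu]_(t in `[- r, r]) be t.
have ci (h : R -> R) a b : continuous h -> mu.-integrable `[a, b] (EFin \o h).
  by move=> ch; apply: continuous_compact_integrable; [exact: segment_compact|exact: continuous_subspaceT].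
have I0 : I != 0.
  apply/eqP => I0.
  pose J : set R := `[- r, r]%classic.
  have h0 : (\int[mu]_(t in J) `|(be t)%:E| = 0)%E.
    under eq_integral => t _ do rewrite gee0_abs ?lee_fin ?hump_ge0//.
    by rewrite -(EFin_Rintegral _ (ci be (- r) r cbe)) -/I ?I0//; exact: measurable_itv.
  have mbe : measurable_fun (`[- r, r] : set R) (EFin \o be).
    by apply/measurable_EFinP; apply: (@measurable_funS _ _ _ _ setT) => //; exact: continuous_measurable_fun.
  have [N [mN N0 sN]] := (ae_eq_integral_abs mu (measurable_itv _) mbe).1 h0.
  pose J' : set R := `]- r, r[%classic.
  have : (mu J' <= mu N)%E.
    apply: le_measure; rewrite ?inE//; first exact: measurable_itv.
    move=> x; rewrite /J' /= in_itv /= => /andP[x1 x2]; apply: sN => /=.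
    rewrite in_itv/= !ltW// => /(_ isT) [] /eqP.
    by rewrite gt_eqF// hump_gt0.
  rewrite N0 /J' lebesgue_measure_itv/= lte_fin; have -> : - r < r by lra.
  by rewrite -EFinB lee_fin; lra.
(* If f - G depends on y only, then I (f - G) equals H0. So the constant on the line at height y has
   to be H0 y / I. *)
pose H0 (y : R) := \int[mu]_x ((f0 (x, y) - G (x, y)) * be x).
have mbe : measurable_fun setT (fun z : R * R => be z.1).
  by apply: measurableT_comp; [exact: continuous_measurable_fun|exact: measurable_fst].
have h1i : m2.-integrable setT (EFin \o (fun z => f0 z - G z)) by exact: integrable_RB.
have bbnd (h : R -> R) : continuous h -> (forall x, r <= `|x| -> h x = 0) -> exists C, forall x, `|h x| <= C.
  move=> ch h0; have : {within `[- r, r]%classic, continuous h} by exact: continuous_subspaceT.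
  move=> /continuous_compact /(_ (@segment_compact _ _ _)) /compact_bounded[M [_ hM]].
  exists (Num.max 0 (M + 1)) => x; have [xr|xr] := leP r `|x|; first by rewrite h0// normr0 le_max lexx.
  rewrite le_max; apply/orP; right; apply: hM; first by rewrite ltrDl.
  by exists x => //; rewrite /= in_itv/= -ler_norml ltW.
have prodi (h : R * R -> R) (a b : R -> R) : m2.-integrable setT (EFin \o h) -> continuous a -> continuous b ->
   (exists C, forall x, `|a x| <= C) -> (exists C, forall x, `|b x| <= C) ->
   m2.-integrable setT (EFin \o (fun z => h z * (a z.1 * b z.2))).
  move=> hi ca cb [C1 a1] [C2 b1]; apply: (@integrable_bounded_mul _ _ _ _ _ _ _ (C1 * C2)) => //.
    by apply: measurable_funM; apply: measurableT_comp; try exact: continuous_measurable_fun; [exact: measurable_fst|exact: measurable_snd].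
  by move=> z _; rewrite normrM ler_pM.
have beb := bbnd be cbe be0.
pose one : R -> R := cst 1.
have oneb : exists C : R, forall x : R, `|one x| <= C by exists `|1|.
have c1 : continuous one by exact: cst_continuous.
have H0i : mu.-integrable setT (EFin \o H0).
  have hi : m2.-integrable setT (EFin \o (fun z => (f0 z - G z) * be z.1)).
    have := prodi _ _ _ h1i cbe c1 beb oneb.
    by congr (_.-integrable _ _); apply/funext => z /=; rewrite mulr1.
  exact: (integrable_Rfubini ord0 hi).
have Hi2 : m2.-integrable setT (EFin \o (fun z : R * R => \1_`[- r, r] z.1 * H0 z.2)).
  by apply: integrable_tensor => //; exact: integrable_indic_itv.
pose h2 (z : R * R) := I * (f0 z - G z) - \1_`[- r, r] z.1 * H0 z.2.
have h2i : m2.-integrable setT (EFin \o h2) by apply: integrable_RB => //; exact: integrable_RZ.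
have key : {ae m2, forall z, (`]- r, r[%classic `*` `]- s, s[%classic) z -> h2 z = 0}.
  apply: fundamental_rect.
    by apply: integrableS h2i => //; apply: measurableX; exact: measurable_itv.
  move=> x1 x2 y1 y2 n hx1 hx2 hy1 hy2.
  pose a := plateau x1 x2 n; pose b := plateau y1 y2 n.
  have a0 x : r <= `|x| -> a x = 0 by exact: plateau_abs_out.
  have b0 x : s <= `|x| -> b x = 0 by exact: plateau_abs_out.
  have sa k : smoothk k a by exact: smoothk_plateau.
  have sb k : smoothk k b by exact: smoothk_plateau.
  have ca : continuous a by exact: (sa 0).
  have cb : continuous b by exact: (sb 0).
  have ab := bbnd a ca a0.
  have bb : exists C, forall x, `|b x| <= C.
    by exists 1 => x; have /andP[p1 p2] := plateau_bounds y1 y2 n x; rewrite ger0_norm.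
  pose c := \int[mu]_(t in `[- r, r]) a t.
  pose e x := I * a x + (- c) * be x.
  have se k : smoothk k e by apply: smoothkD; apply: smoothkM => //; exact: smoothk_cst.
  have ce : continuous e by exact: (se 0).
  have e0 x : r <= `|x| -> e x = 0 by move=> h; rewrite /e a0// be0// !mulr0 addr0.
  have eb := bbnd e ce e0.
  have [E [sE dE E0 EE]] := @smoothk_antiderivative R e (- r) 0 se (fun x h => e0 x ltac:(rewrite ler0_norm; lra)).
  have Er : E r = 0.
    rewrite EE /e RintegralD//; [|by apply: integrable_RZ => //; exact: ci|by apply: integrable_RZ => //; exact: ci].
    rewrite !RintegralZl//; [|exact: ci|exact: ci].
    by rewrite -/I -/c; ring.
  have Eout x : r <= `|x| -> E x = 0.
    move=> h; have [x0|x0] := leP 0 x; last first.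
      by apply: E0; move: h; rewrite ltr0_norm//; lra.
    have rx : r <= x by move: h; rewrite ger0_norm.
    rewrite EE -[RHS]Er EE [LHS]Rintegral_mkcond [RHS]Rintegral_mkcond; apply: eq_Rintegral => t _.
    rewrite !patchE !mem_setE !in_itv /=; have [tr|tr] := leP t r; first by rewrite (le_trans tr rx).
    rewrite andbF; case: ifPn => // _; apply: e0; apply: le_trans (ler_norm _); exact: ltW.
  have cE : continuous E by exact: (sE 0).
  have Eb := bbnd E cE Eout.
  have toQ (h : R * R -> R) (u v : R -> R) : (forall x, r <= `|x| -> u x = 0) -> (forall x, s <= `|x| -> v x = 0) ->
    \int[m2]_(z in D) (h z * (u z.1 * v z.2)) = \int[m2]_z ((h \_ Q) z * (u z.1 * v z.2)).
    move=> u0 v0; rewrite [LHS]Rintegral_mkcond; apply: eq_Rintegral => z _; rewrite !patchE.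
    have [zQ|zQ] := boolP (z \in Q); first by rewrite mem_set//; apply: QD; exact: set_mem.
    rewrite mul0r; case: ifPn => // _.
    have [z1|z1] := leP r `|z.1|; first by rewrite u0// mul0r mulr0.
    have [z2|z2] := leP s `|z.2|; first by rewrite v0// !mulr0.
    by move: zQ; rewrite notin_setE; case; split; rewrite /= in_itv/= -ler_norml ltW.
  have W : \int[m2]_z (f0 z * (e z.1 * b z.2)) = - \int[m2]_z (g0 z * (E z.1 * b z.2)).
    by have := weak E e b sE se sb dE Eout e0 b0; rewrite !toQ.
  have aeg := ae_integrable_pt ord0 g0i.
  (* G satisfies the same weak identity as f: on almost every line this is [ac_prod] for g and e,
     where the boundary term vanishes because E r = 0. *)
  have W2 : \int[m2]_z (G z * (e z.1 * b z.2)) = - \int[m2]_z (g0 z * (E z.1 * b z.2)).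
    apply/eqP; rewrite -addr_eq0 -RintegralD//; [|exact: prodi|exact: prodi].
    apply/eqP; apply: (Rfubini_eq0 (i := ord0)).
      by apply: integrable_RD => //; exact: prodi.
    apply: aeS aeg => y; rewrite /pt eqxx /= => gy.
    have gyr : mu.-integrable `[- r, r] (EFin \o (fun x : R => g0 (x, y))) by apply: integrableS gy.
    have ei := ci e (- r) r ce.
    have := ac_prod 0 0 rr gyr ei.
    rewrite -EE Er add0r addr0 !mulr0 !add0r => /esym PR.
    transitivity (b y * \int[mu]_(t in `[- r, r]) (g0 (t, y) * (0 + \int[mu]_(s0 in `[- r, t]) e s0) +
        e t * (0 + \int[mu]_(s0 in `[- r, t]) g0 (s0, y)))).
      rewrite -RintegralZl//; last first.
        by apply: integrable_RD => //; exact: integrable_mul_indefinite.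
      rewrite [RHS]Rintegral_mkcond; apply: eq_Rintegral => x _; rewrite [RHS]patchE /G /=.
      have [xr|xr] := boolP (x \in _).
        rewrite indicE xr /= !add0r -EE; ring.
      have -> : e x = 0 by apply: e0; move: xr; rewrite mem_setE in_itv/= -ler_norml -ltNge => /ltW.
      have -> : E x = 0 by apply: Eout; move: xr; rewrite mem_setE in_itv/= -ler_norml -ltNge => /ltW.
      by rewrite !mul0r !mulr0 addr0.
    by rewrite PR mulr0.
  have W3 : \int[m2]_z ((f0 z - G z) * (e z.1 * b z.2)) = 0.
    under eq_Rintegral do rewrite mulrBl.
    by rewrite RintegralB//; [rewrite W W2 subrr|exact: prodi|exact: prodi].
  transitivity (\int[m2]_z (h2 z * (a z.1 * b z.2))).
    rewrite Rintegral_mkcond; apply: eq_Rintegral => z _; rewrite patchE.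
    case: ifPn => // zQ; have [z1|z1] := leP r `|z.1|; first by rewrite a0// mul0r mulr0.
    have [z2|z2] := leP s `|z.2|; first by rewrite b0// !mulr0.
    by move: zQ; rewrite notin_setE; case; split; rewrite /= in_itv/= -ltr_norml.
  have K1 : m2.-integrable setT (EFin \o (fun z : R * R => (\1_`[- r, r] z.1 * H0 z.2) * (a z.1 * b z.2))) by exact: prodi.
  have K2 : m2.-integrable setT (EFin \o (fun z : R * R => (f0 z - G z) * (be z.1 * b z.2))) by exact: prodi.
  (* Fubini exchanges the roles of a and be: the integral of a over a line is c, and H0 is the
     integral of f - G against be. *)
  have K3 : \int[m2]_z ((\1_`[- r, r] z.1 * H0 z.2) * (a z.1 * b z.2)) =
            \int[m2]_z (c * ((f0 z - G z) * (be z.1 * b z.2))).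
    rewrite (Rfubini_pt ord0 K1) (Rfubini_pt ord0); last exact: integrable_RZ.
    apply: ae_eq_Rintegral => //.
    + exact: (measurable_Rfubini ord0 K1).
    + exact: (measurable_Rfubini ord0 (integrable_RZ c measurableT K2)).
    have h1b : m2.-integrable setT (EFin \o (fun z => (f0 z - G z) * (be z.1 * one z.2))) by exact: prodi.
    apply: aeS (ae_integrable_pt ord0 h1b) => y; rewrite /pt eqxx /= => hy _.
    transitivity (c * b y * H0 y).
      have -> : c * b y * H0 y = (H0 y * b y) * c by ring.
      rewrite /c -RintegralZl//; last exact: ci.
      rewrite [RHS]Rintegral_mkcond; apply: eq_Rintegral => x _; rewrite indicE patchE.
      case: ifPn => xr /=; last by rewrite !mul0r.
      ring.
    rewrite /H0 -RintegralZl//; last by move: hy; congr (_.-integrable _ _); apply/funext => x /=; rewrite mulr1.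
    by apply: eq_Rintegral => x _; ring.
  rewrite /h2; under eq_Rintegral do rewrite mulrBl.
  rewrite RintegralB//; last first.
    have := integrable_RZ I measurableT (prodi _ _ _ h1i ca cb ab bb).
    by congr (_.-integrable _ _); apply/funext => z /=; rewrite mulrA.
  rewrite K3 -RintegralB//; [| |exact: integrable_RZ].
    rewrite -[RHS]W3; apply: eq_Rintegral => z _; rewrite /e; ring.
  have := integrable_RZ I measurableT (prodi _ _ _ h1i ca cb ab bb).
  by congr (_.-integrable _ _); apply/funext => z /=; rewrite mulrA.
have aek := ae_pt ord0 key.
apply: aeS aek => y hy ys; exists (I^-1 * H0 y).
(* The fundamental lemma speaks of the open rectangle, the claim of the closed interval; the two end
   points are a null set. *)
have ae_end : {ae mu, forall x : R, x != - r /\ x != r}.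
  exists [set - r; r]; split; [by apply: measurableU|by apply: countable_lebesgue_measure0; apply: finite_set_countable|].
  move=> x /= /not_andP[] /negP; rewrite negbK => /eqP ->; [by left|by right].
apply: aeS (aeI hy ae_end) => x; rewrite /pt eqxx => -[hx [x1 x2]] xr.
have yr : - s <= y <= s by rewrite -ler_norml ltW.
have := hx; rewrite /h2 /f0 /G /= => /(_ _)/eqP.
rewrite subr_eq0 => E1.
have {E1}/eqP : I * (f (x, y) - \int[mu]_(t in `[- r, x]) g (t, y)) == H0 y.
  move: xr => /=; rewrite in_itv/= => xr.
  have := E1; rewrite patchE mem_set; last by split; rewrite /= in_itv/=.
  rewrite indicE mem_set ?mul1r /=; last by rewrite in_itv.
  rewrite (_ : \int[mu]_(t in `[- r, x]) g0 (t, y) = \int[mu]_(t in `[- r, x]) g (t, y)).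
    apply; split; rewrite /= in_itv /=; last by rewrite -ltr_norml.
    by case/andP: xr => a1 a2; rewrite !lt_neqAle eq_sym x1 x2 a1 a2.
  apply: eq_Rintegral => t; rewrite inE /= in_itv /= => /andP[t1 t2]; rewrite /g0 patchE mem_set//.
  by split; rewrite /= in_itv /= ?t1 ?(le_trans t2)//; case/andP: xr.
by move=> <-; rewrite mulKf// subrK.
Qed.
End ACLOfWeak.

Lemma ae_forall_count d (T : measurableType d) (R : realType) (m : {measure set T -> \bar R})
  (I : countType) (P : I -> T -> Prop) :
  (forall k, {ae m, forall x, P k x}) -> {ae m, forall x, forall k, P k x}.
Proof.
move=> h; have : {ae m, forall x, forall n : nat, (fun n x => if unpickle n is Some k then P k x else True) n x}.
  apply: ae_foralln => n; case: (unpickle n) => [k|]; [exact: h|exact: aeW].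
by apply: aeS => x hx k; have := hx (pickle k); rewrite pickleK.
Qed.

(** * Calculus of weak derivatives *)

Section WeakCalculus.
Variable R : realType.
Local Notation mu := (@lebesgue_measure R).
Local Notation D := (@disc R).
Local Notation plane := (measurableTypeR R * measurableTypeR R)%type.
Local Notation m2 := (leb2 R).
Implicit Types (f g phi : R * R -> R) (i : 'I_2) (p q : R * R).
Let mD : measurable (D : set plane) := @measurable_disc R.

(** The identity for i = 0, the reflection in the diagonal for i = 1. It preserves the disc and the
    measure, so the lemma of du Bois-Reymond is needed along the first axis only. *)
Definition turn i (f : R * R -> R) : R * R -> R := fun z => f (pt i z.1 z.2).

Lemma turn_patch i f : turn i f \_ D = turn i (f \_ D).
Proof.
apply/funext => z; rewrite /turn !patchE.
suff -> : (z \in D) = (pt i z.1 z.2 \in D) by [].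
have h := disc_pt i z.1 z.2.
by apply/idP/idP; rewrite !inE => k; [apply/h|move/h : k].
Qed.

Lemma measurable_turn i f : measurable_fun (setT : set plane) f -> measurable_fun (setT : set plane) (turn i f).
Proof. by move=> mf; apply: (measurableT_comp mf); exact: measurable_pt. Qed.

Lemma integral_turn i (f : R * R -> \bar R) : measurable_fun (setT : set plane) f -> (forall p, 0 <= f p)%E ->
  (\int[m2]_z f (pt i z.1 z.2) = \int[m2]_z f z)%E.
Proof.
move=> mf f0; rewrite [RHS](fubini_tonelli_pt i)// (fubini_tonelli_pt ord0) ?/pt//.
by apply: (measurableT_comp mf); exact: measurable_pt.
Qed.

Lemma integrable_turn i f : m2.-integrable setT (EFin \o f) -> m2.-integrable setT (EFin \o turn i f).
Proof.
move=> fi; have mf : measurable_fun (setT : set plane) f by apply/measurable_EFinP; exact: measurable_int fi.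
apply/integrableP; split; first by apply/measurable_EFinP; exact: measurable_turn.
have /integrableP[_] := fi; congr (_ < _)%E.
rewrite -(@integral_turn i (fun p => `|(f p)%:E|%E))//.
by apply: measurableT_comp => //; exact/measurable_EFinP.
Qed.

Lemma Rintegral_turn i f : m2.-integrable D (EFin \o f) ->
  \int[m2]_(z in D) turn i f z = \int[m2]_(z in D) f z.
Proof.
move=> fi; have fi0 := (@integrable_mkcondR _ _ _ m2 D f mD).1 fi.
rewrite [LHS]Rintegral_mkcond [RHS]Rintegral_mkcond.
rewrite turn_patch (Rfubini_pt ord0 (integrable_turn i fi0)) (Rfubini_pt i fi0).
by rewrite /turn /pt /=.
Qed.

Lemma sqint_turn i f : sqint f -> sqint (turn i f).
Proof.
move=> [mf fi]; split.
  apply/(measurable_restrictT _ mD); rewrite turn_patch; apply: measurable_turn.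
  exact/(measurable_restrictT _ mD).
have := integrable_turn i ((@integrable_mkcondR _ _ _ m2 D (fun p => f p ^+ 2) mD).1 fi).
rewrite -turn_patch => h.
exact: (@integrable_mkcondR _ _ _ m2 D (turn i (fun p => f p ^+ 2)) mD).2.
Qed.

(** Countably many centred rectangles with rational sides cover the disc; this is how local
    statements are assembled up to a null set. *)
Lemma disc_rat p : D p -> exists q : rat * rat,
  [/\ `|p.1| < ratr q.1 :> R, `|p.2| < ratr q.2 :> R & (ratr q.1 : R) ^+ 2 + (ratr q.2 : R) ^+ 2 < 1].
Proof.
move=> Dp.
have step (x y : R) : x ^+ 2 + y ^+ 2 < 1 -> exists2 q : rat, `|x| < ratr q :> R & (ratr q : R) ^+ 2 + y ^+ 2 < 1.
  move=> xy; pose r' := Num.sqrt (1 - y ^+ 2).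
  have rr' : `|x| < r' by rewrite -sqrtr_sqr ltr_sqrt; have := sqr_ge0 x; lra.
  have [q] := rat_in_itvoo rr'; rewrite in_itv/= => /andP[h1 h2]; exists q => //.
  have : (ratr q : R) ^+ 2 < r' ^+ 2 by rewrite ltr_sqr ?nnegrE ?sqrtr_ge0// ltW// (le_lt_trans _ h1).
  by rewrite sqr_sqrtr; have := sqr_ge0 x; lra.
have [q1 h1 h1'] := step p.1 p.2 Dp.
have h3 : p.2 ^+ 2 + (ratr q1) ^+ 2 < 1 by rewrite addrC.
have [q2 h2 h2'] := step _ _ h3.
by exists (q1, q2); split => //=; rewrite addrC.
Qed.

Lemma weak_tensor i f g (r s : R) (a a' b : R -> R) : sqint f -> is_weak_pd i f g ->
  0 < r -> 0 < s -> r ^+ 2 + s ^+ 2 < 1 ->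
  (forall k, smoothk k a) -> (forall k, smoothk k a') -> (forall k, smoothk k b) ->
  (forall x, is_derive x (1 : R) a (a' x)) ->
  (forall x, r <= `|x| -> a x = 0) -> (forall x, s <= `|x| -> b x = 0) ->
  \int[m2]_(z in D) (turn i f z * (a' z.1 * b z.2)) = - \int[m2]_(z in D) (turn i g z * (a z.1 * b z.2)).
Proof.
move=> sf [/Lp_disc2P sg fg] r0 s0 rs sa sa' sb da a0 b0.
have ca' : continuous a' by exact: (sa' 0%N).
have cb : continuous b by exact: (sb 0%N).
have ca : continuous a by exact: (sa 0%N).
have tphi : test_fun (tensor i a b).
  by apply: (@test_tensor R i a b r s (ltW r0) (ltW s0) rs sa sb) => x /ltW h; [exact: a0|exact: b0].
have [rho [C [_ [_ [c1 c2]] bphi _]]] := test_funP i tphi.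
have := fg _ tphi.
rewrite -(@Rintegral_turn i (fun p => f p * pd i (tensor i a b) p)); last first.
  apply: sqint_mul => //; apply: (@sqint_bounded _ _ C).
    by apply: open_continuous_measurable_plane => //; exact: open_disc.
  by apply: aeW => p Dp; exact: (bphi p Dp).2.
rewrite -(@Rintegral_turn i (fun p => g p * tensor i a b p)); last first.
  apply: sqint_mul => //; apply: (@sqint_bounded _ _ C).
    by apply: open_continuous_measurable_plane => //; exact: open_disc.
  by apply: aeW => p Dp; exact: (bphi p Dp).1.
have E1 : \int[m2]_(x in D) turn i (fun p => f p * pd i (tensor i a b) p) x =
          \int[m2]_(z in D) (turn i f z * (a' z.1 * b z.2)).
  apply: eq_Rintegral => z /set_mem Dz; rewrite /turn (pd_tensor_dir da)//.
  exact/disc_pt.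
have E2 : \int[m2]_(x in D) turn i (fun p => g p * tensor i a b p) x =
          \int[m2]_(z in D) (turn i g z * (a z.1 * b z.2)).
  by apply: eq_Rintegral => z _; rewrite /turn tensor_pt.
by rewrite E1 E2.
Qed.

(** The lemma of du Bois-Reymond on each of the countably many rational rectangles gives one
    exceptional null set of lines; every chord fits into one of these rectangles. *)
Lemma weak_ACL i f g : sqint f -> is_weak_pd i f g -> ACL i f g.
Proof.
move=> sf fg; have sg : sqint g by case: fg => /Lp_disc2P.
pose P (q : rat * rat) (y : R) := 0 < ratr q.1 :> R -> 0 < ratr q.2 :> R -> (ratr q.1 : R) ^+ 2 + (ratr q.2 : R) ^+ 2 < 1 ->
  `|y| < ratr q.2 -> exists c : R, {ae mu, forall x, `[- ratr q.1, ratr q.1]%classic x ->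
    f (pt i x y) = c + \int[mu]_(t in `[- ratr q.1, x]) g (pt i t y)}.
have ae1 : {ae mu, forall y, forall q : rat * rat, P q y}.
  apply: ae_forall_count => q.
  have [q1|q1] := pselect (0 < ratr q.1 :> R); last by apply: aeW => y ?.
  have [q2|q2] := pselect (0 < ratr q.2 :> R); last by apply: aeW => y ? ?.
  have [q3|q3] := pselect ((ratr q.1 : R) ^+ 2 + (ratr q.2 : R) ^+ 2 < 1); last by apply: aeW => y ? ? ?.
  have := @dubois_reymond R (turn i f) (turn i g) _ _ (sqint_turn i sf) (sqint_turn i sg) q1 q2 q3 _.
  move=> dbr; refine (aeS _ (dbr _)); first by move=> y hy _ _ _; exact: hy.
  move=> a a' b sa sa' sb da a0 a'0 b0; exact: (weak_tensor sf fg q1 q2 q3 sa sa' sb da a0 b0).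
apply: aeS (aeI ae1 (ae_chord_integrable i (sqint_integrable sg))) => y [hy giy] r cy.
have [r0 ry] := cy.
have [[q1 q2] /= [rq1 yq2 q2q]] := @disc_rat (r, y) ry.
rewrite (gtr0_norm r0) in rq1.
have q10 : 0 < ratr q1 :> R by exact: lt_trans rq1.
have q20 : 0 < ratr q2 :> R by exact: le_lt_trans (normr_ge0 y) _.
have [c hc] := hy (q1, q2) q10 q20 q2q yq2.
have gi : mu.-integrable `[- ratr q1, ratr q1] (EFin \o (fun x => g (pt i x y))).
  apply: giy; split => //; apply: le_lt_trans q2q; rewrite lerD2l.
  by rewrite -[leLHS]real_normK ?num_real// ler_sqr ?nnegrE// ltW.
(* The constant changes with the left end point: the primitive starting at - q1 differs from the one
   starting at - r by this integral. *)
exists (c + \int[mu]_(t in `[- ratr q1, - r]) g (pt i t y)).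
apply: aeS hc => x hx xr.
have := xr; rewrite /= in_itv/= => /andP[x1 x2].
have sub : `[- ratr q1, x] `<=` `[- ratr q1, ratr q1] by apply: subset_itvl; rewrite bnd_simp; lra.
rewrite hx; last by rewrite /= in_itv/=; apply/andP; split; lra.
rewrite -addrA; congr (_ + _); apply/eqP; rewrite addrC -subr_eq; apply/eqP.
have gi' : mu.-integrable `[- ratr q1, x] (EFin \o (fun x => g (pt i x y))) by apply: integrableS gi.
rewrite Rintegral_itvB//; [|by rewrite bnd_simp; lra].
rewrite Rintegral_itv_obnd_cbnd//.
by apply: integrableS gi' => //; apply: subset_itvr; rewrite bnd_simp; lra.
Qed.

(** On each rational rectangle products of plateaus are admissible test functions, and the
    fundamental lemma applies to the difference. *)
Lemma weak_pd_unique i f g1 g2 : sqint f -> is_weak_pd i f g1 -> is_weak_pd i f g2 ->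
  {ae m2, forall p, D p -> g1 p = g2 p}.
Proof.
move=> sf fg1 fg2; have sg1 : sqint g1 by case: fg1 => /Lp_disc2P.
have sg2 : sqint g2 by case: fg2 => /Lp_disc2P.
pose P (q : rat * rat) (p : R * R) := 0 < ratr q.1 :> R -> 0 < ratr q.2 :> R -> (ratr q.1 : R) ^+ 2 + (ratr q.2 : R) ^+ 2 < 1 ->
  `|p.1| < ratr q.1 -> `|p.2| < ratr q.2 -> g1 p = g2 p.
have ae1 : {ae m2, forall p, forall q : rat * rat, P q p}.
  apply: ae_forall_count => q.
  have [q1|q1] := pselect (0 < ratr q.1 :> R); last by apply: aeW => y ?.
  have [q2|q2] := pselect (0 < ratr q.2 :> R); last by apply: aeW => y ? ?.
  have [q3|q3] := pselect ((ratr q.1 : R) ^+ 2 + (ratr q.2 : R) ^+ 2 < 1); last by apply: aeW => y ? ? ?.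
  have QD : `]- ratr q.1, ratr q.1[%classic `*` `]- ratr q.2, ratr q.2[%classic `<=` D.
    move=> z [/= z1 z2]; apply: lt_trans q3.
    by move: z1 z2; rewrite !in_itv/= -!ltr_norml => z1 z2; rewrite ltrD// -[ltLHS]real_normK ?num_real// ltr_sqr ?nnegrE// ltW.
  have mQ : measurable (`]- ratr q.1, ratr q.1[%classic `*` `]- ratr q.2, ratr q.2[%classic : set plane).
    by apply: measurableX; exact: measurable_itv.
  have := @fundamental_rect R (fun p => g1 p - g2 p) (- ratr q.1) (ratr q.1) (- ratr q.2) (ratr q.2).
  move=> fr; refine (aeS _ (fr _ _)).
  - move=> z hz _ _ _ z1 z2; apply/eqP; rewrite -subr_eq0; apply/eqP/hz.
    by split; rewrite /= in_itv/= -ltr_norml.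
  - apply: integrableS (integrable_RB mD (sqint_integrable sg1) (sqint_integrable sg2)) => //.
  - move=> x1 x2 y1 y2 n hx1 hx2 hy1 hy2.
    pose a := plateau x1 x2 n; pose b := plateau y1 y2 n.
    have a0 x : ratr q.1 <= `|x| -> a x = 0 by exact: plateau_abs_out.
    have b0 x : ratr q.2 <= `|x| -> b x = 0 by exact: plateau_abs_out.
    have sa k : smoothk k a by exact: smoothk_plateau.
    have sb k : smoothk k b by exact: smoothk_plateau.
    have tphi : test_fun (tensor ord0 a b).
      by apply: (@test_tensor R ord0 a b _ _ (ltW q1) (ltW q2) q3 sa sb) => x /ltW h; [exact: a0|exact: b0].
    have [rho [C [_ [_ [c1 c2]] bphi _]]] := test_funP ord0 tphi.
    have st : sqint (tensor ord0 a b).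
      apply: (@sqint_bounded _ _ C).
        by apply: open_continuous_measurable_plane => //; exact: open_disc.
      by apply: aeW => p Dp; exact: (bphi p Dp).1.
    transitivity (\int[m2]_(p in D) ((g1 p - g2 p) * tensor ord0 a b p)).
      rewrite [LHS]Rintegral_mkcond [RHS]Rintegral_mkcond; apply: eq_Rintegral => z _; rewrite !patchE.
      case: ifPn => [zQ|zQ]; first by rewrite mem_set//; apply: QD; exact: set_mem.
      case: ifPn => // _; rewrite /tensor eqxx.
      have [z1|z1] := leP (ratr q.1) `|z.1|; first by rewrite a0// mul0r mulr0.
      have [z2|z2] := leP (ratr q.2) `|z.2|; first by rewrite b0// !mulr0.
      by move: zQ; rewrite notin_setE; case; split; rewrite /= in_itv/= -ltr_norml.
    under eq_Rintegral do rewrite mulrBl.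
    rewrite RintegralB//; [|exact: sqint_mul|exact: sqint_mul].
    have [_ /(_ _ tphi) e1] := fg1; have [_ /(_ _ tphi) e2] := fg2.
    by move: e1; rewrite e2 => /oppr_inj ->; rewrite subrr.
apply: (aeS _ ae1) => p hp Dp.
have [[q1 q2] /= [q1p yq2 q2q]] := disc_rat Dp.
have q10 : 0 < ratr q1 :> R by exact: le_lt_trans q1p.
have q20 : 0 < ratr q2 :> R by exact: le_lt_trans yq2.
exact: (hp (q1, q2)).
Qed.

Lemma measurable_chord i f (y r : R) : measurable_fun (D : set plane) f -> chord y r ->
  measurable_fun (`[- r, r] : set R) (fun x => f (pt i x y)).
Proof.
move=> mf cy; apply: (@measurable_comp _ _ _ _ _ _ (D : set plane) f _ (fun x => pt i x y)) => //.
  by move=> _ [x xr <-]; exact: chord_disc cy xr.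
by apply: (@measurable_funS _ _ _ _ setT) => //; exact: measurable_ptl.
Qed.

(** Both factors are passed to lines, where [ac_prod] is the product rule, and the product is passed
    back. Boundedness of the factors keeps the derivative square integrable. *)
Lemma weak_pdM i f g f' g' (Cf Cg : R) :
  measurable_fun (D : set plane) f -> measurable_fun (D : set plane) g ->
  {ae m2, forall p, D p -> `|f p| <= Cf} -> {ae m2, forall p, D p -> `|g p| <= Cg} ->
  is_weak_pd i f f' -> is_weak_pd i g g' ->
  is_weak_pd i (fun p => f p * g p) (fun p => f' p * g p + g' p * f p).
Proof.
move=> mf mg fC gC wf wg.
have sf := sqint_bounded mf fC; have sg := sqint_bounded mg gC.
have sf' : sqint f' by case: wf => /Lp_disc2P.
have sg' : sqint g' by case: wg => /Lp_disc2P.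
have sh : sqint (fun p => f' p * g p + g' p * f p).
  by apply: sqintD; [exact: (sqint_mul_bounded sf' mg gC)|exact: (sqint_mul_bounded sg' mf fC)].
have sfg : sqint (fun p => f p * g p) by exact: (sqint_mul_bounded sf mg gC).
apply: ACL_weak => //.
have Af := weak_ACL sf wf; have Ag := weak_ACL sg wg.
have If := ae_chord_integrable i (sqint_integrable sf').
have Ig := ae_chord_integrable i (sqint_integrable sg').
apply: aeS (aeI (aeI Af Ag) (aeI If Ig)) => y [[Afy Agy] [Ify Igy]] r cy.
have r0 : 0 < r by case: cy.
have [c hc] := Afy r cy; have [d hd] := Agy r cy.
have fi := Ify r cy; have gi := Igy r cy.
exists (c * d); apply: aeS (aeI hc hd) => x [hx1 hx2] xr.
rewrite (hx1 xr) (hx2 xr); have := xr; rewrite /= in_itv/= => /andP[x1 x2].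
have sub : `[- r, x] `<=` `[- r, r] by apply: subset_itvl; rewrite bnd_simp.
have fi' : mu.-integrable `[- r, x] (EFin \o (fun x => f' (pt i x y))) by apply: integrableS fi.
have gi' : mu.-integrable `[- r, x] (EFin \o (fun x => g' (pt i x y))) by apply: integrableS gi.
rewrite (ac_prod c d x1 fi' gi'); congr (_ + _).
have mi (h : R -> R) : mu.-integrable `[- r, x] (EFin \o h) -> measurable_fun (`[- r, x] : set R) (fun x => \int[mu]_(t in `[- r, x]) h t).
  by move=> hi; exact: (measurable_indefinite x1 hi).
have mIf (h : R * R -> R) : measurable_fun (D : set plane) h -> measurable_fun (`[- r, x] : set R) (fun x => h (pt i x y)).
  by move=> mh; apply: (measurable_funS _ sub) => //; exact: measurable_chord.
apply: ae_eq_Rintegral => //.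
- apply: measurable_funD; apply: measurable_funM; try by apply: mIf; first [exact: sf'.1|exact: sg'.1].
    by apply: measurable_funD => //; exact: mi.
  by apply: measurable_funD => //; exact: mi.
- by apply: measurable_funD; apply: measurable_funM; apply: mIf => //; first [exact: sf'.1|exact: sg'.1].
- by apply: aeS (aeI hc hd) => t [h1 h2] tx; rewrite (h1 (sub _ tx)) (h2 (sub _ tx)).
Qed.

Lemma weak_pd_classical i f f' (C : R) :
  (forall p, D p -> is_derive p (dir R i) f (f' p)) ->
  (forall p, D p -> {for p, continuous f}) -> (forall p, D p -> {for p, continuous f'}) ->
  (forall p, D p -> `|f p| <= C) -> (forall p, D p -> `|f' p| <= C) ->
  is_weak_pd i f f'.
Proof.
move=> df cf cf' fC f'C.
have mc (h : R * R -> R) : (forall p, D p -> {for p, continuous h}) -> measurable_fun (D : set plane) h.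
  by move=> ch; apply: open_continuous_measurable_plane => //; exact: open_disc.
apply: ACL_weak.
- by apply: (@sqint_bounded _ _ C); [exact: mc|exact: aeW].
- by apply: (@sqint_bounded _ _ C); [exact: mc|exact: aeW].
apply: aeW => y r cy; have [_ h] := chord_FTC df cf' cy.
exists (f (pt i (- r) y)); apply: aeW => x; rewrite /= in_itv/= => xr.
by rewrite h// addrC subrK.
Qed.

Lemma is_weak_pdD i f g f' g' : sqint f -> sqint g -> is_weak_pd i f f' -> is_weak_pd i g g' ->
  is_weak_pd i (fun p => f p + g p) (fun p => f' p + g' p).
Proof.
move=> sf sg [/Lp_disc2P sf' hf] [/Lp_disc2P sg' hg]; split; first by apply/Lp_disc2P; exact: sqintD.
move=> phi tphi; have [rho [C [_ [_ [c1 c2]] bphi _]]] := test_funP i tphi.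
have sphi : sqint phi.
  apply: (@sqint_bounded _ _ C); last by apply: aeW => p Dp; exact: (bphi p Dp).1.
  by apply: open_continuous_measurable_plane => //; exact: open_disc.
have sphi' : sqint (pd i phi).
  apply: (@sqint_bounded _ _ C); last by apply: aeW => p Dp; exact: (bphi p Dp).2.
  by apply: open_continuous_measurable_plane => //; exact: open_disc.
under eq_Rintegral do rewrite mulrDl.
under [in RHS]eq_Rintegral do rewrite mulrDl.
by rewrite !RintegralD// ?hf ?hg// ?opprD//; exact: sqint_mul.
Qed.

Lemma is_weak_pdZ i (c : R) f f' : sqint f -> is_weak_pd i f f' ->
  is_weak_pd i (fun p => c * f p) (fun p => c * f' p).
Proof.
move=> sf [/Lp_disc2P sf' hf]; split; first by apply/Lp_disc2P; exact: sqintZ.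
move=> phi tphi; have [rho [C [_ [_ [c1 c2]] bphi _]]] := test_funP i tphi.
have sphi : sqint phi.
  apply: (@sqint_bounded _ _ C); last by apply: aeW => p Dp; exact: (bphi p Dp).1.
  by apply: open_continuous_measurable_plane => //; exact: open_disc.
have sphi' : sqint (pd i phi).
  apply: (@sqint_bounded _ _ C); last by apply: aeW => p Dp; exact: (bphi p Dp).2.
  by apply: open_continuous_measurable_plane => //; exact: open_disc.
under eq_Rintegral do rewrite -mulrA.
under [in RHS]eq_Rintegral do rewrite -mulrA.
by rewrite !RintegralZl ?hf ?mulrN//; exact: sqint_mul.
Qed.
End WeakCalculus.

(** * Compactness and the direct method *)

Section AlmostEverywhereLimits.
Context d (T : measurableType d) (R : realType) (m : {measure set T -> \bar R}) (A : set T).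
Hypothesis mA : measurable A.
Implicit Types (f g h : T -> R).

Lemma ae_le_Rintegral f g : m.-integrable A (EFin \o f) -> m.-integrable A (EFin \o g) ->
  {ae m, forall x, A x -> f x <= g x} -> \int[m]_(x in A) f x <= \int[m]_(x in A) g x.
Proof.
move=> fi gi fg.
have mf : measurable_fun A f by apply/measurable_EFinP; exact: measurable_int fi.
have mg : measurable_fun A g by apply/measurable_EFinP; exact: measurable_int gi.
rewrite -subr_ge0 -RintegralB//.
rewrite (@ae_eq_Rintegral _ _ _ m A (fun x => g x - f x) (fun x => `|g x - f x|))//.
- by apply: Rintegral_ge0 => x _; exact: normr_ge0.
- exact: measurable_funB.
- by apply: measurableT_comp => //; exact: measurable_funB.
- by apply: aeS fg => x h Ax; rewrite ger0_norm// subr_ge0; exact: h.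
Qed.

Lemma Rfatou (h_ : nat -> T -> R) h (M : R) :
  (forall n, m.-integrable A (EFin \o h_ n)) -> measurable_fun A h ->
  (forall n x, A x -> 0 <= h_ n x) ->
  {ae m, forall x, A x -> h_ n x @[n --> \oo] --> h x} ->
  (forall n, \int[m]_(x in A) h_ n x <= M) ->
  m.-integrable A (EFin \o h) /\ \int[m]_(x in A) h x <= M.
Proof.
move=> hi mh h0 hcvg hM.
have mh_ n : measurable_fun A (EFin \o h_ n) by exact: measurable_int (hi n).
have mabs : measurable_fun A (fun x => `|(h x)%:E|%E).
  by apply/measurable_EFinP; exact: measurableT_comp.
have key : (\int[m]_(x in A) `|(h x)%:E| <= M%:E)%E.
  rewrite (@ae_eq_integral _ _ _ m A (fun x => limn_einf (fun n => (h_ n x)%:E)) (fun x => `|(h x)%:E|%E))//.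
  - apply: (le_trans (fatou m mA mh_ _)); first by move=> n x Ax; rewrite lee_fin; exact: h0.
    rewrite limn_einf_lim; apply: lime_le; first exact: is_cvg_einfs.
    apply: nearW => n; apply: (@le_trans _ _ (\int[m]_(x in A) (h_ n x)%:E)%E).
      by apply: ereal_inf_lbound; exists n => /=.
    by rewrite -EFin_Rintegral// lee_fin.
  - have -> : (fun x => limn_einf (fun n => (h_ n x)%:E)) =
             (fun x => - limn_esup (fun n => - (h_ n x)%:E))%E by [].
    apply: measurableT_comp => //.
    apply: (@measurable_fun_limn_esup _ _ _ A (fun n x => - (h_ n x)%:E)%E) => n.
    have : measurable_fun A (fun x => - h_ n x).
      by apply: measurableT_comp => //; apply/measurable_EFinP; exact: mh_.
    by move/measurable_EFinP.
  - apply: aeS hcvg => x hx Ax; have {}hx := hx Ax.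
    have hxE : (h_ n x)%:E @[n --> \oo] --> (h x)%:E by apply: cvg_EFin; [exact: nearW|exact: hx].
    rewrite is_cvg_limn_einfE; last by apply/cvg_ex; exists (h x)%:E.
    have -> : (limn (fun n => (h_ n x)%:E) = (h x)%:E)%E by exact/cvg_lim.
    rewrite gee0_abs// lee_fin.
    by apply: (cvgr_to_ge hx); apply: nearW => n; exact: h0.
have ih : m.-integrable A (EFin \o h).
  apply/integrableP; split; first exact/measurable_EFinP.
  by apply: le_lt_trans key _; rewrite ltry.
split => //; rewrite -lee_fin EFin_Rintegral//; apply: le_trans key.
by apply: le_integral => //; [exact: integrable_abse|move=> x _; exact: lee_abs].
Qed.

(** The upper limit is measurable and agrees with the limit wherever the latter exists. *)
Lemma ae_cvgn_limit (f_ : nat -> T -> R) : (forall n, measurable_fun A (f_ n)) ->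
  {ae m, forall x, A x -> cvgn (f_ ^~ x)} ->
  exists2 F : T -> R, measurable_fun A F & {ae m, forall x, A x -> f_ n x @[n --> \oo] --> F x}.
Proof.
move=> mf cf; exists (fun x => fine (limn_esup (fun n => (f_ n x)%:E))).
  apply: measurableT_comp => //.
  by apply: (@measurable_fun_limn_esup _ _ _ A (fun n x => (f_ n x)%:E)) => n; exact/measurable_EFinP.
apply: aeS cf => x cf Ax; have /cvg_ex[l hl] := cf Ax.
rewrite is_cvg_limn_esupE.
  have -> : (limn (fun n => (f_ n x)%:E) = l%:E)%E by apply/cvg_lim => //; apply: cvg_EFin; [exact: nearW|exact: hl].
  by [].
by apply/cvg_ex; exists l%:E; apply: cvg_EFin; [exact: nearW|exact: hl].
Qed.

(** The series of the increments has a finite L1 norm, so it converges absolutely almost everywhere;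
    the sequence is its partial sums by telescoping. *)
Lemma ae_cvg_summable (f_ : nat -> T -> R) (C : R) :
  (forall n, measurable_fun A (f_ n)) ->
  (forall n, m.-integrable A (EFin \o (fun x => f_ n.+1 x - f_ n x))) ->
  (forall n, \int[m]_(x in A) `|f_ n.+1 x - f_ n x| <= C * 2^-1 ^+ n) ->
  {ae m, forall x, A x -> cvgn (f_ ^~ x)}.
Proof.
move=> mf fi fC.
pose h n x : R := `|f_ n.+1 x - f_ n x|.
have h0 n x : 0 <= h n x by exact: normr_ge0.
have mh n : measurable_fun A (h n).
  by apply: measurableT_comp => //; exact: measurable_funB.
have hi n : m.-integrable A (EFin \o h n) by exact: integrable_abse (fi n).
have C0 : 0 <= C.
  have := fC 0%N; rewrite expr0 mulr1; apply: le_trans.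
  by apply: Rintegral_ge0 => x _; exact: normr_ge0.
have sumh : (\sum_(n <oo) \int[m]_(x in A) (h n x)%:E <= (2 * C)%:E)%E.
  apply: lime_le.
    by apply: is_cvg_nneseries => n _ _; apply: integral_ge0 => x _; rewrite lee_fin.
  (* The partial sums of C 2^-n are 2 C (1 - 2^-n), a form in which the induction closes. *)
  apply: nearW => n; rewrite (_ : (2 * C)%:E = (2 * C * (1 - 2^-1 ^+ n))%:E + (2 * C * 2^-1 ^+ n)%:E)%E; last first.
    by rewrite -EFinD; congr EFin; ring.
  rewrite -[leLHS]adde0; apply: leeD; last by rewrite lee_fin mulr_ge0 ?mulr_ge0// exprn_ge0.
  elim: n => [|n IH]; first by rewrite big_nil expr0 subrr mulr0.
  have IH' := IH; rewrite big_nat_recr//= (_ : (2 * C * (1 - 2^-1 ^+ n.+1))%:E = (2 * C * (1 - 2^-1 ^+ n))%:E + (C * 2^-1 ^+ n)%:E)%E; last first.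
    by rewrite -EFinD; congr EFin; rewrite exprS; field.
  by apply: (leeD IH); rewrite -EFin_Rintegral//; exact: fC.
have si : m.-integrable A (fun x => \sum_(n <oo) (h n x)%:E)%E.
  apply/integrableP; split.
    apply: (@ge0_emeasurable_sum _ _ _ A (fun n x => (h n x)%:E) xpredT) => [k x _ _|k _].
      by rewrite lee_fin.
    exact/measurable_EFinP.
  have -> : (\int[m]_(x in A) `|\sum_(n <oo) (h n x)%:E| = \int[m]_(x in A) (\sum_(n <oo) (h n x)%:E))%E.
    by apply: eq_integral => x _; rewrite gee0_abs//; apply: nneseries_ge0 => n _ _; rewrite lee_fin.
  rewrite (@integral_nneseries _ _ _ m A mA (fun n x => (h n x)%:E)).
  - by apply: le_lt_trans sumh _; rewrite ltry.
  - by move=> n; exact/measurable_EFinP.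
  - by move=> n x _; rewrite lee_fin.
apply: aeS (integrable_ae mA si) => x hx Ax.
have {}hx := hx Ax.
have ch : cvgn (series (h ^~ x)).
  apply: nondecreasing_is_cvgn; first by apply: nondecreasing_series => n _ _; exact: normr_ge0.
  exists (fine (\sum_(n <oo) (h n x)%:E)%E) => _ [n _ <-].
  rewrite -lee_fin fineK// /series/= -sumEFin.
  by apply: (@nneseries_lim_ge R (fun n => (h n x)%:E) xpredT 0%N n) => k _ _; rewrite lee_fin.
have /(@normed_cvg R R^o) cs : cvgn [normed series (telescope (f_ ^~ x)) : nat -> R^o] by exact: ch.
rewrite (_ : f_ ^~ x = (fun n => f_ 0%N x + series (telescope (f_ ^~ x)) n)); last first.
  by apply/funext => n; exact: eq_sum_telescope.
by apply: is_cvgD => //; exact: is_cvg_cst.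
Qed.
End AlmostEverywhereLimits.

Section SqintComplete.
Variable R : realType.
Local Notation D := (@disc R).
Local Notation plane := (measurableTypeR R * measurableTypeR R)%type.
Local Notation m2 := (leb2 R).
Implicit Types (f g : R * R -> R).
Let mD : measurable (D : set plane) := @measurable_disc R.

Lemma sqintB f g : sqint f -> sqint g -> sqint (fun p => f p - g p).
Proof.
move=> sf sg; have := sqintD sf (sqintZ (-1) sg).
by under [X in sqint X]funext do rewrite mulN1r.
Qed.

(** Riesz-Fischer: a fast subsequence converges almost everywhere, and Fatou compares its limit with
    the whole sequence. *)
Lemma sqint_complete (g_ : nat -> R * R -> R) : (forall n, sqint (g_ n)) ->
  (forall e : R, 0 < e -> exists J, forall j k, (J <= j)%N -> (J <= k)%N ->
     \int[m2]_(p in D) ((g_ j p - g_ k p) ^+ 2) <= e) ->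
  exists2 G, sqint G & forall e : R, 0 < e -> exists J, forall j, (J <= j)%N ->
     \int[m2]_(p in D) ((G p - g_ j p) ^+ 2) <= e.
Proof.
move=> sg cg.
have /choice[J hJ] : forall n, exists J, forall j k, (J <= j)%N -> (J <= k)%N ->
   \int[m2]_(p in D) ((g_ j p - g_ k p) ^+ 2) <= (4^-1 ^+ n : R).
  by move=> n; apply: cg; rewrite exprn_gt0// invr_gt0.
(* The sum makes K n and K (n+1) both at least J n without assuming that J is monotone; the summand
   n makes K tend to infinity. *)
pose K n := (n + \sum_(i < n.+1) J i)%N.
have JK n : (J n <= K n)%N by rewrite /K big_ord_recr/=; lia.
have JK' n : (J n <= K n.+1)%N by rewrite /K !big_ord_recr/=; lia.
pose u n := g_ (K n).
pose vol := \int[m2]_(p in D) (1 : R).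
have sd j k : sqint (fun p => g_ j p - g_ k p) by exact: sqintB.
have [G mG uG] : exists2 G : R * R -> R, measurable_fun (D : set plane) G & {ae m2, forall p, D p -> u n p @[n --> \oo] --> G p}.
  apply: (@ae_cvgn_limit _ _ _ m2 D u); first by move=> n; case: (sg (K n)).
  apply: (@ae_cvg_summable _ _ _ m2 D mD u ((1 + vol) / 2)).
  - by move=> n; case: (sg (K n)).
  - by move=> n; exact: (sqint_integrable (sd (K n.+1) (K n))).
  move=> n.
  have i1 := (sd (K n.+1) (K n)).2.
  have i2 := @integrable_cst_disc R 1.
  (* The inequality |a| <= a^2 / (2 z) + z / 2 turns the bound z^2 on the squared L2 norm into the
     L1 bound z (1 + vol) / 2 required for summability. *)
  pose z := (2^-1 : R) ^+ n; have z0 : 0 < z by rewrite exprn_gt0// invr_gt0.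
  have I1 := @integrable_RZ _ _ _ m2 D _ (z^-1 / 2) mD i1.
  have I2 := @integrable_RZ _ _ _ m2 D _ (z / 2) mD i2.
  apply: (@le_trans _ _ (\int[m2]_(p in D) (z^-1 / 2 * (u n.+1 p - u n p) ^+ 2 + z / 2 * 1))).
    apply: le_Rintegral => //.
    - exact: (integrable_abse (sqint_integrable (sd (K n.+1) (K n)))).
    - exact: (integrable_RD mD I1 I2).
    move=> p _; rewrite mulr1.
    set a := u n.+1 p - u n p.
    rewrite -subr_ge0 (_ : _ - _ = z^-1 / 2 * (`|a| - z) ^+ 2).
      by rewrite mulr_ge0 ?sqr_ge0// divr_ge0// invr_ge0 ltW.
    by rewrite -(real_normK (num_real a)); field; rewrite gt_eqF.
  rewrite (RintegralD mD I1 I2) (RintegralZl _ mD i1) (RintegralZl _ mD i2) -/vol.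
  have : \int[m2]_(p in D) (u n.+1 p - u n p) ^+ 2 <= z ^+ 2.
    by rewrite /z -exprM mulnC exprM expr2 -invfM -natrM; exact: hJ.
  move=> h; have := ler_pM2l (_ : 0 < z^-1 / 2); rewrite divr_gt0// ?invr_gt0// => /(_ isT).
  move=> /(_ (\int[m2]_(p in D) (u n.+1 p - u n p) ^+ 2) (z ^+ 2)); rewrite h.
  have -> : z^-1 / 2 * z ^+ 2 = z / 2 by field; rewrite gt_eqF.
  by rewrite /u -/z => h'; lra.
have GB e : 0 < e -> exists J, forall j, (J <= j)%N ->
    m2.-integrable D (EFin \o (fun p => (G p - g_ j p) ^+ 2)) /\ \int[m2]_(p in D) ((G p - g_ j p) ^+ 2) <= e.
  move=> e0; have [J0 hJ0] := cg e e0; exists J0 => j Jj.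
  (* The shift by J0 brings every index K (n + J0) into the Cauchy range. *)
  apply: (@Rfatou _ _ _ m2 D mD (fun n p => (u (n + J0)%N p - g_ j p) ^+ 2)).
  - by move=> n; case: (sd (K (n + J0)%N) j).
  - by apply: measurable_funX; apply: measurable_funB => //; case: (sg j).
  - by move=> n x _; exact: sqr_ge0.
  - apply: aeS uG => p hp Dp.
    have : (fun x : R => (x - g_ j p) ^+ 2) \o (fun n => u (n + J0)%N p) @ \oo --> (G p - g_ j p) ^+ 2.
      apply: continuous_cvg; last by rewrite (cvg_shiftn J0 (u ^~ p)); exact: hp.
      apply: (@continuousM _ _ (fun x : R => x - g_ j p)); apply: continuousB; try exact: cvg_id; exact: cvg_cst.
    by [].
  - by move=> n; apply: hJ0 => //; rewrite /K; lia.
exists G.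
  have [J1 /(_ J1 (leqnn _))[i1 _]] := GB 1 ltr01.
  have s1 : sqint (fun p => G p - g_ J1 p).
    by split => //; apply: measurable_funB => //; case: (sg J1).
  by have := sqintD s1 (sg J1); under [X in sqint X]funext do rewrite subrK.
by move=> e e0; have [J1 h1] := GB e e0; exists J1 => j /h1[].
Qed.
End SqintComplete.

(** * Poincare inequality on rectangles *)

Section Poincare.
Variable R : realType.
Local Notation mu := (@lebesgue_measure R).
Local Notation D := (@disc R).
Local Notation plane := (measurableTypeR R * measurableTypeR R)%type.
Local Notation m2 := (leb2 R).
Implicit Types (f g : R * R -> R) (i : 'I_2).
Let mD : measurable (D : set plane) := @measurable_disc R.

Lemma Rintegral_norm_subset d (T : measurableType d) (m : {measure set T -> \bar R}) (A B : set T) (f : T -> R) :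
  measurable A -> measurable B -> A `<=` B -> m.-integrable B (EFin \o f) ->
  \int[m]_(t in A) `|f t| <= \int[m]_(t in B) `|f t|.
Proof.
move=> mA mB AB fi.
have fiA : m.-integrable A (EFin \o f) by apply: integrableS fi.
rewrite -lee_fin EFin_Rintegral//; last exact: (integrable_norm fiA).
rewrite EFin_Rintegral//; last exact: (integrable_norm fi).
apply: ge0_subset_integral => //.
by apply/measurable_EFinP; apply: measurableT_comp => //; apply/measurable_EFinP; exact: measurable_int fi.
Qed.

Lemma Rintegral_cst_itvoc (a b c : R) : a <= b -> \int[mu]_(x in `]a, b]) c = c * (b - a).
Proof.
move=> ab; rewrite Rintegral_cst//; congr (_ * _).
have := @lebesgue_measure_itv R `]a, b]; rewrite /= lte_fin => ->.
case: ltgtP ab => // -> _.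
by rewrite subrr.
Qed.

Lemma integrable_cst_itvoc (a b c : R) : mu.-integrable `]a, b] (EFin \o (fun=> c)).
Proof.
apply/integrableP; split; first by apply/measurable_EFinP; exact: measurable_cst.
rewrite /= integral_cst//.
have := @lebesgue_measure_itv R `]a, b]; rewrite /= lte_fin => ->.
by case: ifP => _; rewrite -?EFinB -EFinM ltry.
Qed.

Lemma integrable_indic_itvoc (a b : R) : mu.-integrable setT (EFin \o (\1_`]a, b] : R -> R)).
Proof.
have -> : (\1_`]a, b] : R -> R) = (cst 1 : R -> R) \_ `]a, b].
  by apply/funext => x; rewrite patchE indicE; case: ifP.
by apply/(integrable_mkcondR mu _ (measurable_itv _)); exact: integrable_cst_itvoc.
Qed.

Lemma Rintegral_indic_itvoc (a b : R) : a <= b -> \int[mu]_x (\1_`]a, b] x : R) = b - a.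
Proof.
move=> ab; have := Rintegral_cst_itvoc 1 ab; rewrite mul1r => <-.
rewrite [RHS]Rintegral_mkcond; congr (Rintegral mu _ _).
by apply/funext => x; rewrite patchE indicE; case: ifP.
Qed.

(** Two values of the absolutely continuous representative differ by at most the integral of |g|;
    integrating over the second point gives the claim. Means stay multiplied by the length, which
    avoids divisions. *)
Lemma oscillation (a b r c : R) (f g : R -> R) : - r <= a -> a <= b -> b <= r ->
  mu.-integrable `[- r, r] (EFin \o g) -> measurable_fun (`]a, b] : set R) f ->
  {ae mu, forall x, `[- r, r]%classic x -> f x = c + \int[mu]_(t in `[- r, x]) g t} ->
  {ae mu, forall x, `]a, b]%classic x ->
    `|(b - a) * f x - \int[mu]_(t in `]a, b]) f t| <= (b - a) * \int[mu]_(t in `]a, b]) `|g t|}.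
Proof.
move=> ra ab br gi mf fG.
pose G x := c + \int[mu]_(t in `[- r, x]) g t.
have rr : - r <= r by lra.
have sub : `]a, b] `<=` `[- r, r].
  by apply: subset_itv; rewrite bnd_simp.
have mG : measurable_fun (`]a, b] : set R) G.
  apply: measurable_funD => //; apply: (measurable_funS _ sub) => //.
  exact: measurable_indefinite.
have Gi : mu.-integrable `]a, b] (EFin \o G).
  apply: (@le_integrable _ _ _ mu (`]a, b] : set R) _ _ (EFin \o (fun=> `|c| + \int[mu]_(t in `[- r, r]) `|g t|))) => //.
  - exact/measurable_EFinP.
  - move=> x xab; rewrite /= lee_fin; apply: le_trans (ler_normD _ _) _.
    rewrite [leRHS]ger0_norm; last first.
      by rewrite addr_ge0//; apply: Rintegral_ge0 => t _; exact: normr_ge0.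
    rewrite lerD2l; apply: (indefinite_bounded gi).
    by move: xab; rewrite /= in_itv/= => /andP[_]; lra.
  - exact: integrable_cst_itvoc.
have fE : \int[mu]_(t in `]a, b]) f t = \int[mu]_(t in `]a, b]) G t.
  by apply: ae_eq_Rintegral => //; apply: aeS fG => x h /sub; exact: h.
have giab : mu.-integrable `]a, b] (EFin \o g) by apply: integrableS gi.
have step x t : a < t <= b -> a < x <= b -> t <= x -> `|G x - G t| <= \int[mu]_(s in `]a, b]) `|g s|.
  move=> tab xab tx.
  have gix : mu.-integrable `[- r, x] (EFin \o g).
    by apply: integrableS gi => //; apply: subset_itvl; rewrite bnd_simp; lra.
  rewrite /G opprD addrACA subrr add0r Rintegral_itvB//; [|by rewrite bnd_simp; lra].
  have sx : `]t, x] `<=` `]a, b] by apply: subset_itv; rewrite bnd_simp; lra.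
  have gtx : mu.-integrable `]t, x] (EFin \o g) by apply: integrableS giab.
  apply: (le_trans (le_normr_Rintegral _ gtx)) => //.
  exact: (@Rintegral_norm_subset _ _ mu _ _ g (measurable_itv _) (measurable_itv _) sx giab).
apply: aeS fG => x fx xab.
rewrite fE (fx (sub _ xab)) -/(G x).
have Gxi := integrable_cst_itvoc a b (G x).
rewrite mulrC -(Rintegral_cst_itvoc (G x) ab) -RintegralB//.
apply: le_trans (le_normr_Rintegral _ _) _ => //; first exact: (integrable_RB _ Gxi Gi).
rewrite [leRHS]mulrC -(Rintegral_cst_itvoc _ ab); apply: le_Rintegral => //.
- by apply: (integrable_norm (integrable_RB _ Gxi Gi)).
- exact: integrable_cst_itvoc.
move=> t /=; move: xab; rewrite /= !in_itv/= => xab tab.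
have [tx|/ltW xt] := leP t x; first exact: step.
by rewrite distrC; exact: step.
Qed.

Lemma ptK i (x y : R) : pt i (pt i x y).1 (pt i x y).2 = (x, y).
Proof. by rewrite /pt; case: (i == ord0). Qed.

(** The oscillation bound does not depend on x, so integrating it over ]a, b] contributes the second
    factor b - a; a further integration over the lines gives the plane integrals. *)
Lemma slab i (w G : R * R -> R) (a b : R) : a < b ->
  m2.-integrable setT (EFin \o w) -> m2.-integrable setT (EFin \o G) ->
  (forall x y, ~ `]a, b]%classic x -> w (pt i x y) = 0) ->
  {ae mu, forall y, {ae mu, forall x, `]a, b]%classic x ->
    `|(b - a) * w (pt i x y) - \int[mu]_t w (pt i t y)| <= (b - a) * \int[mu]_t `|G (pt i t y)| }} ->
  let F := fun p => (b - a) * w p -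
    \1_`]a, b] (pt i p.1 p.2).1 * \int[mu]_t w (pt i t (pt i p.1 p.2).2) in
  m2.-integrable setT (EFin \o F) /\
  \int[m2]_p `|F p| <= (b - a) ^+ 2 * \int[m2]_p `|G p|.
Proof.
move=> ab wi Gi w0 osc F.
have Ii := integrable_indic_itvoc a b.
have Wi := integrable_Rfubini i wi.
have Fi : m2.-integrable setT (EFin \o F).
  apply: integrable_RB => //; first exact: integrable_RZ.
  exact: (integrable_turn i (integrable_tensor Ii Wi)).
have aGi : m2.-integrable setT (EFin \o (fun p => `|G p|)) by exact: (integrable_norm Gi).
have Ki := integrable_Rfubini i aGi.
have aFi : m2.-integrable setT (EFin \o (fun p => `|F p|)) by exact: (integrable_norm Fi).
split => //; rewrite (Rfubini_pt i aFi) (Rfubini_pt i aGi).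
have Ki2 := @integrable_RZ _ _ _ mu setT _ ((b - a) ^+ 2) measurableT Ki.
rewrite -(RintegralZl _ measurableT Ki).
apply: ae_le_Rintegral => //; first exact: (integrable_Rfubini i aFi).
apply: aeS (aeI osc (ae_integrable_pt i aFi)) => y [hy Fyi] _ /=.
have -> : (b - a) ^+ 2 * (\int[mu]_x `|G (pt i x y)|) = \int[mu]_x (((b - a) * \int[mu]_x `|G (pt i x y)|) * \1_`]a, b] x).
  by rewrite RintegralZl// Rintegral_indic_itvoc ?ltW//; ring.
apply: ae_le_Rintegral => //; first exact: integrable_RZ.
apply: aeS hy => x hx _; rewrite /F ptK/= indicE.
case: (boolP (x \in (`]a, b]%classic : set R))) => [/set_mem xab|].
  by rewrite mul1r mulr1; exact: hx.
by rewrite notin_setE => nx; rewrite w0// mulr0 !mul0r mulr0 subrr normr0.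
Qed.

(** The half-open sides make a bisection a disjoint union. The first interval always refers to axis
    i, hence the exchange of arguments in [boxC]. *)
Definition box i (a b c d : R) : set (R * R) :=
  [set p | (`]a, b] `*` `]c, d])%classic (pt i p.1 p.2)].

Lemma box_pt i (a b c d x y : R) : box i a b c d (pt i x y) <-> `]a, b]%classic x /\ `]c, d]%classic y.
Proof. by rewrite /box /= ptK. Qed.

Lemma boxC (a b c d : R) : box 1 c d a b = box 0 a b c d.
Proof. by apply/seteqP; split => p [/= h1 h2]; split. Qed.

Lemma measurable_box i a b c d : measurable (box i a b c d : set plane).
Proof.
rewrite -[X in measurable X]setTI; apply: measurable_pt => //.
by apply: measurableX; exact: measurable_itv.
Qed.

Lemma slab_box i f g (a b c d r : R) : sqint f -> sqint g -> ACL i f g ->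
  - r <= a -> a < b -> b <= r -> (forall y, `]c, d]%classic y -> chord y r) ->
  box i a b c d `<=` D ->
  let w := f \_ (box i a b c d) in
  let F := fun p => (b - a) * w p -
    \1_`]a, b] (pt i p.1 p.2).1 * \int[mu]_t w (pt i t (pt i p.1 p.2).2) in
  m2.-integrable setT (EFin \o F) /\
  \int[m2]_p `|F p| <= (b - a) ^+ 2 * \int[m2]_(p in box i a b c d) `|g p|.
Proof.
move=> sf sg fg ra ab br chrd QD w F.
have mQ := measurable_box i a b c d.
have ii h : sqint h -> m2.-integrable setT (EFin \o (h \_ (box i a b c d))).
  move=> sh; apply/(integrable_mkcondR _ _ mQ).
  exact: (integrableS mD mQ QD (sqint_integrable sh)).
have := @slab i w (g \_ (box i a b c d)) a b ab (ii _ sf) (ii _ sg).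
have -> : \int[m2]_p `|(g \_ (box i a b c d)) p| = \int[m2]_(p in box i a b c d) `|g p|.
  rewrite [RHS]Rintegral_mkcond; apply: eq_Rintegral => p _; rewrite !patchE.
  by case: ifP => //; rewrite normr0.
apply.
  by move=> x y nx; rewrite /w patchE; case: ifPn => // /set_mem/box_pt[/nx].
have patchx (h : R * R -> R) y x : `]c, d]%classic y -> (h \_ (box i a b c d)) (pt i x y) = ((fun x => h (pt i x y)) \_ (`]a, b] : set R)) x.
  move=> ycd; rewrite !patchE.
  suff -> : (pt i x y \in box i a b c d) = (x \in (`]a, b]%classic : set R)) by [].
  by apply/idP/idP => /set_mem h1; apply/mem_set; [case/box_pt : h1|apply/box_pt].
apply: aeS (aeI fg (ae_chord_integrable i (sqint_integrable sg))) => y [hy gy].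
have [ycd|ycd] := pselect (`]c, d]%classic y); last first.
  have w0 x : w (pt i x y) = 0.
    by rewrite /w patchE; case: ifPn => // /set_mem/box_pt[_].
  apply: aeW => x _; rewrite w0 mulr0 (@eq_Rintegral _ _ _ mu setT (cst 0)); last by move=> t _; exact: w0.
  rewrite Rintegral_cst// mul0r subrr normr0 mulr_ge0//; first by rewrite subr_ge0 ltW.
  by apply: Rintegral_ge0 => t _; exact: normr_ge0.
have cy := chrd _ ycd.
have [k hk] := hy _ cy.
have mf : measurable_fun (`]a, b] : set R) (fun x => f (pt i x y)).
  apply: (@measurable_funS _ _ _ _ (`[- r, r] : set R)) => //.
    by apply: subset_itv; rewrite bnd_simp.
  by apply: measurable_chord => //; case: sf.
apply: aeS (oscillation ra (ltW ab) br (gy _ cy) mf hk) => x hx xab.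
have := hx xab; rewrite [\int[mu]_(t in _) f _]Rintegral_mkcond [\int[mu]_(t in _) `|_|]Rintegral_mkcond.
rewrite /w (patchx f)// patchE mem_set//.
under eq_Rintegral do rewrite -(patchx f)//.
move=> /le_trans; apply; rewrite ler_wpM2l ?subr_ge0 ?(ltW ab)//.
rewrite le_eqVlt; apply/orP; left; apply/eqP/eq_Rintegral => t _; rewrite (patchx g)// !patchE.
by case: ifP => //; rewrite normr0.
Qed.

(* Averages are compared first along one axis and then along the other, which
   avoids integrating over pairs of points of the plane. *)
Lemma poincare f g1 g2 (a b c d r s : R) : sqint f -> sqint g1 -> sqint g2 ->
  ACL 0 f g1 -> ACL 1 f g2 ->
  0 < r -> 0 < s -> r ^+ 2 + s ^+ 2 < 1 ->
  - r <= a -> a < b -> b <= r -> - s <= c -> c < d -> d <= s ->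
  \int[m2]_(p in box 0 a b c d) `|f p| <= `|\int[m2]_(p in box 0 a b c d) f p| +
    ((b - a) * \int[m2]_(p in box 0 a b c d) `|g1 p| + (d - c) * \int[m2]_(p in box 0 a b c d) `|g2 p|).
Proof.
move=> sf sg1 sg2 A1 A2 r0 s0 rs ra ab br sc cd ds.
set Q := box 0 a b c d.
have mQ : measurable (Q : set plane) := measurable_box 0 a b c d.
have sqle (x t : R) : - t <= x -> x <= t -> x ^+ 2 <= t ^+ 2.
  by move=> h1 h2; rewrite -subr_ge0 subr_sqr mulr_ge0//; lra.
have QD : Q `<=` D.
  move=> p [/=]; rewrite !in_itv/= => p1 p2; rewrite /disc /=; apply: le_lt_trans rs.
  by apply: lerD; apply: sqle; lra.
have ch1 y : `]c, d]%classic y -> chord y r.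
  rewrite /= in_itv/= => yc; split => //; apply: le_lt_trans rs.
  by rewrite lerD2l; apply: sqle; lra.
have ch2 x : `]a, b]%classic x -> chord x s.
  rewrite /= in_itv/= => yc; split => //; rewrite addrC; apply: le_lt_trans rs.
  by rewrite lerD2r; apply: sqle; lra.
have [] := slab_box sf sg1 A1 ra ab br ch1 QD.
have := slab_box sf sg2 A2 sc cd ds ch2; rewrite boxC -/Q => /(_ QD)[].
set w := f \_ Q; set F1 := (X in EFin \o X); move=> iF1 bF1; set F0 := (X in EFin \o X); move=> iF0 bF0.
have wi : m2.-integrable setT (EFin \o w).
  by apply/(integrable_mkcondR _ _ mQ); exact: (integrableS mD mQ QD (sqint_integrable sf)).
pose M := \int[m2]_p w p.
have ba : 0 < b - a by rewrite subr_gt0.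
have dc : 0 < d - c by rewrite subr_gt0.
(* F1 is the error of averaging along the second axis. Its integral over x compares the average W
   along the first axis with the total integral M, and H dominates this difference on the box. *)
pose H p : R := \1_`]a, b] p.1 * \int[mu]_x `|F1 (x, p.2)|.
have Ii := integrable_indic_itvoc.
have I1 a' b' (ab' : a' < b') := Rintegral_indic_itvoc (ltW ab').
have aF1 : m2.-integrable setT (EFin \o (fun p => `|F1 p|)) by exact: (integrable_norm iF1).
have aF0 : m2.-integrable setT (EFin \o (fun p => `|F0 p|)) by exact: (integrable_norm iF0).
have Ki := integrable_Rfubini ord0 aF1.
have Hi : m2.-integrable setT (EFin \o H) by exact: (integrable_tensor (Ii a b) Ki).
have Hint : \int[m2]_p H p = (b - a) * \int[m2]_p `|F1 p|.
  rewrite (Rfubini_pt ord0 Hi) (Rfubini_pt ord0 aF1) -RintegralZl//.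
  by apply: eq_Rintegral => y _; rewrite /H /pt/= RintegralZr ?I1//; exact: Ii.
pose B p : R := \1_`]a, b] p.1 * (`|M| * \1_`]c, d] p.2).
have Bi : m2.-integrable setT (EFin \o B).
  have Ic := @integrable_RZ _ _ _ mu setT _ `|M| measurableT (Ii c d).
  exact: (integrable_tensor (Ii a b) Ic).
have Bint : \int[m2]_p B p = (b - a) * ((d - c) * `|M|).
  rewrite (Rfubini_pt ord0 Bi) /B /pt/=.
  under eq_Rintegral do rewrite RintegralZr// I1//.
  by rewrite RintegralZl ?RintegralZl ?I1//; [rewrite (mulrC `|M|)|exact: integrable_RZ].
have awi : m2.-integrable setT (EFin \o (fun p => `|w p|)) by exact: (integrable_norm wi).
have aw : \int[m2]_(p in Q) `|f p| = \int[m2]_p `|w p|.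
  rewrite [LHS]Rintegral_mkcond; apply: eq_Rintegral => p _; rewrite /w !patchE.
  by case: ifP => //; rewrite normr0.
have key : \int[m2]_p ((b - a) * (d - c) * `|w p|) <= \int[m2]_p ((d - c) * `|F0 p| + H p + B p).
  have iR : m2.-integrable setT (EFin \o (fun p => (d - c) * `|F0 p| + H p + B p)).
    by apply: integrable_RD => //; apply: integrable_RD => //; exact: integrable_RZ.
  have iL : m2.-integrable setT (EFin \o (fun p => (b - a) * (d - c) * `|w p|)) by exact: integrable_RZ.
  rewrite (Rfubini_pt ord0 iR) (Rfubini_pt ord0 iL).
  apply: ae_le_Rintegral; [by []|exact: (integrable_Rfubini ord0 iL)|exact: (integrable_Rfubini ord0 iR)|].
  have ai1 := aeI (ae_integrable_pt ord0 iR) (ae_integrable_pt ord0 iL).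
  have ai2 := aeI (ae_integrable_pt ord0 iF1) (ae_integrable_pt ord0 wi).
  apply: aeS (aeI ai1 ai2) => y [[yR yL] [yF1 yw]] _.
  apply: ae_le_Rintegral => //; apply: aeW => x _.
  rewrite /pt/=.
  set W := \int[mu]_t w (t, y).
  have F0E : F0 (x, y) = (b - a) * w (x, y) - \1_`]a, b] x * W by [].
  have F1E : \int[mu]_t F1 (t, y) = (d - c) * W - \1_`]c, d] y * M.
    have -> : (fun t => F1 (t, y)) = (fun t => (d - c) * w (t, y) - \1_`]c, d] y * \int[mu]_z w (t, z)) by [].
    have iV := integrable_Rfubini 1 wi.
    rewrite RintegralB//; last 2 first.
    - exact: integrable_RZ.
    - exact: integrable_RZ.
    rewrite RintegralZl// RintegralZl//; congr (_ - _ * _).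
    by rewrite /M (Rfubini_pt 1 wi).
  have F1n : `|(d - c) * W - \1_`]c, d] y * M| <= \int[mu]_t `|F1 (t, y)|.
    by rewrite -F1E; exact: le_normr_Rintegral.
  have I0 (z a' b' : R) : 0 <= \1_`]a', b'] z :> R by rewrite indicE.
  rewrite /H /B /=.
  have -> : (b - a) * (d - c) * `|w (x, y)| = `|(b - a) * (d - c) * w (x, y)|.
    by rewrite !normrM (gtr0_norm ba) (gtr0_norm dc).
  (* The value is compared with its average on the horizontal line, and that average with the mean
     over the box. *)
  have -> : (b - a) * (d - c) * w (x, y) = (d - c) * F0 (x, y) + \1_`]a, b] x * ((d - c) * W - \1_`]c, d] y * M) +
     \1_`]a, b] x * (M * \1_`]c, d] y) by rewrite F0E; ring.
  apply: le_trans (ler_normD _ _) _; apply: lerD; last by rewrite !normrM !(ger0_norm (I0 _ _ _)).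
  apply: le_trans (ler_normD _ _) _; apply: lerD; first by rewrite normrM (gtr0_norm dc).
  by rewrite normrM (ger0_norm (I0 _ _ _)) ler_wpM2l.
move: key; rewrite RintegralZl// RintegralD//; last first.
  by apply: integrable_RD => //; exact: integrable_RZ.
rewrite RintegralD//; last exact: integrable_RZ.
rewrite RintegralZl// Hint Bint -aw.
have -> : M = \int[m2]_(p in Q) f p by rewrite [RHS]Rintegral_mkcond.
set m := `|_|; set L := \int[m2]_(p in Q) _; set G1 := \int[m2]_(p in Q) _; set G2 := \int[m2]_(p in Q) _.
move=> key; rewrite -(ler_pM2l (mulr_gt0 ba dc)); apply: le_trans key _.
have : (d - c) * (\int[m2]_p `|F0 p|) <= (d - c) * ((b - a) ^+ 2 * G1) by rewrite ler_pM2l.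
have : (b - a) * (\int[m2]_p `|F1 p|) <= (b - a) * ((d - c) ^+ 2 * G2) by rewrite ler_pM2l.
move=> h1 h2; rewrite -subr_ge0.
set x0 := \int[m2]_p _ in h2 *; set x1 := \int[m2]_p _ in h1 *.
have -> : (b - a) * (d - c) * (m + ((b - a) * G1 + (d - c) * G2)) - ((d - c) * x0 + (b - a) * x1 + (b - a) * ((d - c) * m)) =
  ((d - c) * ((b - a) ^+ 2 * G1) - (d - c) * x0) + ((b - a) * ((d - c) ^+ 2 * G2) - (b - a) * x1) by ring.
by rewrite addr_ge0// subr_ge0.
Qed.
End Poincare.

(** By compactness the image of the ultrafilter clusters at some p, and for an ultrafilter
    clustering is convergence: the set A or its complement belongs to U, and the complement stays
    away from p. *)
Lemma ultra_bounded_cauchy (R : realType) (U : set_system nat) (UU : UltraFilter U) (m_ : nat -> R) (M e : R) :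
  (forall k, `|m_ k| <= M) -> 0 < e ->
  exists2 A, U A & forall k l, A k -> A l -> `|m_ k - m_ l| <= e.
Proof.
move=> mM e0.
have [] := @segment_compact R (- M) M (m_ @ U) _.
  by apply: (@filterS _ U _ setT) => [k _|]; last exact: filterT; rewrite /= in_itv/= -ler_norml.
move=> p [_ clp]; pose A := [set k | `|m_ k - p| < e / 2]; exists A.
  have [//|nA] := in_ultra_setVsetC A UU; exfalso.
  have h1 : (m_ @ U) (m_ @` (~` A)) by apply: (@filterS _ U _ _ _ _ nA) => k nk; exists k.
  have h2 : nbhs p (ball p (e / 2)) by apply: nbhsx_ballx; rewrite divr_gt0.
  have [x [[k nk <-]]] := clp _ _ h1 h2.
  by rewrite /ball/= distrC.
move=> k l; rewrite /A/= => hk hl.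
have -> : m_ k - m_ l = (m_ k - p) - (m_ l - p) by ring.
by apply: le_trans (ler_normB _ _) _; lra.
Qed.

(** * Local compactness by bisection *)

Section Rellich.
Variable R : realType.
Local Notation mu := (@lebesgue_measure R).
Local Notation D := (@disc R).
Local Notation plane := (measurableTypeR R * measurableTypeR R)%type.
Local Notation m2 := (leb2 R).
Implicit Types (f g : R * R -> R) (i : 'I_2).
Let mD : measurable (D : set plane) := @measurable_disc R.

Lemma Rintegral_box_split i f (a m b c d : R) : a <= m -> m <= b ->
  m2.-integrable (box i a b c d) (EFin \o f) ->
  \int[m2]_(p in box i a b c d) f p = \int[m2]_(p in box i a m c d) f p + \int[m2]_(p in box i m b c d) f p.
Proof.
move=> am mb fi.
have E : box i a b c d = box i a m c d `|` box i m b c d.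
  apply/seteqP; split => p; rewrite /box /= !in_itv/=.
    move=> [/andP[h1 h2] h3]; have [h4|h4] := leP (pt i p.1 p.2).1 m; [left|right];
      by split => //; apply/andP; split.
  by move=> [] [/andP[h1 h2] h3]; split => //; apply/andP; split; lra.
rewrite E Rintegral_setU//; [exact: measurable_box|exact: measurable_box|by rewrite -E|].
rewrite disj_set2E; apply/eqP/seteqP; split => // p; rewrite /box /= !in_itv/=.
by move=> [[/andP[_ h1] _] [/andP[h2 _] _]]; lra.
Qed.

Lemma is_weak_pdB i f g f' g' : sqint f -> sqint g -> is_weak_pd i f f' -> is_weak_pd i g g' ->
  is_weak_pd i (fun p => f p - g p) (fun p => f' p - g' p).
Proof.
move=> sf sg wf wg; have := is_weak_pdD sf (sqintZ (-1) sg) wf (is_weak_pdZ (-1) sg wg).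
rewrite (_ : (fun p => f p + -1 * g p) = (fun p => f p - g p)); last by apply/funext => p; rewrite mulN1r.
by rewrite (_ : (fun p => f' p + -1 * g' p) = (fun p => f' p - g' p))//; apply/funext => p; rewrite mulN1r.
Qed.

Lemma box_disc (r s a b c d : R) : 0 < r -> 0 < s -> r ^+ 2 + s ^+ 2 < 1 ->
  - r <= a -> b <= r -> - s <= c -> d <= s -> box 0 a b c d `<=` D.
Proof.
move=> r0 s0 rs ra br sc ds.
have sqle (x t : R) : - t <= x -> x <= t -> x ^+ 2 <= t ^+ 2.
  by move=> h1 h2; rewrite -subr_ge0 subr_sqr mulr_ge0//; lra.
move=> p [/=]; rewrite !in_itv/= => p1 p2; rewrite /disc /=; apply: le_lt_trans rs.
by apply: lerD; apply: sqle; lra.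
Qed.

Section Sequence.
Variables (U : set_system nat) (UU : UltraFilter U).
Variables (u_ : nat -> R * R -> R) (g_ : nat -> 'I_2 -> R * R -> R) (C : R).
Hypothesis mu_ : forall k, measurable_fun (D : set plane) (u_ k).
Hypothesis u1 : forall k, {ae m2, forall p, D p -> `|u_ k p| <= 1}.
Hypothesis ug : forall k i, is_weak_pd i (u_ k) (g_ k i).
Hypothesis gC : forall k i, \int[m2]_(p in D) `|g_ k i p| <= C.
Variables (r s : R).
Hypotheses (r0 : 0 < r) (s0 : 0 < s) (rs : r ^+ 2 + s ^+ 2 < 1).

Let su k : sqint (u_ k) := sqint_bounded (mu_ k) (u1 k).
Let sg k i : sqint (g_ k i).
Proof. by case: (ug k i) => /Lp_disc2P. Qed.

(* The means over a box converge along the ultrafilter, and every bisection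
   shrinks the error term of the Poincare inequality. *)
Lemma rellich_bisect n (a b c d e : R) : - r <= a -> a < b -> b <= r -> - s <= c -> c < d -> d <= s -> 0 < e ->
  exists2 A, U A & forall k l, A k -> A l ->
    \int[m2]_(p in box 0 a b c d) `|u_ k p - u_ l p| <= e +
      2^-1 ^+ n * ((b - a) * \int[m2]_(p in box 0 a b c d) `|g_ k 0 p - g_ l 0 p| +
                   (d - c) * \int[m2]_(p in box 0 a b c d) `|g_ k 1 p - g_ l 1 p|).
Proof.
elim: n a b c d e => [|n IH] a b c d e ra ab br sc cd ds e0.
  have QD := box_disc r0 s0 rs ra br sc ds.
  have mQ := measurable_box 0 a b c d.
  pose vol := \int[m2]_(p in D) (1 : R).
  have iQ k : m2.-integrable (box 0 a b c d) (EFin \o u_ k).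
    exact: (integrableS mD mQ QD (sqint_integrable (su k))).
  have [|A UA hA] := @ultra_bounded_cauchy R U UU (fun k => \int[m2]_(p in box 0 a b c d) u_ k p) vol e _ e0.
    move=> k; apply: le_trans (le_normr_Rintegral mQ (iQ k)) _.
    apply: le_trans (Rintegral_norm_subset mQ mD QD (sqint_integrable (su k))) _.
    apply: ae_le_Rintegral => //; first exact: (integrable_norm (sqint_integrable (su k))).
    exact: integrable_cst_disc.
  exists A => // k l Ak Al.
  have A1 i : ACL i (fun p => u_ k p - u_ l p) (fun p => g_ k i p - g_ l i p).
    by apply: weak_ACL; [exact: sqintB|exact: is_weak_pdB].
  have sB i : sqint (fun p => g_ k i p - g_ l i p) by exact: sqintB.
  have := poincare (sqintB (su k) (su l)) (sB 0) (sB 1) (A1 0) (A1 1) r0 s0 rs ra ab br sc cd ds.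
  move=> /le_trans; apply; rewrite expr0 mul1r lerD2r RintegralB//.
  exact: hA.
pose x := (a + b) / 2; pose y := (c + d) / 2.
(* Each quarter receives the share e / 4. Its sides are half as long, which turns the factor 2^-n of
   the induction hypothesis into 2^-(n+1). *)
have e40 : 0 < e / 4 by lra.
have ax : a < x by rewrite /x; lra.
have xb : x < b by rewrite /x; lra.
have cy : c < y by rewrite /y; lra.
have yd : y < d by rewrite /y; lra.
have xr : x <= r by lra.
have rx : - r <= x by lra.
have ys : y <= s by lra.
have sy : - s <= y by lra.
have [A1 U1 h1] := IH a x c y (e / 4) ra ax xr sc cy ys e40.
have [A2 U2 h2] := IH x b c y (e / 4) rx xb br sc cy ys e40.
have [A3 U3 h3] := IH a x y d (e / 4) ra ax xr sy yd ds e40.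
have [A4 U4 h4] := IH x b y d (e / 4) rx xb br sy yd ds e40.
exists (A1 `&` A2 `&` (A3 `&` A4)); first by apply: filterI; exact: filterI.
move=> k l [[k1 k2] [k3 k4]] [[l1 l2] [l3 l4]].
have split4 f : sqint f -> \int[m2]_(p in box 0 a b c d) `|f p| =
   (\int[m2]_(p in box 0 a x c y) `|f p| + \int[m2]_(p in box 0 x b c y) `|f p|) +
   (\int[m2]_(p in box 0 a x y d) `|f p| + \int[m2]_(p in box 0 x b y d) `|f p|).
  move=> sf.
  have fi a' b' c' d' : - r <= a' -> b' <= r -> - s <= c' -> d' <= s ->
     m2.-integrable (box 0 a' b' c' d') (EFin \o (fun p => `|f p|)).
    move=> h5 h6 h7 h8; apply: (integrableS mD (measurable_box _ _ _ _ _) (box_disc r0 s0 rs h5 h6 h7 h8)).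
    exact: (integrable_norm (sqint_integrable sf)).
  rewrite -boxC (Rintegral_box_split (ltW cy) (ltW yd)) ?boxC; last exact: fi.
  by congr (_ + _); rewrite (Rintegral_box_split (ltW ax) (ltW xb))//; apply: fi.
have sB i : sqint (fun p => g_ k i p - g_ l i p) by exact: sqintB.
rewrite (split4 _ (sqintB (su k) (su l))) (split4 _ (sB 0)) (split4 _ (sB 1)).
have {}h1 := h1 k l k1 l1; have {}h2 := h2 k l k2 l2.
have {}h3 := h3 k l k3 l3; have {}h4 := h4 k l k4 l4.
have -> : b - a = 2 * (x - a) by rewrite /x; field.
have -> : d - c = 2 * (y - c) by rewrite /y; field.
have E1 : b - x = x - a by rewrite /x; field.
have E2 : d - y = y - c by rewrite /y; field.
rewrite E1 in h2 h4; rewrite E2 in h3 h4.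
apply: le_trans (lerD (lerD h1 h2) (lerD h3 h4)) _; rewrite exprS le_eqVlt; apply/orP; left; apply/eqP.
by field.
Qed.

Lemma rellich_box (e : R) : 0 < e -> exists2 A, U A & forall k l, A k -> A l ->
  \int[m2]_(p in box 0 (- r) r (- s) s) `|u_ k p - u_ l p| <= e.
Proof.
move=> e0; have C0 : 0 <= C.
  by apply: le_trans (gC 0 0); apply: Rintegral_ge0 => p _; exact: normr_ge0.
(* The rectangle has sides shorter than 2 and the difference of two gradients has norm at most 2 C
   in each direction, which adds up to 8 C. In K the summand 1 keeps the divisor positive when C =
   0. *)
have [n hn] : exists n, 2^-1 ^+ n * (8 * C) <= e / 2.
  pose K := 8 * C + 1; have K0 : 0 < K by rewrite /K; lra.
  have : (fun n => (2^-1 : R) ^+ n) @ \oo --> (0 : R).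
    by apply: cvg_expr; rewrite ger0_norm// invf_lt1//; lra.
  move=> /cvgrPdist_lt/(_ (e / 2 / K)); rewrite divr_gt0 ?divr_gt0// => /(_ isT)[N _ /(_ N (leqnn _))].
  rewrite sub0r normrN ger0_norm ?exprn_ge0// ltr_pdivlMr// => h; exists N.
  apply: le_trans (ltW h); rewrite ler_wpM2l ?exprn_ge0// /K; lra.
have e20 : 0 < e / 2 by lra.
have rr : - r < r by move: r0; lra.
have ss : - s < s by move: s0; lra.
have [A UA hA] := @rellich_bisect n (- r) r (- s) s (e / 2) (lexx _) rr (lexx _) (lexx _) ss (lexx _) e20.
exists A => // k l Ak Al; apply: le_trans (hA k l Ak Al) _.
have r1 : r < 1 by move: r0 rs; have := sqr_ge0 s; nra.
have s1 : s < 1 by move: s0 rs; have := sqr_ge0 r; nra.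
have QD := box_disc r0 s0 rs (lexx _) (lexx _) (lexx _) (lexx _).
have gB i : \int[m2]_(p in box 0 (- r) r (- s) s) `|g_ k i p - g_ l i p| <= 2 * C.
  have sB := sqintB (sg k i) (sg l i).
  apply: le_trans (Rintegral_norm_subset (measurable_box _ _ _ _ _) mD QD (sqint_integrable sB)) _.
  apply: (@le_trans _ _ (\int[m2]_(p in D) (`|g_ k i p| + `|g_ l i p|))).
    apply: le_Rintegral => //.
    - exact: (integrable_norm (sqint_integrable sB)).
    - by apply: integrable_RD => //; exact: (integrable_norm (sqint_integrable (sg _ i))).
    by move=> p _; exact: ler_normB.
  rewrite RintegralD//; [|exact: (integrable_norm (sqint_integrable (sg _ i)))..].
  by have := gC k i; have := gC l i; lra.
have g0 i : 0 <= \int[m2]_(p in box 0 (- r) r (- s) s) `|g_ k i p - g_ l i p|.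
  by apply: Rintegral_ge0 => p _; exact: normr_ge0.
have := gB 0; have := gB 1; have := g0 0; have := g0 1.
set x := \int[m2]_(p in _) _; set y := \int[m2]_(p in _) _ => x0 y0 x1 y1.
rewrite [leRHS](_ : e = e / 2 + e / 2); last by field.
rewrite lerD2l; apply: le_trans hn; rewrite ler_wpM2l ?exprn_ge0//.
nra.
Qed.
End Sequence.

(** One ultrafilter finer than [\oo] serves all components and all rational rectangles, in place of
    successive subsequences: finitely many of its sets always have a common element beyond n. The
    indices [k_ n] tend to infinity but need not increase. *)
Lemma rellich (I : finType) (u_ : nat -> I -> R * R -> R) (g_ : nat -> I -> 'I_2 -> R * R -> R) (C : R) :
  (forall k c, measurable_fun (D : set plane) (u_ k c)) ->
  (forall k c, {ae m2, forall p, D p -> `|u_ k c p| <= 1}) ->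
  (forall k c i, is_weak_pd i (u_ k c) (g_ k c i)) ->
  (forall k c i, \int[m2]_(p in D) `|g_ k c i p| <= C) ->
  exists (k_ : nat -> nat) (u : I -> R * R -> R), (forall n, (n <= k_ n)%N) /\
    forall c, measurable_fun (D : set plane) (u c) /\
      {ae m2, forall p, D p -> u_ (k_ n) c p @[n --> \oo] --> u c p}.
Proof.
move=> mu_ u1 ug gC.
have [U [UU oU]] := @ultraFilterLemma nat \oo _.
pose good (q : rat * rat) := [/\ 0 < ratr q.1 :> R, 0 < ratr q.2 :> R & (ratr q.1 : R) ^+ 2 + (ratr q.2 : R) ^+ 2 < 1].
pose Q (q : rat * rat) := box (0 : 'I_2) (- ratr q.1 : R) (ratr q.1) (- ratr q.2) (ratr q.2).
have QD q : good q -> Q q `<=` D by move=> [h1 h2 h3]; exact: (box_disc h1 h2 h3).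
have mQ q : measurable (Q q : set plane) by exact: measurable_box.
have stepA m : exists2 A, U A & forall k l, A k -> A l -> forall q : rat * rat, (pickle q < m)%N -> good q ->
    forall c, \int[m2]_(p in Q q) `|u_ k c p - u_ l c p| <= 2^-1 ^+ m.
  have /choice[A hA] : forall z : 'I_m * I, exists A, U A /\ forall k l, A k -> A l ->
     forall q : rat * rat, unpickle z.1 = Some q -> good q -> \int[m2]_(p in Q q) `|u_ k z.2 p - u_ l z.2 p| <= 2^-1 ^+ m.
    move=> [z c] /=; have [[q qz [q1 q2 q3]]|nq] := pselect (exists2 q : rat * rat, unpickle z = Some q & good q); last first.
      by exists setT; split; [exact: filterT|move=> k l _ _ q h1 h2; case: nq; exists q].
    have e0 : 0 < (2^-1 : R) ^+ m by rewrite exprn_gt0// invr_gt0.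
    have [A UA hA] := @rellich_box U UU (fun k => u_ k c) (fun k => g_ k c) C (mu_ ^~ c) (u1 ^~ c) (fun k => ug k c) (fun k => gC k c) _ _ q1 q2 q3 _ e0.
    by exists A; split => // k l Ak Al q'; rewrite qz => -[<-] _; exact: hA.
  exists (fun k => forall z, A z k); first by apply: filter_forall => z; case: (hA z).
  move=> k l Ak Al q qm gq c.
  by case: (hA (Ordinal qm, c)) => _ /(_ _ _ (Ak _) (Al _) q); apply => //=; rewrite pickleK.
have /choice[A hA] : forall m, exists A : set nat, U A /\ forall k l, A k -> A l -> forall q : rat * rat, (pickle q < m)%N -> good q ->
    forall c, \int[m2]_(p in Q q) `|u_ k c p - u_ l c p| <= 2^-1 ^+ m.
  by move=> m; have [A UA hA] := stepA m; exists A.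
(* Meeting all sets with index up to n puts k_n and k_(n+1) into the same set A n, which bounds
   their difference by 2^-n on the first n rectangles. *)
have /choice[k_ hk] : forall n, exists k, (n <= k)%N /\ forall j : 'I_n.+1, A j k.
  move=> n; apply: (@filter_ex _ U); apply: filterI.
    by apply: oU; exists n.
  by apply: filter_forall => j; case: (hA j).
have kA n : A n (k_ n) by have [_ /(_ ord_max)] := hk n.
have kA1 n : A n (k_ n.+1) by have [_ /(_ (inord n))] := hk n.+1; rewrite inordK.
have su k c : sqint (u_ k c) by exact: sqint_bounded (mu_ k c) (u1 k c).
pose vol := \int[m2]_(p in D) (1 : R).
have vol0 : 0 <= vol by apply: Rintegral_ge0.
have aeQ c q : good q -> {ae m2, forall p, Q q p -> cvgn (fun n => u_ (k_ n) c p)}.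
  move=> gq; have iB n : m2.-integrable (Q q) (EFin \o (fun p => u_ (k_ n.+1) c p - u_ (k_ n) c p)).
    exact: (integrableS mD (mQ q) (QD q gq) (sqint_integrable (sqintB (su _ c) (su _ c)))).
  (* The increments with n <= pickle q are not controlled by A n; they are at most 2 vol since |u|
     <= 1, and the factor 2^(pickle q) pays for the missing 2^-n. *)
  apply: (@ae_cvg_summable _ _ _ m2 (Q q) (mQ q) (fun n => u_ (k_ n) c) (1 + 2 * vol * 2 ^+ (pickle q))) => //.
    by move=> n; apply: (measurable_funS mD (QD q gq)).
  move=> n; have z0 : 0 < (2^-1 : R) ^+ n by rewrite exprn_gt0// invr_gt0.
  have [qn|nq] := ltnP (pickle q) n.
    have [_ /(_ _ _ (kA1 n) (kA n) q qn gq c)] := hA n; move=> /le_trans; apply.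
    by rewrite ler_peMl ?(ltW z0)// lerDl !mulr_ge0// exprn_ge0.
  have sB := sqintB (su (k_ n.+1) c) (su (k_ n) c).
  apply: le_trans (Rintegral_norm_subset (mQ q) mD (QD q gq) (sqint_integrable sB)) _.
  apply: (@le_trans _ _ (2 * vol)).
    rewrite /vol -RintegralZl//; last exact: integrable_cst_disc.
    apply: ae_le_Rintegral => //; first exact: (integrable_norm (sqint_integrable sB)).
      exact: integrable_cst_disc.
    apply: aeS (aeI (u1 (k_ n.+1) c) (u1 (k_ n) c)) => p [h1 h2] Dp.
    by apply: le_trans (ler_normB _ _) _; have := h1 Dp; have := h2 Dp; lra.
  have h : 1 <= 2 ^+ pickle q * (2^-1 : R) ^+ n.
    rewrite exprVn -(subnK nq) exprD mulrK ?unitfE ?expf_neq0//.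
    by rewrite exprn_ege1// ler1n.
  have E (x y z : R) : (1 + x * y) * z = z + x * (y * z) by ring.
  rewrite E; apply: ler_wpDl; first exact: ltW.
  by rewrite -[leLHS]mulr1 ler_wpM2l// mulr_ge0.
have aeD c : {ae m2, forall p, D p -> cvgn (fun n => u_ (k_ n) c p)}.
  have : {ae m2, forall p, forall q : rat * rat, good q -> Q q p -> cvgn (fun n => u_ (k_ n) c p)}.
    apply: ae_forall_count => q; have [gq|ngq] := pselect (good q); last by apply: aeW.
    by apply: aeS (aeQ c q gq) => p hp _.
  apply: aeS => p hp Dp.
  have [q gq Qp] : exists2 q, good q & Q q p.
    have [q [q1 q2 q3]] := disc_rat Dp; exists q.
      by split => //; [exact: le_lt_trans q1|exact: le_lt_trans q2].
    by split; rewrite /= in_itv/=; [move: q1|move: q2]; rewrite ltr_norml => /andP[-> /ltW ->].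
  exact: hp gq Qp.
exists k_.
have /choice[u hu] : forall c, exists u : R * R -> R, measurable_fun (D : set plane) u /\
   {ae m2, forall p, D p -> u_ (k_ n) c p @[n --> \oo] --> u p}.
  move=> c; have [u mu_c hu] := @ae_cvgn_limit _ _ _ m2 D (fun n => u_ (k_ n) c) (fun n => mu_ (k_ n) c) (aeD c).
  by exists u.
by exists u; split => // n; have [] := hk n.
Qed.
End Rellich.

(** * Lower semicontinuity of the energy *)

Section DirectMethod.
Variable R : realType.
Local Notation D := (@disc R).
Local Notation plane := (measurableTypeR R * measurableTypeR R)%type.
Local Notation m2 := (leb2 R).
Let mD : measurable (D : set plane) := @measurable_disc R.
Variable I : finType.
Implicit Types (g h : I -> 'I_2 -> R * R -> R) (u v w : I -> R * R -> R).

(** The gradient is an independent argument: weak derivatives are determined only up to null sets,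
    and the convexity argument works with gradients alone. *)
Definition energy g : R := \sum_(z : I * 'I_2) \int[m2]_(p in D) (g z.1 z.2 p ^+ 2).

Lemma energy_ge0 g : 0 <= energy g.
Proof. by apply: sumr_ge0 => z _; apply: Rintegral_ge0 => p _; exact: sqr_ge0. Qed.

Lemma parallelogram g h : (forall c i, sqint (g c i)) -> (forall c i, sqint (h c i)) ->
  energy (fun c i p => g c i p - h c i p) =
  2 * energy g + 2 * energy h - 4 * energy (fun c i p => 2^-1 * (g c i p + h c i p)).
Proof.
move=> sg sh; rewrite /energy !mulr_sumr -big_split -sumrB/=; apply: eq_bigr => -[c i] _ /=.
have s1 := sg c i; have s2 := sh c i.
have s3 := sqintZ 2^-1 (sqintD s1 s2).
have i1 := @integrable_RZ _ _ _ m2 D _ 2 mD s1.2.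
have i2 := @integrable_RZ _ _ _ m2 D _ 2 mD s2.2.
have i3 := @integrable_RZ _ _ _ m2 D _ 4 mD s3.2.
rewrite -(RintegralZl _ mD s1.2) -(RintegralZl _ mD s2.2) -(RintegralZl _ mD s3.2).
rewrite -(RintegralD mD i1 i2) -(RintegralB mD (integrable_RD mD i1 i2) i3).
by apply: eq_Rintegral => p _ /=; field.
Qed.

(** Gradients of functions bounded by 1 at L1 distance at most e from u. These sets are closed under
    midpoints and shrink with e. *)
Definition approx u (e : R) g := exists w : I -> R * R -> R, forall c,
  [/\ measurable_fun (D : set plane) (w c), {ae m2, forall p, D p -> `|w c p| <= 1},
      forall i, is_weak_pd i (w c) (g c i) & \int[m2]_(p in D) `|w c p - u c p| <= e].

Lemma approx_mid u e g h : (forall c, measurable_fun (D : set plane) (u c)) ->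
  (forall c, {ae m2, forall p, D p -> `|u c p| <= 1}) ->
  approx u e g -> approx u e h -> approx u e (fun c i p => 2^-1 * (g c i p + h c i p)).
Proof.
move=> mu_ u1 [v hv] [w hw]; exists (fun c p => 2^-1 * (v c p + w c p)) => c.
have [mv v1 vg ve] := hv c; have [mw w1 wh we] := hw c.
have sv := sqint_bounded mv v1; have sw := sqint_bounded mw w1; have su := sqint_bounded (mu_ c) (u1 c).
split.
- by apply: measurable_funM => //; exact: measurable_funD.
- apply: aeS (aeI v1 w1) => p [h1 h2] Dp; rewrite normrM ger0_norm ?invr_ge0//.
  by have := ler_normD (v c p) (w c p); have := h1 Dp; have := h2 Dp; lra.
- by move=> i; apply: is_weak_pdZ; [exact: sqintD|exact: is_weak_pdD].
have i1 := integrable_norm (sqint_integrable (sqintB sv su)).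
have i2 := integrable_norm (sqint_integrable (sqintB sw su)).
have i3 := @integrable_RZ _ _ _ m2 D _ 2^-1 mD i1.
have i4 := @integrable_RZ _ _ _ m2 D _ 2^-1 mD i2.
apply: (@le_trans _ _ (\int[m2]_(p in D) (2^-1 * `|v c p - u c p| + 2^-1 * `|w c p - u c p|))).
  apply: le_Rintegral => //.
  - exact: (integrable_norm (sqint_integrable (sqintB (sqintZ 2^-1 (sqintD sv sw)) su))).
  - exact: (integrable_RD mD i3 i4).
  move=> p _; have -> : 2^-1 * (v c p + w c p) - u c p = 2^-1 * (v c p - u c p) + 2^-1 * (w c p - u c p) by field.
  by apply: le_trans (ler_normD _ _) _; rewrite !normrM ger0_norm ?invr_ge0.
rewrite (RintegralD mD i3 i4) (RintegralZl _ mD i1) (RintegralZl _ mD i2).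
by move: ve we; rewrite /= -/(Rintegral _ _ _); lra.
Qed.

(** Both sides of the defining identity pass to the limit: the functions converge in L1 and the
    derivatives in L2, while phi and its derivative are bounded. *)
Lemma is_weak_pd_limit i (f G : R * R -> R) : measurable_fun (D : set plane) f -> {ae m2, forall p, D p -> `|f p| <= 1} ->
  sqint G -> (forall e : R, 0 < e -> exists f' G', [/\ sqint f', is_weak_pd i f' G',
     \int[m2]_(p in D) `|f' p - f p| <= e & \int[m2]_(p in D) (G p - G' p) ^+ 2 <= e ^+ 2]) ->
  is_weak_pd i f G.
Proof.
move=> mf f1 sG h; have sf := sqint_bounded mf f1.
split; first exact/Lp_disc2P.
move=> phi tphi; have [rho [C [_ [_ [c1 c2]] bphi _]]] := test_funP i tphi.
have mphi : measurable_fun (D : set plane) phi by apply: open_continuous_measurable_plane => //; exact: open_disc.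
have mphi' : measurable_fun (D : set plane) (pd i phi) by apply: open_continuous_measurable_plane => //; exact: open_disc.
have sphi : sqint phi by apply: (@sqint_bounded _ _ C) => //; apply: aeW => p Dp; exact: (bphi p Dp).1.
have sphi' : sqint (pd i phi) by apply: (@sqint_bounded _ _ C) => //; apply: aeW => p Dp; exact: (bphi p Dp).2.
have C0 : 0 <= C.
  have D0 : D (0, 0) by rewrite /disc/= expr0n/= addr0 ltr01.
  by apply: le_trans (bphi _ D0).1; exact: normr_ge0.
set x := \int[m2]_(p in D) _; set y := \int[m2]_(p in D) _.
pose vol := \int[m2]_(p in D) (1 : R).
have vol0 : 0 <= vol by apply: Rintegral_ge0.
have bound (a b : R * R -> R) : sqint a -> measurable_fun (D : set plane) b -> (forall p, D p -> `|b p| <= C) ->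
    `|\int[m2]_(p in D) (a p * b p)| <= C * \int[m2]_(p in D) `|a p|.
  move=> sa mb bC; have ai := sqint_integrable sa.
  have abi := integrable_bounded_mul mD ai mb bC.
  apply: le_trans (le_normr_Rintegral mD abi) _; rewrite -RintegralZl//; last exact: (integrable_norm ai).
  apply: le_Rintegral => //; first exact: (integrable_norm abi).
    by apply: integrable_RZ => //; exact: (integrable_norm ai).
  by move=> p Dp; rewrite normrM mulrC ler_wpM2r// bC.
have key e : 0 < e -> `|x + y| <= (C * (2 + vol)) * e.
  move=> e0; have [f' [g' [sf' wf' hf hg]]] := h e e0.
  have sg' : sqint g' by case: wf' => /Lp_disc2P.
  have [_ /(_ phi tphi) E] := wf'.
  have Ex : x = \int[m2]_(p in D) (f' p * pd i phi p) - \int[m2]_(p in D) ((f' p - f p) * pd i phi p).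
    rewrite -RintegralB//; [|exact: sqint_mul|by apply: sqint_mul => //; exact: sqintB].
    by apply: eq_Rintegral => p _; ring.
  have Ey : y = \int[m2]_(p in D) (g' p * phi p) + \int[m2]_(p in D) ((G p - g' p) * phi p).
    rewrite -RintegralD//; [|exact: sqint_mul|by apply: sqint_mul => //; exact: sqintB].
    by apply: eq_Rintegral => p _; ring.
  have -> : x + y = (- \int[m2]_(p in D) ((f' p - f p) * pd i phi p)) + \int[m2]_(p in D) ((G p - g' p) * phi p).
    by rewrite Ex Ey E; ring.
  apply: le_trans (ler_normD _ _) _; rewrite normrN.
  have b1 := bound _ _ (sqintB sf' sf) mphi' (fun p Dp => (bphi p Dp).2).
  have b2 := bound _ _ (sqintB sG sg') mphi (fun p Dp => (bphi p Dp).1).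
  have b3 : \int[m2]_(p in D) `|G p - g' p| <= (1 + vol) * e.
    have s1 := sqintB sG sg'; have i1 := @integrable_RZ _ _ _ m2 D _ e^-1 mD s1.2.
    have i2 := @integrable_cst_disc R e.
    apply: (@le_trans _ _ (\int[m2]_(p in D) (e^-1 * (G p - g' p) ^+ 2 + e))).
      apply: le_Rintegral => //; [exact: (integrable_norm (sqint_integrable s1))|exact: (integrable_RD mD i1 i2)|].
      move=> p _; set a := G p - g' p; rewrite -subr_ge0.
      have -> : e^-1 * a ^+ 2 + e - `|a| = e^-1 * ((`|a| - e / 2) ^+ 2 + 3 / 4 * e ^+ 2).
        by rewrite -(real_normK (num_real a)); field; rewrite gt_eqF.
      by rewrite mulr_ge0 ?invr_ge0 ?(ltW e0)// addr_ge0 ?sqr_ge0// mulr_ge0 ?sqr_ge0.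
    rewrite (RintegralD mD i1 i2) (RintegralZl _ mD s1.2) mulrDl mul1r lerD//.
      by rewrite mulrC ler_pdivrMr// -expr2.
    by rewrite Rintegral_cst// /vol Rintegral_cst// mul1r mulrC.
  have : C * (\int[m2]_(p in D) `|f' p - f p|) <= C * e by rewrite ler_wpM2l.
  have : C * (\int[m2]_(p in D) `|G p - g' p|) <= C * ((1 + vol) * e) by rewrite ler_wpM2l.
  move=> h1 h2; apply: le_trans (lerD b1 b2) _; apply: le_trans (lerD h2 h1) _.
  by rewrite le_eqVlt; apply/orP; left; apply/eqP; ring.
apply/eqP; rewrite -addr_eq0 -normr_le0; apply/ler_addgt0Pl => e e0; rewrite addr0.
have K0 : 0 < C * (2 + vol) + 1 by rewrite ltr_wpDl// mulr_ge0// addr_ge0.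
apply: le_trans (key (e / (C * (2 + vol) + 1)) (divr_gt0 e0 K0)) _.
rewrite mulrA ler_pdivrMr// [leRHS]mulrC ler_wpM2r ?(ltW e0)//.
by rewrite lerDl.
Qed.

(* The nested convex sets of approximate competitors and the parallelogram
   identity replace weak compactness in L2. *)
Lemma direct_method (u_ : nat -> I -> R * R -> R) (g_ : nat -> I -> 'I_2 -> R * R -> R) u (m : R) :
  (forall k c, measurable_fun (D : set plane) (u_ k c)) ->
  (forall k c, {ae m2, forall p, D p -> `|u_ k c p| <= 1}) ->
  (forall k c i, is_weak_pd i (u_ k c) (g_ k c i)) ->
  (forall c, measurable_fun (D : set plane) (u c)) ->
  (forall c, {ae m2, forall p, D p -> u_ n c p @[n --> \oo] --> u c p}) ->
  (forall e : R, 0 < e -> exists N, forall n, (N <= n)%N -> energy (g_ n) <= m + e) ->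
  exists G : I -> 'I_2 -> R * R -> R, (forall c i, is_weak_pd i (u c) (G c i)) /\ energy G <= m.
Proof.
move=> mu_ u1 ug mu uu gm.
have ub c : {ae m2, forall p, D p -> `|u c p| <= 1}.
  apply: aeS (aeI (uu c) (@ae_foralln _ _ _ m2 (fun n p => D p -> `|u_ n c p| <= 1) (u1 ^~ c))) => p [h1 h2] Dp.
  by apply: (cvgr_to_le (cvg_norm (h1 Dp))); apply: nearW => n; exact: h2.
have L1 c : \int[m2]_(p in D) `|u_ n c p - u c p| @[n --> \oo] --> (0 : R).
  have [] := @Rdominated_convergence _ _ _ m2 D (fun n => u_ n c) (u c) (fun=> 1) mD (mu_ ^~ c) (mu c) (uu c) (integrable_cst_disc _) _; last by [].
  apply: aeS (@ae_foralln _ _ _ m2 (fun n p => D p -> `|u_ n c p| <= 1) (u1 ^~ c)) => p h n Dp; exact: h.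
pose S j := [set energy g | g in approx u (j.+1%:R^-1 : R)].
pose mm j := inf (S j).
have S0 j : has_lbound (S j) by exists 0 => _ [g _ <-]; exact: energy_ge0.
have Sm j e : 0 < e -> exists2 g, approx u (j.+1%:R^-1) g & energy g <= m + e.
  move=> e0; have [N hN] := gm e e0.
  have : \forall n \near \oo, forall c, \int[m2]_(p in D) `|u_ n c p - u c p| <= j.+1%:R^-1.
    apply: filter_forall => c; have j0 : 0 < j.+1%:R^-1 :> R by rewrite invr_gt0.
    have /cvgrPdist_le/(_ _ j0) := L1 c; apply: filterS => n; rewrite sub0r normrN; apply: le_trans; exact: ler_norm.
  move=> [N' _ hN']; exists (g_ (maxn N N')); last by apply: hN; exact: leq_maxl.
  by exists (u_ (maxn N N')) => c; split => //; apply: hN'; exact: leq_maxr.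
(* The infima [mm j] increase with j, as the sets shrink, and stay below m; hence they converge. *)
have hS j : has_inf (S j).
  by split => //; have [g ag _] := Sm j 1 ltr01; exists (energy g), g.
have mmm j : mm j <= m.
  apply/ler_addgt0Pl => e e0; have [g ag ge] := Sm j e e0; rewrite addrC; apply: le_trans ge.
  by apply: ge_inf => //; exists g.
have sub j k : (j <= k)%N -> S k `<=` S j.
  move=> jk _ [g [w hw] <-]; exists g => //; exists w => c; have [h1 h2 h3 h4] := hw c; split => //.
  by apply: le_trans h4 _; rewrite lef_pV2 ?posrE// ler_nat.
have mono : nondecreasing_seq mm.
  move=> j k jk; apply: lb_le_inf; first by case: (hS k).
  by move=> x /(sub _ _ jk) Sx; exact: ge_inf.
have /choice[g hg] : forall j, exists g, approx u (j.+1%:R^-1) g /\ energy g <= mm j + j.+1%:R^-1.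
  move=> j; have j0 : 0 < j.+1%:R^-1 :> R by rewrite invr_gt0.
  by have [_ [g ag <-] h] := inf_adherent j0 (hS j); exists g; split => //; exact: ltW.
have sg j c i : sqint (g j c i).
  by have [[w /(_ c)[_ _ /(_ i)[/Lp_disc2P]]]] := hg j.
have inv0 (e : R) : 0 < e -> exists J, forall j, (J <= j)%N -> j.+1%:R^-1 <= e.
  move=> e0; have /cvgrPdist_le/(_ _ e0)[J _ hJ] := @cvg_harmonic R.
  exists J => j /hJ; rewrite sub0r normrN /harmonic/=; apply: le_trans; exact: ler_norm.
have cmm : cvgn mm by apply: nondecreasing_is_cvgn => //; exists m => _ [j _ <-].
have cau (e : R) : 0 < e -> exists J, forall j k, (J <= j)%N -> (J <= k)%N ->
    energy (fun c i p => g j c i p - g k c i p) <= e.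
  (* The midpoint of two near-minimizers lies in the larger of their two sets, so the parallelogram
     identity leaves 2 (mm k' - mm j') + e / 2. The infima are within e / 8 of their limit, so the
     first term is at most e / 2. *)
  move=> e0; have e80 : 0 < e / 8 by lra.
  have [J1 hJ1] := inv0 _ e80.
  have /cvgrPdist_le/(_ _ e80)[J2 _ hJ2] := cmm.
  exists (maxn J1 J2) => j k; rewrite !geq_max => /andP[j1 j2] /andP[k1 k2].
  have step j' k' : (j' <= k')%N -> (J1 <= j')%N -> (J2 <= j')%N -> (J1 <= k')%N -> (J2 <= k')%N ->
     energy (fun c i p => g j' c i p - g k' c i p) <= e.
    move=> jk a1 a2 b1 b2; rewrite parallelogram//.
    have : mm j' <= energy (fun c i p => 2^-1 * (g j' c i p + g k' c i p)).
      apply: ge_inf => //; exists (fun c i p => 2^-1 * (g j' c i p + g k' c i p)) => //.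
      apply: approx_mid => //; first by case: (hg j').
      have [[w hw] _] := hg k'; exists w => c; have [h1 h2 h3 h4] := hw c; split => //.
      by apply: le_trans h4 _; rewrite lef_pV2 ?posrE// ler_nat.
    have ej : energy (g j') <= mm j' + e / 8 by apply: le_trans (hg j').2 _; rewrite lerD2l; exact: hJ1.
    have ek : energy (g k') <= mm k' + e / 8 by apply: le_trans (hg k').2 _; rewrite lerD2l; exact: hJ1.
    have := hJ2 _ a2; have := hJ2 _ b2; rewrite !ler_norml => /andP[x1 x2] /andP[y1 y2].
    by lra.
  have [jk|/ltnW kj] := leqP j k; first exact: step.
  have -> : energy (fun c i p => g j c i p - g k c i p) = energy (fun c i p => g k c i p - g j c i p).
    by apply: eq_bigr => z _; apply: eq_Rintegral => p _; rewrite -sqrrN opprB.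
  exact: step.
have term (h : I -> 'I_2 -> R * R -> R) c i : \int[m2]_(p in D) (h c i p ^+ 2) <= energy h.
  rewrite /energy (bigD1 (c, i))//= lerDl; apply: sumr_ge0 => z _.
  by apply: Rintegral_ge0 => p _; exact: sqr_ge0.
have /choice[G hG] : forall z : I * 'I_2, exists G, sqint G /\ forall e : R, 0 < e -> exists J, forall j, (J <= j)%N ->
     \int[m2]_(p in D) ((G p - g j z.1 z.2 p) ^+ 2) <= e.
  move=> [c i] /=; have [] := @sqint_complete R (fun j => g j c i); first by move=> j; exact: sg.
    move=> e e0; have [J hJ] := cau e e0; exists J => j k Jj Jk; apply: le_trans (hJ j k Jj Jk).
    exact: (term (fun c i p => g j c i p - g k c i p)).
  by move=> G sG hG; exists G.
have hG' (e : R) : 0 < e -> exists j, j.+1%:R^-1 <= e /\ forall z : I * 'I_2, \int[m2]_(p in D) ((G z p - g j z.1 z.2 p) ^+ 2) <= e ^+ 2.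
  move=> e0; have /choice[J hJ] : forall z, exists J, forall j, (J <= j)%N -> \int[m2]_(p in D) ((G z p - g j z.1 z.2 p) ^+ 2) <= e ^+ 2.
    by move=> z; have [_] := hG z; apply; rewrite exprn_gt0.
  have [J0 hJ0] := inv0 e e0; exists (J0 + \sum_z J z)%N; split; first by apply: hJ0; exact: leq_addr.
  by move=> z; apply: hJ; rewrite (bigD1 z)//=; lia.
exists (fun c i => G (c, i)); split.
  move=> c i; apply: is_weak_pd_limit => //; first by case: (hG (c, i)).
  move=> e e0; have [j [je hj]] := hG' e e0.
  have [[w hw] _] := hg j; have [mw w1 wg wu] := hw c.
  exists (w c), (g j c i); split => //; first exact: sqint_bounded mw w1.
  exact: le_trans wu je.
(* The energy of the limit is compared by a^2 <= (1 + e) b^2 + (1 + 1/e) (a - b)^2. The last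
   integral is at most e^2, so this term costs (1 + 1/e) e^2 = e^2 + e <= 2 e for each component. *)
have key (e : R) : 0 < e -> e < 1 -> energy (fun c i => G (c, i)) <= m + e * (m + 2 + 2 * #|{: I * 'I_2}|%:R).
  move=> e0 e1; have [j [je hj]] := hG' e e0.
  have m0 : 0 <= m by apply: le_trans (mmm 0%N); apply: lb_le_inf => [|_ [h _ <-]]; [case: (hS 0%N)|exact: energy_ge0].
  have [_ gj] := hg j; have mj := mmm j.
  apply: (@le_trans _ _ ((1 + e) * energy (g j) + 2 * e * #|{: I * 'I_2}|%:R)).
    rewrite -sum1_card natr_sum !mulr_sumr -big_split/=; apply: ler_sum => -[c i] _ /=.
    have s1 := sg j c i; have s2 := sqintB (hG (c, i)).1 s1.
    have i1 := @integrable_RZ _ _ _ m2 D _ (1 + e) mD s1.2.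
    have i2 := @integrable_RZ _ _ _ m2 D _ (1 + e^-1) mD s2.2.
    apply: (@le_trans _ _ (\int[m2]_(p in D) ((1 + e) * g j c i p ^+ 2 + (1 + e^-1) * (G (c, i) p - g j c i p) ^+ 2))).
      apply: le_Rintegral => //; [exact: (hG (c, i)).1.2|exact: (integrable_RD mD i1 i2)|].
      move=> p _; set a := G _ _; set b := g j c i p; rewrite -subr_ge0.
      have -> : (1 + e) * b ^+ 2 + (1 + e^-1) * (a - b) ^+ 2 - a ^+ 2 = e^-1 * (e * b - (a - b)) ^+ 2.
        by field; rewrite gt_eqF.
      by rewrite mulr_ge0 ?sqr_ge0// invr_ge0 ltW.
    rewrite (RintegralD mD i1 i2) (RintegralZl _ mD s1.2) (RintegralZl _ mD s2.2) lerD2l mulr1.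
    apply: (@le_trans _ _ ((1 + e^-1) * e ^+ 2)).
      by rewrite ler_wpM2l ?addr_ge0 ?invr_ge0 ?(ltW e0)//; exact: (hj (c, i)).
    have -> : (1 + e^-1) * e ^+ 2 = e ^+ 2 + e by field; rewrite gt_eqF.
    by rewrite expr2; nra.
  have {}gj : energy (g j) <= m + e by apply: le_trans gj _; exact: lerD.
  have : (1 + e) * energy (g j) <= (1 + e) * (m + e) by rewrite ler_wpM2l//; lra.
  set K := _%:R => h; have : (1 + e) * (m + e) <= m + e * (m + 2) by nra.
  by lra.
apply/ler_addgt0Pl => e e0.
pose K := m + 2 + 2 * #|{: I * 'I_2}|%:R : R.
have m0 : 0 <= m by apply: le_trans (mmm 0%N); apply: lb_le_inf => [|_ [h _ <-]]; [case: (hS 0%N)|exact: energy_ge0].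
have K0 : 0 < K by rewrite /K ltr_wpDr ?mulr_ge0//; lra.
have t0 : 0 < Num.min (e / K) 2^-1 by rewrite lt_min divr_gt0//= invr_gt0.
have t1 : Num.min (e / K) 2^-1 < 1 by rewrite gt_min invf_lt1// orbC; apply/orP; left; lra.
apply: le_trans (key _ t0 t1) _; rewrite -/K addrC lerD2r.
by rewrite -ler_pdivlMr// ge_min lexx.
Qed.
End DirectMethod.

(** * Existence of a regular frame *)

Section BoundedC1.
Variable R : realType.
Local Notation D := (@disc R).
Local Notation plane := (measurableTypeR R * measurableTypeR R)%type.
Local Notation m2 := (leb2 R).
Implicit Types (f g : R * R -> R) (i : 'I_2) (p q : R * R).

(** Continuously differentiable in the open disc with bounds up to the boundary: enough for H^{1,2}
    and closed under the algebra needed to build a frame, without any limit at the boundary. *)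
Definition C1b f := exists (f' : 'I_2 -> R * R -> R) (C : R), forall p, D p ->
  [/\ {for p, continuous f}, `|f p| <= C &
      forall i, [/\ is_derive p (dir R i) f (f' i p), {for p, continuous (f' i)} & `|f' i p| <= C]].

Lemma C1b_bounded f : C1b f -> exists2 C, 0 <= C & forall p, D p -> `|f p| <= C.
Proof.
move=> [f' [C h]]; exists C; last by move=> p /h[].
have D0 : D (0, 0) by rewrite /disc/= expr0n/= addr0 ltr01.
by case: (h _ D0) => _ h1 _; apply: le_trans h1; exact: normr_ge0.
Qed.

Lemma C1b_continuous f : C1b f -> forall p, D p -> {for p, continuous f}.
Proof. by move=> [f' [C h]] p /h[]. Qed.

Lemma C1b_weak i f : C1b f -> exists g (C : R), [/\ is_weak_pd i f g,
  forall p, D p -> is_derive p (dir R i) f (g p), forall p, D p -> {for p, continuous g} &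
  forall p, D p -> `|g p| <= C].
Proof.
move=> [f' [C h]]; exists (f' i), C.
have h1 p : D p -> is_derive p (dir R i) f (f' i p) by case/h => _ _ /(_ i)[].
have h2 p : D p -> {for p, continuous (f' i)} by case/h => _ _ /(_ i)[].
have h3 p : D p -> `|f' i p| <= C by case/h => _ _ /(_ i)[].
split => //; apply: (weak_pd_classical (C := C)) => //; by move=> p /h[].
Qed.

Lemma C1b_cst (c : R) : C1b (fun=> c).
Proof.
exists (fun _ _ => 0), `|c| => p Dp; split => //; first exact: cvg_cst.
by move=> i; split; [exact: is_derive_cst|exact: cvg_cst|rewrite normr0].
Qed.

Lemma C1bD f g : C1b f -> C1b g -> C1b (fun p => f p + g p).
Proof.
move=> [f' [C hf]] [g' [K hg]]; exists (fun i p => f' i p + g' i p), (C + K) => p Dp.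
have [cf bf df] := hf p Dp; have [cg bg dg] := hg p Dp; split.
- exact: continuousD.
- by apply: le_trans (ler_normD _ _) _; exact: lerD.
move=> i; have [d1 c1 b1] := df i; have [d2 c2 b2] := dg i; split.
- exact: is_deriveD.
- exact: continuousD.
- by apply: le_trans (ler_normD _ _) _; exact: lerD.
Qed.

Lemma C1bM f g : C1b f -> C1b g -> C1b (fun p => f p * g p).
Proof.
move=> [f' [C hf]] [g' [K hg]]; exists (fun i p => f p * g' i p + g p * f' i p), (C * K + K * C + C * K) => p Dp.
have [cf bf df] := hf p Dp; have [cg bg dg] := hg p Dp.
have C0 : 0 <= C by apply: le_trans bf; exact: normr_ge0.
have K0 : 0 <= K by apply: le_trans bg; exact: normr_ge0.
have CK : 0 <= C * K by exact: mulr_ge0.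
split.
- exact: continuousM.
- rewrite normrM; apply: (@le_trans _ _ (C * K)); first by rewrite ler_pM.
  by rewrite lerDr addr_ge0// mulr_ge0.
move=> i; have [d1 c1 b1] := df i; have [d2 c2 b2] := dg i; split.
- exact: is_deriveM.
- by apply: continuousD; exact: continuousM.
- apply: le_trans (ler_normD _ _) _; apply: (@le_trans _ _ (C * K + K * C)); last by rewrite lerDl.
  by rewrite !normrM; apply: lerD; rewrite ler_pM.
Qed.

Lemma C1bZ (c : R) f : C1b f -> C1b (fun p => c * f p).
Proof. by move=> cf; apply: C1bM => //; exact: C1b_cst. Qed.

Lemma C1bN f : C1b f -> C1b (fun p => - f p).
Proof.
move=> cf; have := C1bZ (-1) cf.
by rewrite (_ : (fun p => -1 * f p) = (fun p => - f p))//; apply/funext => p; rewrite mulN1r.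
Qed.

Lemma C1b_sum (I : Type) (r : seq I) (P : pred I) (F : I -> R * R -> R) :
  (forall k, C1b (F k)) -> C1b (fun p => \sum_(k <- r | P k) F k p).
Proof.
move=> cF; elim: r => [|k r IH].
  by under [X in C1b X]funext do rewrite big_nil; exact: C1b_cst.
under [X in C1b X]funext do rewrite big_cons.
by case: (P k) => //; exact: C1bD.
Qed.

Lemma C1b_prod (I : Type) (r : seq I) (P : pred I) (F : I -> R * R -> R) :
  (forall k, C1b (F k)) -> C1b (fun p => \prod_(k <- r | P k) F k p).
Proof.
move=> cF; elim: r => [|k r IH].
  by under [X in C1b X]funext do rewrite big_nil; exact: C1b_cst.
under [X in C1b X]funext do rewrite big_cons.
by case: (P k) => //; exact: C1bM.
Qed.

Lemma C1b_comp (h h' : R -> R) (K : R) f : C1b f ->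
  (forall p, D p -> [/\ is_derive (f p) (1 : R) h (h' (f p)), {for f p, continuous h'},
     `|h (f p)| <= K & `|h' (f p)| <= K]) -> C1b (fun p => h (f p)).
Proof.
move=> [f' [C hf]] hh; exists (fun i p => h' (f p) * f' i p), (K + K * C) => p Dp.
have [cf bf df] := hf p Dp; have [dh ch bh bh'] := hh p Dp.
have C0 : 0 <= C by apply: le_trans bf; exact: normr_ge0.
have K0 : 0 <= K by apply: le_trans bh; exact: normr_ge0.
have ch0 : {for f p, continuous h}.
  by apply: differentiable_continuous; apply/derivable1_diffP; case: dh.
split.
- exact: continuous_comp.
- by apply: le_trans bh _; rewrite lerDl mulr_ge0.
move=> i; have [d1 c1 b1] := df i; split.
- have [x [y pE]] := pt_surj i p; rewrite pE in d1 dh *; apply/is_derive_ptP.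
  exact: (@is_derive1_comp _ h (fun t => f (pt i t y)) x _ _ dh ((is_derive_ptP _ _ _ _ _).1 d1)).
- by apply: continuousM => //; exact: continuous_comp.
- rewrite normrM; apply: (@le_trans _ _ (K * C)); first by rewrite ler_pM.
  by rewrite lerDr.
Qed.

Lemma C1bV f (c : R) : 0 < c -> (forall p, D p -> c <= f p) -> C1b f -> C1b (fun p => (f p)^-1).
Proof.
move=> c0 fc cf; apply: (@C1b_comp (fun x => x^-1) (fun x => - x ^- 2) (c^-1 + c ^- 2)) => // p Dp.
have fp0 : 0 < f p by exact: lt_le_trans (fc p Dp).
have h0 := gt_eqF fp0.
have v0 : 0 <= c^-1 by rewrite invr_ge0 ltW.
split.
- have := @is_deriveV R id (f p) 1 1; rewrite /= h0 => /(_ isT (is_derive_id _ _)) h.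
  by apply: is_derive_eq; rewrite /GRing.scale/= mulr1.
- apply: continuousN; apply: continuousV; first by rewrite expf_neq0// h0.
  by apply: exprn_continuous.
- rewrite ger0_norm ?invr_ge0 ?(ltW fp0)//; apply: (@le_trans _ _ c^-1).
    by rewrite lef_pV2 ?posrE//; exact: fc.
  by rewrite lerDl invr_ge0 exprn_ge0// ltW.
- rewrite normrN ger0_norm ?invr_ge0 ?exprn_ge0 ?(ltW fp0)//; apply: (@le_trans _ _ (c ^- 2)).
    by rewrite lef_pV2 ?posrE ?exprn_gt0// ler_sqr ?nnegrE ?(ltW c0) ?(ltW fp0)//; exact: fc.
  by rewrite lerDr.
Qed.

Lemma C1b_sqrt f (c : R) : 0 < c -> (forall p, D p -> c <= f p) -> C1b f -> C1b (fun p => Num.sqrt (f p)).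
Proof.
move=> c0 fc cf; have [C C0 bf] := C1b_bounded cf.
have sc : 0 < Num.sqrt c by rewrite sqrtr_gt0.
apply: (@C1b_comp Num.sqrt (fun x => (2 * Num.sqrt x)^-1) (Num.sqrt C + (2 * Num.sqrt c)^-1)) => // p Dp.
have fp0 : 0 < f p by exact: lt_le_trans (fc p Dp).
have sp0 : 0 < Num.sqrt (f p) by rewrite sqrtr_gt0.
have v0 : 0 <= (2 * Num.sqrt c)^-1 by rewrite invr_ge0 mulr_ge0 ?ltW.
split.
- exact: is_derive1_sqrt.
- apply: continuousV; first by rewrite mulf_neq0 ?gt_eqF.
  by apply: continuousM; [exact: cvg_cst|exact: sqrt_continuous].
- rewrite ger0_norm ?sqrtr_ge0//; apply: (@le_trans _ _ (Num.sqrt C)); last by rewrite lerDl.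
  by rewrite ler_wsqrtr//; apply: le_trans (ler_norm _) (bf p Dp).
- rewrite ger0_norm ?invr_ge0 ?mulr_ge0 ?sqrtr_ge0//; apply: (@le_trans _ _ (2 * Num.sqrt c)^-1); last by rewrite lerDr sqrtr_ge0.
  by rewrite lef_pV2 ?posrE ?mulr_gt0// ler_pM2l// ler_wsqrtr//; exact: fc.
Qed.

Definition shrink (s : R) (p : R * R) : R * R := (s * p.1, s * p.2).

Lemma disc_shrink (s : R) p : 0 <= s <= 1 -> D p -> D (shrink s p).
Proof.
move=> /andP[s0 s1]; rewrite /disc/= !exprMn => h; rewrite -mulrDr.
apply: le_lt_trans h; rewrite ler_piMl ?addr_ge0 ?sqr_ge0//.
by rewrite expr2; nra.
Qed.

Lemma continuous_shrink (s : R) : continuous (shrink s).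
Proof.
move=> p; apply: (@cvg_pair _ _ _ (nbhs p) (nbhs (s * p.1)) (nbhs (s * p.2))).
  by apply: cvgM; [exact: cvg_cst|exact: cvg_fst].
by apply: cvgM; [exact: cvg_cst|exact: cvg_snd].
Qed.

Lemma C1b_shrink (s : R) f : 0 <= s <= 1 -> C1b f -> C1b (fun p => f (shrink s p)).
Proof.
move=> s01 [f' [C hf]]; exists (fun i p => f' i (shrink s p) * s), C => p Dp.
have /andP[s0 s1] := s01.
have [cf bf df] := hf _ (disc_shrink s01 Dp).
have C0 : 0 <= C by apply: le_trans bf; exact: normr_ge0.
have cs := @continuous_shrink s p.
split => //; first exact: (@continuous_comp _ _ _ (shrink s) f).
move=> i; have [d1 c1 b1] := df i; split.
- have [x [y pE]] := pt_surj i p; rewrite pE in d1 *; apply/is_derive_ptP.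
  have E z : shrink s (pt i z y) = pt i (s * z) (s * y) by rewrite /shrink /pt; case: (i == ord0).
  rewrite E in d1 *; under [X in is_derive _ _ X]funext do rewrite E.
  have da : is_derive x (1 : R) (fun x => s * x) s.
    have -> : (fun x => s * x) = (s \*: (id : R -> R)) :> (R -> R) by [].
    by apply: is_derive_eq; rewrite /GRing.scale /= mulr1.
  exact: (@is_derive1_comp _ (fun t => f (pt i t (s * y))) (fun x => s * x) x _ _ ((is_derive_ptP _ _ _ _ _).1 d1) da).
- apply: continuousM; last exact: cvg_cst.
  exact: (@continuous_comp _ _ _ (shrink s) (f' i)).
- by rewrite normrM (ger0_norm s0) -[leRHS]mulr1 ler_pM.
Qed.

(** The mean value theorem is applied on two axis-parallel segments through the corner (s p_1, t
    p_2), which lies in the disc because s <= t. *)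
Lemma C1b_lipschitz f : C1b f -> exists2 L, 0 <= L & forall s t p, 0 <= s -> s <= t -> t <= 1 -> D p ->
  `|f (shrink s p) - f (shrink t p)| <= L * (t - s).
Proof.
move=> [f' [C hf]].
have D0 : D (0, 0) by rewrite /disc/= expr0n/= addr0 ltr01.
have C0 : 0 <= C by case: (hf _ D0) => _ h _; apply: le_trans h; exact: normr_ge0.
have mvt i (x x' y : R) : x ^+ 2 + y ^+ 2 < 1 -> x' ^+ 2 + y ^+ 2 < 1 -> `|f (pt i x' y) - f (pt i x y)| <= C * `|x' - x|.
  move=> h1 h2.
  have step (a b : R) : a ^+ 2 + y ^+ 2 < 1 -> b ^+ 2 + y ^+ 2 < 1 -> a <= b -> `|f (pt i b y) - f (pt i a y)| <= C * `|b - a|.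
    move=> ha hb ab.
    have inD t : a <= t <= b -> D (pt i t y).
      move=> /andP[t1 t2]; apply/disc_pt.
      have : t ^+ 2 <= Num.max (a ^+ 2) (b ^+ 2).
        rewrite le_max; have [t0|t0] := leP 0 t; apply/orP; [right|left]; rewrite -subr_ge0 subr_sqr.
          by rewrite mulr_ge0//; lra.
        by rewrite mulr_le0//; lra.
      by have [ha'|ha'] := leP (a ^+ 2) (b ^+ 2) => h; lra.
    have [||c] := @MVT_segment R (fun t => f (pt i t y)) (fun t => f' i (pt i t y)) a b ab.
    - move=> x0; rewrite in_itv/= => /andP[/ltW c1 /ltW c2]; apply/is_derive_ptP.
      by have [_ _ /(_ i)[]] := hf _ (inD x0 (introT andP (conj c1 c2))).
    - apply/subspace_continuousP => x0 /=; rewrite in_itv/= => x0ab.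
      apply: cvg_within_filter; have [cf _ _] := hf _ (inD x0 x0ab).
      exact: (@continuous_comp _ _ _ (fun t => pt i t y) f _ (@continuous_pt R i y x0) cf).
    rewrite in_itv/= => cab ->; rewrite normrM ler_wpM2r//.
    by have [_ _ /(_ i)[]] := hf _ (inD c cab).
  have [xx|/ltW xx] := leP x x'; first exact: step.
  by rewrite distrC (distrC x'); exact: step.
exists (C + C); first exact: addr_ge0.
move=> s t p s0 st t1 Dp.
have s1 : s <= 1 by exact: le_trans st t1.
have t0 : 0 <= t by exact: le_trans s0 st.
have sq : s ^+ 2 <= t ^+ 2 by rewrite ler_sqr.
have := disc_shrink (introT andP (conj s0 s1)) Dp; have := disc_shrink (introT andP (conj t0 t1)) Dp.
rewrite /disc /shrink /= => h1 h2.
have h3 : (s * p.1) ^+ 2 + (t * p.2) ^+ 2 < 1.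
  by apply: le_lt_trans h1; rewrite lerD2r !exprMn ler_wpM2r ?sqr_ge0.
have b1 := mvt ord0 (t * p.1) (s * p.1) (t * p.2) h1 h3.
have b2 := mvt 1 (t * p.2) (s * p.2) (s * p.1) _ _.
rewrite addrC in h3; rewrite addrC in h2; have {}b2 := b2 h3 h2.
have np : `|p.1| <= 1 /\ `|p.2| <= 1.
  move: Dp; rewrite /disc/= => Dp; rewrite -(@ler_sqr _ `|p.1|) ?nnegrE// -(@ler_sqr _ `|p.2|) ?nnegrE//.
  by rewrite !real_normK ?num_real// expr1n; have := sqr_ge0 p.1; have := sqr_ge0 p.2; split; lra.
have -> : f (s * p.1, s * p.2) - f (t * p.1, t * p.2) = (f (pt 1 (s * p.2) (s * p.1)) - f (pt 1 (t * p.2) (s * p.1))) +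
   (f (pt ord0 (s * p.1) (t * p.2)) - f (pt ord0 (t * p.1) (t * p.2))) by rewrite /pt/=; ring.
apply: le_trans (ler_normD _ _) _; rewrite mulrDl; apply: lerD.
  apply: le_trans b2 _; rewrite -mulrBl normrM (distrC s) (ger0_norm (_ : 0 <= t - s)) ?subr_ge0//.
  by rewrite ler_wpM2l// ler_piMr ?subr_ge0//; case: np.
apply: le_trans b1 _; rewrite -mulrBl normrM (distrC s) (ger0_norm (_ : 0 <= t - s)) ?subr_ge0//.
by rewrite ler_wpM2l// ler_piMr ?subr_ge0//; case: np.
Qed.

Lemma Ck_C1b f : Ck_cdisc 1 f -> C1b f.
Proof.
move=> [cf df]; have [C C0 bf] := within_cdisc_bounded cf.
have h i := df i.
have b i : exists2 K, 0 <= K & forall p, cdisc p -> `|pd i f p| <= K.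
  by apply: within_cdisc_bounded; case: (df i) => _ [].
have [K0 K00 h0] := b 0; have [K1 K10 h1] := b 1.
exists (fun i => pd i f), (C + K0 + K1) => p Dp.
have cp : cdisc p by exact: subset_closure.
split; first exact: within_cdisc_continuous.
  by apply: le_trans (bf _ cp) _; lra.
move=> i; have [d1 [c1 _]] := df i; split; [exact: d1|exact: within_cdisc_continuous|].
have [->|->] : i = 0 \/ i = 1 by case: i {d1 c1} => [[|[|]]]// ?; [left|right]; exact: val_inj.
  by apply: le_trans (h0 _ cp) _; lra.
by apply: le_trans (h1 _ cp) _; lra.
Qed.
End BoundedC1.

(** * Inner product and reflections *)

Section Dot.
Variables (R : realType) (n : nat).
Local Notation vec := 'rV[R]_(2 + n).
Implicit Types (x y z u v w : vec) (F G : 'M[R]_(2 + n)).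

Lemma dotE x y : dot x y = (x *m y^T) 0 0.
Proof. by rewrite /dot mxE; apply: eq_bigr => l _; rewrite mxE. Qed.

Lemma dotC x y : dot x y = dot y x.
Proof. by apply: eq_bigr => l _; rewrite mulrC. Qed.

Lemma dotDl x y z : dot (x + y) z = dot x z + dot y z.
Proof. by rewrite !dotE mulmxDl mxE. Qed.

Lemma dotZl (c : R) x y : dot (c *: x) y = c * dot x y.
Proof. by rewrite !dotE -scalemxAl mxE. Qed.

Lemma dotDr x y z : dot x (y + z) = dot x y + dot x z.
Proof. by rewrite ![dot x _]dotC dotDl. Qed.

Lemma dotZr (c : R) x y : dot x (c *: y) = c * dot x y.
Proof. by rewrite ![dot x _]dotC dotZl. Qed.

Lemma dotNl x y : dot (- x) y = - dot x y.
Proof. by rewrite -scaleN1r dotZl mulN1r. Qed.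

Lemma dotNr x y : dot x (- y) = - dot x y.
Proof. by rewrite dotC dotNl dotC. Qed.

Lemma dot_adjoint x y F : dot (x *m F) y = dot x (y *m F^T).
Proof. by rewrite !dotE trmx_mul trmxK mulmxA. Qed.

Lemma dot_isometry x y F : F *m F^T = 1%:M -> dot (x *m F) (y *m F) = dot x y.
Proof. by move=> FF; rewrite dot_adjoint -mulmxA FF mulmx1. Qed.

Lemma dot_ge0 x : 0 <= dot x x.
Proof. by apply: sumr_ge0 => l _; rewrite -expr2 sqr_ge0. Qed.

Lemma dot_gt0 x : x != 0 -> 0 < dot x x.
Proof.
rewrite lt_def dot_ge0 andbT; apply: contra => /eqP; rewrite /dot => h.
apply/eqP/rowP => l; rewrite mxE.
apply/eqP; rewrite -sqrf_eq0 eq_le sqr_ge0 andbT -h (bigD1 l)//= -expr2 lerDl.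
by apply: sumr_ge0 => k _; rewrite -expr2 sqr_ge0.
Qed.

Lemma dot_delta i j : dot (delta_mx 0 i : vec) (delta_mx 0 j) = (i == j)%:R.
Proof. rewrite /dot (bigD1 i)//= big1 ?addr0 => [|l li]; first by rewrite !mxE !eqxx mul1r.
by rewrite !mxE (negbTE li) andbF mul0r. Qed.

Lemma orthogonal_mul F G : F *m F^T = 1%:M -> G *m G^T = 1%:M -> (F *m G) *m (F *m G)^T = 1%:M.
Proof. by move=> FF GG; rewrite trmx_mul mulmxA -(mulmxA F) GG mulmx1. Qed.

Definition householder w : 'M[R]_(2 + n) := 1%:M - (2 / dot w w) *: (w^T *m w).

Lemma mul_householder u w : u *m householder w = u - (2 / dot w w * dot u w) *: w.
Proof.
rewrite /householder mulmxBr mulmx1 -scalemxAr mulmxA [u *m w^T]mx11_scalar -dotE.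
by rewrite mul_scalar_mx scalerA.
Qed.

Lemma householder_orthogonal w : dot w w != 0 -> householder w *m (householder w)^T = 1%:M.
Proof.
move=> w0; have -> : (householder w)^T = householder w.
  by rewrite /householder linearB/= linearZ/= trmx_mul trmxK trmx1.
rewrite {2}/householder mulmxBr mulmx1 -scalemxAr {2}/householder mulmxBl mul1mx -scalemxAl.
have -> : w^T *m w *m (w^T *m w) = dot w w *: (w^T *m w).
  by rewrite mulmxA -(mulmxA w^T) [w *m w^T]mx11_scalar -dotE mul_mx_scalar scalemxAl.
rewrite /householder scalerBr !scalerA (_ : 2 / dot w w * (2 / dot w w) * dot w w = 2 / dot w w + 2 / dot w w).
  by rewrite scalerDl opprB addrK subrK.
by field.
Qed.

(** The sum is reflected, at the cost of a sign, because for close unit vectors it is bounded away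
    from 0, while the difference may vanish. *)
Lemma householder_swap u v : dot u u = 1 -> dot v v = 1 -> dot (u + v) (u + v) != 0 ->
  u *m householder (u + v) = - v.
Proof.
move=> u1 v1 w0; rewrite mul_householder.
have E : dot (u + v) (u + v) = 2 * dot u (u + v).
  by rewrite !dotDl !dotDr u1 v1 (dotC v u); ring.
rewrite E in w0 *; have -> : 2 / (2 * dot u (u + v)) * dot u (u + v) = 1.
  by move: w0; rewrite mulf_eq0 negb_or => /andP[_ h]; field.
by rewrite scale1r opprD addrA subrr add0r.
Qed.

Lemma householder_fix u w : dot u w = 0 -> u *m householder w = u.
Proof. by move=> h; rewrite mul_householder h mulr0 scale0r subr0. Qed.

(** For two fixed vectors no smoothness is at stake, so the reflection in the difference can be
    used, with u = v treated apart. *)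
Lemma orthogonal_swap u v : dot u u = 1 -> dot v v = 1 -> exists F,
  [/\ F *m F^T = 1%:M, u *m F = v & forall z, dot z u = 0 -> dot z v = 0 -> z *m F = z].
Proof.
move=> u1 v1; have [->|uv] := eqVneq u v.
  by exists 1%:M; split => [||z _ _]; rewrite ?trmx1 mulmx1.
have w0 : dot (u + - v) (u + - v) != 0 by rewrite gt_eqF// dot_gt0// subr_eq0.
exists (householder (u + - v)); split.
- exact: householder_orthogonal.
- by rewrite householder_swap ?opprK// dotNl dotNr opprK.
- by move=> z zu zv; rewrite householder_fix// dotDr dotNr zu zv oppr0 addr0.
Qed.
End Dot.

Section RegularFrame.
Variables (R : realType) (n : nat).
Local Notation vec := 'rV[R]_(2 + n).
Local Notation D := (@disc R).
Implicit Types (xi : R * R -> vec) (p q : R * R).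

Definition C1bmx m k (F : R * R -> 'M[R]_(m, k)) := forall i j, C1b (fun p => F p i j).

Lemma C1bmx_cst m k (A : 'M[R]_(m, k)) : C1bmx (fun=> A).
Proof. by move=> i j; exact: C1b_cst. Qed.

Lemma C1bmxM m k l (F : R * R -> 'M[R]_(m, k)) (G : R * R -> 'M[R]_(k, l)) :
  C1bmx F -> C1bmx G -> C1bmx (fun p => F p *m G p).
Proof.
move=> cF cG i j; under [X in C1b X]funext do rewrite mxE.
by apply: C1b_sum => z; exact: C1bM.
Qed.

Lemma C1bmxT m k (F : R * R -> 'M[R]_(m, k)) : C1bmx F -> C1bmx (fun p => (F p)^T).
Proof. by move=> cF i j; under [X in C1b X]funext do rewrite mxE. Qed.

Lemma C1bmxD m k (F G : R * R -> 'M[R]_(m, k)) : C1bmx F -> C1bmx G -> C1bmx (fun p => F p + G p).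
Proof. by move=> cF cG i j; under [X in C1b X]funext do rewrite mxE; exact: C1bD. Qed.

Lemma C1bmxZ m k (f : R * R -> R) (F : R * R -> 'M[R]_(m, k)) : C1b f -> C1bmx F -> C1bmx (fun p => f p *: F p).
Proof. by move=> cf cF i j; under [X in C1b X]funext do rewrite mxE; exact: C1bM. Qed.

Lemma C1b_dot (F G : R * R -> vec) : C1bmx F -> C1bmx G -> C1b (fun p => dot (F p) (G p)).
Proof. by move=> cF cG; apply: C1b_sum => l; exact: C1bM. Qed.

Lemma C1b_det m (F : R * R -> 'M[R]_m) : C1bmx F -> C1b (fun p => \det (F p)).
Proof. by move=> cF; apply: C1b_sum => s; apply: C1bZ; apply: C1b_prod => i. Qed.

Lemma C1bmx_householder w (c : R) : C1bmx w -> 0 < c -> (forall p, D p -> c <= dot (w p) (w p)) ->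
  C1bmx (fun p => @householder R n (w p)).
Proof.
move=> cw c0 wc; apply: C1bmxD; first exact: C1bmx_cst.
under [X in C1bmx X]funext do rewrite -scaleNr.
apply: C1bmxZ; last by apply: C1bmxM => //; exact: C1bmxT.
by apply/C1bN/C1bZ; apply: (C1bV c0) => //; exact: C1b_dot.
Qed.

(* Transport along rays: consecutive values of xi on a fine subdivision of the
   segment from 0 to p are close, so that their sum is nonzero and the
   reflection in it maps one to minus the other, smoothly in p. *)
Lemma transport xi : C1bmx xi -> (forall p, D p -> dot (xi p) (xi p) = 1) ->
  exists2 F : R * R -> 'M[R]_(2 + n), C1bmx F & forall p, D p ->
    [/\ F p *m (F p)^T = 1%:M, xi (0, 0) *m F p = xi p &
        forall v, (forall q, D q -> dot v (xi q) = 0) -> v *m F p = v].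
Proof.
move=> cxi xi1.
have /choice[L hL] : forall l, exists L, 0 <= L /\ forall s t p, 0 <= s -> s <= t -> t <= 1 -> D p ->
   `|xi (shrink s p) 0 l - xi (shrink t p) 0 l| <= L * (t - s).
  by move=> l; have [L L0 hL] := C1b_lipschitz (cxi 0 l); exists L.
pose K := \sum_l L l ^+ 2.
have K0 : 0 <= K by apply: sumr_ge0 => l _; exact: sqr_ge0.
(* M is even, so that the M sign changes cancel. It satisfies K <= M^2, so neighbouring values
   differ by at most 1 in length, and the squared length of their sum is at least 4 - 1 = 3. *)
pose M := (2 * (Num.bound K).+1)%N.
have M0 : 0 < M%:R :> R by rewrite ltr0n /M.
have KM : K <= M%:R ^+ 2.
  have KB : K < (Num.bound K)%:R by exact: archi_boundP.
  apply: (@le_trans _ _ (M%:R)); last first.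
    by rewrite expr2 ler_peMr ?(ltW M0)// ler1n /M.
  by apply: (le_trans (ltW KB)); rewrite ler_nat /M; lia.
have close s t p : 0 <= s -> s <= t -> t <= 1 -> t - s = M%:R^-1 -> D p ->
    3 <= dot (xi (shrink s p) + xi (shrink t p)) (xi (shrink s p) + xi (shrink t p)).
  move=> s0 st t1 ts Dp.
  have s1 : s <= 1 by exact: le_trans st t1.
  have t0 : 0 <= t by exact: le_trans s0 st.
  have e1 := xi1 _ (disc_shrink (introT andP (conj s0 s1)) Dp).
  have e2 := xi1 _ (disc_shrink (introT andP (conj t0 t1)) Dp).
  set a := xi _ in e1 *; set b := xi _ in e2 *.
  have : dot (a + - b) (a + - b) <= 1.
    apply: (@le_trans _ _ (K * M%:R^-1 ^+ 2)); last by rewrite exprVn ler_pdivrMr ?exprn_gt0// mul1r.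
    rewrite /dot /K mulr_suml; apply: ler_sum => l _; rewrite !mxE -expr2 -exprMn -ts.
    have [Ll hl] := hL l; rewrite -[leLHS]real_normK ?num_real// ler_sqr ?nnegrE ?mulr_ge0 ?subr_ge0//.
    exact: hl.
  rewrite !dotDl !dotDr !dotNl !dotNr opprK e1 e2 (dotC b a); lra.
have rec k : (k <= M)%N -> exists2 F : R * R -> 'M[R]_(2 + n), C1bmx F & forall p, D p ->
    [/\ F p *m (F p)^T = 1%:M, xi (0, 0) *m F p = (-1) ^+ k *: xi (shrink (k%:R / M%:R) p) &
        forall v, (forall q, D q -> dot v (xi q) = 0) -> v *m F p = v].
  elim: k => [|k IH] kM.
    exists (fun=> 1%:M); first exact: C1bmx_cst.
    move=> p Dp; split; [by rewrite trmx1 mulmx1| |by move=> v _; rewrite mulmx1].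
    by rewrite mulmx1 expr0 scale1r mul0r /shrink !mul0r.
  have [F cF hF] := IH (ltnW kM).
  pose s : R := k%:R / M%:R; pose t : R := k.+1%:R / M%:R.
  have s0 : 0 <= s by rewrite divr_ge0.
  have st : s <= t by rewrite ler_pM2r ?invr_gt0// ler_nat.
  have t1 : t <= 1 by rewrite ler_pdivrMr// mul1r ler_nat.
  have ts : t - s = M%:R^-1 by rewrite /t /s -mulrBl -natrB// subSnn mul1r.
  have s1 : s <= 1 by exact: le_trans st t1.
  have t0 : 0 <= t by exact: le_trans s0 st.
  pose w p := xi (shrink s p) + xi (shrink t p).
  have cw : C1bmx w.
    apply: C1bmxD => i j.
      by apply: (@C1b_shrink _ s (fun p => xi p i j)); rewrite ?s0.
    by apply: (@C1b_shrink _ t (fun p => xi p i j)); rewrite ?t0.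
  have w3 p : D p -> 3 <= dot (w p) (w p) by exact: close.
  exists (fun p => F p *m householder (w p)).
    by apply: C1bmxM => //; apply: (@C1bmx_householder w 3).
  move=> p Dp; have [h1 h2 h3] := hF p Dp.
  have Ds := disc_shrink (introT andP (conj s0 s1)) Dp.
  have Dt := disc_shrink (introT andP (conj t0 t1)) Dp.
  have w0 : dot (w p) (w p) != 0 by rewrite gt_eqF// (lt_le_trans _ (w3 p Dp)).
  split.
  - by apply: orthogonal_mul => //; exact: householder_orthogonal.
  - rewrite mulmxA h2 -scalemxAl householder_swap ?xi1//.
    by rewrite exprS mulN1r scaleNr scalerN.
  - by move=> v hv; rewrite mulmxA h3// householder_fix// dotDr !hv// addr0.
have [F cF hF] := rec M (leqnn _); exists F => // p Dp; have [h1 h2 h3] := hF p Dp; split => //.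
by rewrite h2 divff ?gt_eqF// /shrink !mul1r /M exprM sqrrN expr1n expr1n scale1r -surjective_pairing.
Qed.

(** First x1 is transported from the centre. Pulled back by this transport, x2 becomes a field [eta]
    orthogonal to the constant vector x1(0, 0), so transporting [eta] leaves that vector fixed.
    Constant orthogonal matrices carry the first two basis vectors to the two values at the
    centre. *)
Lemma regular_frame (x1 x2 : R * R -> vec) : C1bmx x1 -> C1bmx x2 ->
  (forall p, D p -> [/\ dot (x1 p) (x1 p) = 1, dot (x2 p) (x2 p) = 1 & dot (x1 p) (x2 p) = 0]) ->
  exists2 P : R * R -> 'M[R]_(2 + n), C1bmx P & forall p, D p ->
    [/\ P p *m (P p)^T = 1%:M, row (lshift n 0) (P p) = x1 p & row (lshift n 1) (P p) = x2 p].
Proof.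
move=> c1 c2 h.
have D0 : D (0, 0) by rewrite /disc/= expr0n/= addr0 ltr01.
have [F1 cF1 hF1] := transport c1 (fun p Dp => (let: And3 e _ _ := h p Dp in e)).
pose eta p := x2 p *m (F1 p)^T.
have FT p : D p -> (F1 p)^T *m F1 p = 1%:M by move=> /hF1[e _ _]; exact: mulmx1C.
have ceta : C1bmx eta by apply: C1bmxM => //; exact: C1bmxT.
have eta1 p : D p -> dot (eta p) (eta p) = 1.
  by move=> Dp; rewrite /eta dot_isometry ?trmxK ?FT//; case: (h p Dp).
have eta0 p : D p -> dot (x1 (0, 0)) (eta p) = 0.
  move=> Dp; rewrite /eta -dot_adjoint; have [_ -> _] := hF1 p Dp.
  by case: (h p Dp).
have [F2 cF2 hF2] := transport ceta eta1.
have [a1 _ _] := h _ D0; have b1 := eta1 _ D0; have ab := eta0 _ D0.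
set a := x1 (0, 0) in a1 ab eta0 *; set b := eta (0, 0) in b1 ab *.
pose d0 : vec := delta_mx 0 (lshift n 0); pose d1 : vec := delta_mx 0 (lshift n 1).
have d00 : dot d0 d0 = 1 by rewrite dot_delta eqxx.
have d11 : dot d1 d1 = 1 by rewrite dot_delta eqxx.
have d01 : dot d0 d1 = 0 by rewrite dot_delta.
have [H1 [OO1 dO1 _]] := orthogonal_swap d00 a1.
have bO : dot (b *m H1^T) (b *m H1^T) = 1 by rewrite dot_isometry// trmxK; exact: mulmx1C.
have db : dot d0 (b *m H1^T) = 0 by rewrite -dot_adjoint dO1.
have [H2 [OO2 dO2 fO2]] := orthogonal_swap d11 bO.
exists (fun p => (H2 *m H1) *m (F2 p *m F1 p)).
  by apply: C1bmxM; [exact: C1bmx_cst|exact: C1bmxM].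
move=> p Dp; have [f1 f2 _] := hF1 p Dp; have [g1 g2 g3] := hF2 p Dp; split.
- by apply: orthogonal_mul; exact: orthogonal_mul.
- by rewrite rowE !mulmxA fO2// dO1 g3.
- rewrite rowE !mulmxA dO2 -(mulmxA b) (mulmx1C OO1) mulmx1 g2 /eta -mulmxA FT ?mulmx1//.
Qed.
End RegularFrame.

(** * Total torsion and Dirichlet energy *)

Section FrameAlgebra.
Variables (R : realType) (n : nat).
Local Notation vec := 'rV[R]_(2 + n).
Implicit Types (X : R * R -> vec) (N : 'I_n -> R * R -> vec) (p : R * R).

Definition conformal_at X p := [/\ dot (vpd 0 X p) (vpd 0 X p) = dot (vpd 1 X p) (vpd 1 X p),
  0 < dot (vpd 0 X p) (vpd 0 X p) & dot (vpd 0 X p) (vpd 1 X p) = 0].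

Definition area X p := dot (vpd 0 X p) (vpd 0 X p).

Definition gram_diag X p : 'rV[R]_(2 + n) := row_mx (const_mx (area X p)) (const_mx 1).

Lemma ord2P (i : 'I_2) : i = 0 \/ i = 1.
Proof. by case: i => [[|[|]]]// ?; [left|right]; exact: val_inj. Qed.

Lemma dot_vpd X p i j : conformal_at X p -> dot (vpd i X p) (vpd j X p) = area X p *+ (i == j).
Proof.
have gen (y : 'I_2 -> vec) : dot (y 0) (y 0) = dot (y 1) (y 1) -> dot (y 0) (y 1) = 0 ->
    forall i j, dot (y i) (y j) = dot (y 0) (y 0) *+ (i == j).
  have n01 : (0 == 1 :> 'I_2) = false by [].
  have n10 : (1 == 0 :> 'I_2) = false by [].
  move=> h1 h2 k l; case: (ord2P k) => ->; case: (ord2P l) => ->.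
  - by rewrite eqxx mulr1n.
  - by rewrite n01 h2 mulr0n.
  - by rewrite n10 dotC h2 mulr0n.
  - by rewrite eqxx -h1 mulr1n.
by move=> [h1 _ h2]; exact: (gen (fun i => vpd i X p)).
Qed.

Lemma row_frame_l X N p i : row (lshift n i) (frame_mx X N p) = vpd i X p.
Proof. by apply/rowP => l; rewrite !mxE (unsplitK (inl _)) !mxE. Qed.

Lemma row_frame_r X N p s : row (rshift 2 s) (frame_mx X N p) = N s p.
Proof. by apply/rowP => l; rewrite !mxE (unsplitK (inr _)) !mxE. Qed.

Lemma mul_tr_row m (A B : 'M[R]_(m, 2 + n)) i j : (A *m B^T) i j = dot (row i A) (row j B).
Proof. by rewrite mxE; apply: eq_bigr => l _; rewrite !mxE. Qed.

Lemma gram_frame X N p : conformal_at X p -> (forall s t, dot (N s p) (N t p) = (s == t)%:R) ->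
  (forall s i, dot (N s p) (vpd i X p) = 0) ->
  frame_mx X N p *m (frame_mx X N p)^T = diag_mx (gram_diag X p).
Proof.
move=> cX NN NX; apply/matrixP => i j; rewrite mul_tr_row [RHS]mxE /gram_diag.
rewrite -(splitK i) -(splitK j); case: (fintype.split i) => a; case: (fintype.split j) => b /=;
  rewrite ?row_frame_l ?row_frame_r.
- by rewrite (dot_vpd _ _ cX) row_mxEl mxE (inj_eq (@lshift_inj _ _)).
- by rewrite dotC NX eq_lrshift mulr0n.
- by rewrite NX eq_rlshift mulr0n.
- by rewrite NN row_mxEr mxE (inj_eq (@rshift_inj _ _)).
Qed.

Lemma gram_diag_gt0 X p i : conformal_at X p -> 0 < gram_diag X p 0 i.
Proof.
move=> [_ W0 _]; rewrite /gram_diag mxE; case: (fintype.split i) => j; rewrite mxE//.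
Qed.

(** The rows of F are orthogonal with squared lengths d. A one-sided inverse of a square matrix is
    two-sided, so F^T diag(1/d) F = 1 may be inserted between v and its transpose. *)
Lemma parseval (F : 'M[R]_(2 + n)) (d : vec) : F *m F^T = diag_mx d -> (forall i, 0 < d 0 i) ->
  forall v, dot v v = \sum_i (dot v (row i F)) ^+ 2 / d 0 i.
Proof.
move=> FF d0 v; pose e : vec := \row_i (d 0 i)^-1.
have ed : diag_mx e *m diag_mx d = 1%:M.
  rewrite mulmx_diag; apply/matrixP => i j; rewrite !mxE mulVf//; exact: lt0r_neq0.
have : F^T *m (diag_mx e *m F) = 1%:M by apply: mulmx1C; rewrite -mulmxA FF ed.
move=> E.
have -> : dot v v = ((v *m F^T) *m diag_mx e *m (v *m F^T)^T) 0 0.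
  by rewrite dotE trmx_mul trmxK -[X in X *m v^T]mulmx1 -E !mulmxA.
rewrite mxE; apply: eq_bigr => i _.
have -> : (v *m F^T)^T i 0 = dot v (row i F).
  by rewrite !mxE; apply: eq_bigr => l _; rewrite !mxE.
have -> : (v *m F^T *m diag_mx e) 0 i = dot v (row i F) / d 0 i.
  by rewrite mul_mx_diag !mxE; congr (_ / _); apply: eq_bigr => l _; rewrite !mxE.
by rewrite expr2 mulrAC.
Qed.

Lemma det_frame_sqr X N p : conformal_at X p -> (forall s t, dot (N s p) (N t p) = (s == t)%:R) ->
  (forall s i, dot (N s p) (vpd i X p) = 0) -> \det (frame_mx X N p) ^+ 2 = area X p ^+ 2.
Proof.
move=> cX NN NX; have := congr1 determinant (gram_frame cX NN NX).
rewrite det_mulmx det_tr -expr2 => ->; rewrite det_diag /gram_diag big_split_ord/=.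
rewrite [X in _ * X]big1 ?mulr1; last by move=> i _; rewrite row_mxEr mxE.
by under eq_bigr do rewrite row_mxEl mxE; rewrite prodr_const card_ord.
Qed.

Lemma frame_expansion X N p v : conformal_at X p -> normal_frame_at X N p ->
  dot v v = \sum_(j < 2) dot v (vpd j X p) ^+ 2 / area X p + \sum_t dot v (N t p) ^+ 2.
Proof.
move=> cX [NN NX _]; rewrite (parseval (gram_frame cX NN NX) (fun i => gram_diag_gt0 i cX)) big_split_ord/=.
congr (_ + _); apply: eq_bigr => i _.
  by rewrite row_frame_l /gram_diag row_mxEl mxE.
by rewrite row_frame_r /gram_diag row_mxEr mxE divr1.
Qed.
End FrameAlgebra.

(** * Rotation of two members of a frame *)

Section Rotation.
Variables (R : realType) (n : nat) (s t : 'I_n).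
Hypothesis st : s != t.

(** The projection onto the plane of the basis vectors s and t, followed by its quarter turn [rotJ].
    They multiply like 1 and i, so [givens c z] acts on the plane as c + i z and is the identity on
    the complement. *)
Definition rotP : 'M[R]_n := delta_mx s s + delta_mx t t.
Definition rotJ : 'M[R]_n := delta_mx s t - delta_mx t s.
Definition givens (c z : R) : 'M[R]_n := 1%:M + (c - 1) *: rotP + z *: rotJ.

Lemma rotPP : rotP *m rotP = rotP.
Proof.
rewrite /rotP mulmxDl !mulmxDr !mul_delta_mx_cond !eqxx (negbTE st) eq_sym (negbTE st).
by rewrite !mulr0n !mulr1n addr0 add0r.
Qed.

Lemma rotPJ : rotP *m rotJ = rotJ.
Proof.
rewrite /rotP /rotJ mulmxDl !mulmxBr !mul_delta_mx_cond !eqxx (negbTE st) eq_sym (negbTE st).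
by rewrite !mulr0n !mulr1n subr0 sub0r.
Qed.

Lemma rotJP : rotJ *m rotP = rotJ.
Proof.
rewrite /rotP /rotJ mulmxBl !mulmxDr !mul_delta_mx_cond !eqxx (negbTE st) eq_sym (negbTE st).
by rewrite !mulr0n !mulr1n addr0 add0r.
Qed.

Lemma rotJJ : rotJ *m rotJ = - rotP.
Proof.
rewrite /rotP /rotJ mulmxBl !mulmxBr !mul_delta_mx_cond !eqxx (negbTE st) eq_sym (negbTE st).
by rewrite !mulr0n !mulr1n subr0 sub0r opprD.
Qed.

Lemma rotJ_tr : rotJ^T = - rotJ.
Proof. by rewrite /rotJ linearB/= !trmx_delta opprB. Qed.

Lemma rotP_tr : rotP^T = rotP.
Proof. by rewrite /rotP linearD/= !trmx_delta. Qed.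

Lemma givens_tr c z : (givens c z)^T = givens c (- z).
Proof.
rewrite /givens; move: rotP_tr rotJ_tr; move: rotP rotJ => P J PT JT.
by rewrite !linearD/= !linearZ/= trmx1 PT JT scalerN scaleNr.
Qed.

Lemma givens_mul c z c' z' : givens c z *m givens c' z' = givens (c * c' - z * z') (c * z' + z * c').
Proof.
rewrite /givens !mulmxDl !mulmxDr !mul1mx !mulmx1 -!scalemxAl -!scalemxAr rotPP rotPJ rotJP rotJJ.
rewrite !scalerN !scalerA; apply/matrixP => i j; rewrite !mxE.
ring.
Qed.

Lemma givens10 : givens 1 0 = 1%:M.
Proof. by rewrite /givens subrr !scale0r !addr0. Qed.

Lemma givens_orthogonal c z : c ^+ 2 + z ^+ 2 = 1 -> givens c z *m (givens c z)^T = 1%:M.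
Proof.
move=> h; have E1 : c * c - z * (- z) = 1 by rewrite -h; ring.
have E2 : c * (- z) + z * c = 0 by ring.
by rewrite givens_tr givens_mul E1 E2 givens10.
Qed.

(* A rotation is the square of the rotation by half the angle. *)
Lemma det_givens_gt0 (a : R) : 0 < \det (givens (cos a) (sin a)).
Proof.
have o : (cos (a / 2)) ^+ 2 + (sin (a / 2)) ^+ 2 = 1 by exact: cos2Dsin2.
have -> : givens (cos a) (sin a) = givens (cos (a / 2)) (sin (a / 2)) *m givens (cos (a / 2)) (sin (a / 2)).
  have aE : a / 2 + a / 2 = a by field.
  rewrite givens_mul; congr givens; first by rewrite -cosD aE.
  by rewrite addrC -sinD aE.
rewrite det_mulmx -expr2 lt_def sqr_ge0 andbT expf_neq0//.
have := congr1 determinant (givens_orthogonal o); rewrite det_mulmx det1 => /eqP.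
by apply: contraTneq => ->; rewrite mul0r eq_sym oner_eq0.
Qed.

Lemma givens_rotJ c z : givens c z *m rotJ = c *: rotJ - z *: rotP.
Proof.
rewrite /givens !mulmxDl mul1mx -!scalemxAl rotPJ rotJJ scalerN.
by apply/matrixP => i j; rewrite !mxE; ring.
Qed.

Lemma mxtrace_mul_delta (A : 'M[R]_n) i j : \tr (A *m delta_mx i j) = A j i.
Proof.
rewrite /mxtrace (bigD1 j)//= [X in _ + X]big1 ?addr0 => [|k kj]; rewrite mxE.
  rewrite (bigD1 i)//= big1 ?addr0 => [|l li]; first by rewrite mxE !eqxx mulr1.
  by rewrite mxE (negbTE li) mulr0.
by rewrite big1// => l _; rewrite mxE (negbTE kj) andbF mulr0.
Qed.

(* With N the matrix of a frame, V its derivative and [a] the derivative of the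
   angle, the product below is the derivative of the rotated frame. *)
Lemma energy_givens m (V N : 'M[R]_(n, m)) (c z a : R) : c ^+ 2 + z ^+ 2 = 1 -> N *m N^T = 1%:M ->
  let V' := givens c z *m (V + a *: (rotJ *m N)) in
  \tr (V' *m V'^T) = \tr (V *m V^T) + 2 * a * ((V *m N^T) s t - (V *m N^T) t s) + 2 * a ^+ 2.
Proof.
move=> h NN V'; have Rt : (givens c z)^T *m givens c z = 1%:M by apply: mulmx1C; exact: givens_orthogonal.
rewrite /V' trmx_mul mulmxA mxtrace_mulC !mulmxA Rt mul1mx.
have JT := rotJ_tr.
have -> : (V + a *: (rotJ *m N))^T = V^T + a *: (N^T *m rotJ^T).
  by rewrite linearD/= linearZ/= trmx_mul.
have -> : (V + a *: (rotJ *m N)) *m (V^T + a *: (N^T *m rotJ^T)) =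
    V *m V^T + a *: (V *m N^T *m rotJ^T) + (a *: (V *m N^T *m rotJ^T)^T + a ^+ 2 *: (rotJ *m rotJ^T)).
  rewrite mulmxDl !mulmxDr -!scalemxAl -!scalemxAr scalerA -expr2 !mulmxA.
  by rewrite -(mulmxA rotJ N N^T) NN mulmx1 !trmx_mul !trmxK mulmxA.
rewrite !mxtraceD !mxtraceZ mxtrace_tr.
have -> : \tr (V *m N^T *m rotJ^T) = (V *m N^T) s t - (V *m N^T) t s.
  by rewrite JT opprB mulmxBr raddfB/= !mxtrace_mul_delta.
have -> : \tr (rotJ *m rotJ^T) = 2.
  by rewrite JT mulmxN rotJJ opprK /rotP mxtraceD -[delta_mx s s]mul1mx -[delta_mx t t]mul1mx !mxtrace_mul_delta !mxE !eqxx.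
ring.
Qed.
End Rotation.

(** * Weakly differentiable vector fields *)

Section WeakFields.
Variable R : realType.
Local Notation D := (@disc R).
Local Notation plane := (measurableTypeR R * measurableTypeR R)%type.
Local Notation m2 := (leb2 R).
Implicit Types (f g : R * R -> R) (i : 'I_2) (p q : R * R).
Let mD : measurable (D : set plane) := @measurable_disc R.

Lemma Rintegral_sum_fin d (T : measurableType d) (m : {measure set T -> \bar R}) (A : set T)
  (I : Type) (r : seq I) (F : I -> T -> R) : measurable A ->
  (forall k, m.-integrable A (EFin \o F k)) ->
  m.-integrable A (EFin \o (fun x => \sum_(k <- r) F k x)) /\
  \int[m]_(x in A) (\sum_(k <- r) F k x) = \sum_(k <- r) \int[m]_(x in A) F k x.
Proof.
move=> mA Fi; elim: r => [|k r [IH1 IH2]].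
  rewrite big_nil; under [X in EFin \o X]funext do rewrite big_nil.
  by under eq_Rintegral do rewrite big_nil; split; [exact: integrable0|rewrite Rintegral_cst// mul0r].
rewrite big_cons; under [X in EFin \o X]funext do rewrite big_cons.
under eq_Rintegral do rewrite big_cons.
by split; [exact: integrable_RD|rewrite RintegralD// IH2].
Qed.

Lemma sqint_sum (I : Type) (r : seq I) (F : I -> R * R -> R) :
  (forall k, sqint (F k)) -> sqint (fun p => \sum_(k <- r) F k p).
Proof.
move=> sF; elim: r => [|k r IH].
  by under [X in sqint X]funext do rewrite big_nil; exact: sqint_cst.
by under [X in sqint X]funext do rewrite big_cons; exact: sqintD.
Qed.

Lemma Lp_disc_bounded f (C : R) : measurable_fun (D : set plane) f ->
  {ae m2, forall p, D p -> `|f p| <= C} -> Lp_disc +oo%E f.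
Proof.
move=> mf fC; rewrite /Lp_disc inE; apply/andP; split; rewrite inE/=.
  exact/(measurable_restrictT f mD).
rewrite /finite_norm unlock; case: ifPn => // _.
apply: (@le_lt_trans _ _ (Num.max C 0)%:E); last by rewrite ltry.
apply/ess_supP; apply: aeS fC => p h /=; rewrite lee_fin patchE.
case: ifPn => [/set_mem Dp|_]; first by rewrite le_max h.
by rewrite normr0 le_max lexx orbT.
Qed.

Lemma weak_pdP i f : H12_disc f -> is_weak_pd i f (weak_pd i f).
Proof.
move=> [_ /(_ i) h].
by have := @xgetPex _ (cst 0 : R * R -> R) [set g | is_weak_pd i f g] h.
Qed.

Lemma test_fun_sqint i (phi : R * R -> R) : test_fun phi -> sqint phi /\ sqint (pd i phi).
Proof.
move=> tphi; have [rho [C [_ [_ [c1 c2]] bphi _]]] := test_funP i tphi.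
split; apply: (@sqint_bounded _ _ C); try by apply: open_continuous_measurable_plane => //; exact: open_disc.
  by apply: aeW => p Dp; exact: (bphi p Dp).1.
by apply: aeW => p Dp; exact: (bphi p Dp).2.
Qed.

Lemma is_weak_pd_ae i f f2 g : sqint f -> sqint f2 -> {ae m2, forall p, D p -> f p = f2 p} ->
  is_weak_pd i f g -> is_weak_pd i f2 g.
Proof.
move=> sf sf2 ff [sg h]; split => // phi tphi; rewrite -h//.
have [_ sp] := test_fun_sqint i tphi.
apply: ae_eq_Rintegral => //.
- by apply: measurable_funM; [case: sf2|case: sp].
- by apply: measurable_funM; [case: sf|case: sp].
- by apply: aeS ff => p e Dp; rewrite e.
Qed.

Lemma is_weak_pd_cst i (c : R) : is_weak_pd i (fun=> c) (fun=> 0).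
Proof.
apply: (weak_pd_classical (C := `|c|)) => p Dp; rewrite ?normr0//; exact: cvg_cst.
Qed.

Lemma is_weak_pd_sum i (I : Type) (r : seq I) (F F' : I -> R * R -> R) :
  (forall k, sqint (F k)) -> (forall k, is_weak_pd i (F k) (F' k)) ->
  is_weak_pd i (fun p => \sum_(k <- r) F k p) (fun p => \sum_(k <- r) F' k p).
Proof.
move=> sF wF; elim: r => [|k r IH].
  under [X in is_weak_pd _ X]funext do rewrite big_nil.
  by under [X in is_weak_pd _ _ X]funext do rewrite big_nil; exact: is_weak_pd_cst.
under [X in is_weak_pd _ X]funext do rewrite big_cons.
under [X in is_weak_pd _ _ X]funext do rewrite big_cons.
by apply: is_weak_pdD => //; exact: sqint_sum.
Qed.

Variable n : nat.
Local Notation vec := 'rV[R]_(2 + n).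
Implicit Types (u v : R * R -> vec).

Definition weak_field i u u' := forall l,
  [/\ measurable_fun (D : set plane) (entry u l),
      exists C, {ae m2, forall p, D p -> `|entry u l p| <= C} &
      is_weak_pd i (entry u l) (entry u' l)].

Lemma weak_field_sqint i u u' l : weak_field i u u' -> sqint (entry u l) /\ sqint (entry u' l).
Proof.
move=> /(_ l)[mu_ [C uC] [/Lp_disc2P su' _]]; split => //; exact: sqint_bounded mu_ uC.
Qed.

Lemma sqint_dot i u u' j v v' : weak_field i u u' -> weak_field j v v' ->
  sqint (fun p => dot (u' p) (v p)).
Proof.
move=> wu wv; apply: sqint_sum => l.
have [_ su'] := weak_field_sqint l wu; have [mv [C vC] _] := wv l.
exact: (sqint_mul_bounded su' mv vC).
Qed.

Lemma sqint_dot0 i u u' j v v' : weak_field i u u' -> weak_field j v v' ->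
  sqint (fun p => dot (u p) (v p)).
Proof.
move=> wu wv; apply: sqint_sum => l.
have [su _] := weak_field_sqint l wu; have [mv [C vC] _] := wv l.
exact: (sqint_mul_bounded su mv vC).
Qed.

Lemma is_weak_pd_dot i u u' v v' : weak_field i u u' -> weak_field i v v' ->
  is_weak_pd i (fun p => dot (u p) (v p)) (fun p => dot (u' p) (v p) + dot (v' p) (u p)).
Proof.
move=> wu wv.
have -> : (fun p => dot (u' p) (v p) + dot (v' p) (u p)) =
   (fun p => \sum_l (entry u' l p * entry v l p + entry v' l p * entry u l p)).
  by apply/funext => p; rewrite /dot -big_split.
apply: is_weak_pd_sum => l.
  have [su _] := weak_field_sqint l wu; have [mv [C vC] _] := wv l.
  exact: (sqint_mul_bounded su mv vC).
have [mu_ [C uC] pu] := wu l; have [mv [K vK] pv] := wv l.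
exact: (weak_pdM mu_ mv uC vK pu pv).
Qed.

(** The Leibniz rule and uniqueness of the weak derivative. Applied to N_s . N_t it gives the
    antisymmetry of the torsion, applied to N_s . X_j the tangential part of the derivative of
    N_s. *)
Lemma weak_dot_const i u u' v v' (c : R) : weak_field i u u' -> weak_field i v v' ->
  {ae m2, forall p, D p -> dot (u p) (v p) = c} ->
  {ae m2, forall p, D p -> dot (u' p) (v p) = - dot (v' p) (u p)}.
Proof.
move=> wu wv uv; have suv := sqint_dot0 wu wv.
have w1 := is_weak_pd_ae suv (@sqint_cst R c) uv (is_weak_pd_dot wu wv).
apply: aeS (weak_pd_unique (@sqint_cst R c) w1 (is_weak_pd_cst i c)) => p h Dp.
by apply/eqP; rewrite -addr_eq0 h.
Qed.
End WeakFields.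

Section WeakFrame.
Variables (R : realType) (n : nat).
Local Notation vec := 'rV[R]_(2 + n).
Local Notation D := (@disc R).
Local Notation plane := (measurableTypeR R * measurableTypeR R)%type.
Local Notation m2 := (leb2 R).
Let mD : measurable (D : set plane) := @measurable_disc R.
Variable X : R * R -> vec.
Hypothesis cX : forall p, D p -> conformal_at X p.
Hypothesis wX : forall i j, weak_field i (vpd j X) (vpd i (vpd j X)).
Implicit Types (N : 'I_n -> R * R -> vec) (i : 'I_2).

Lemma frame_entry_le1 N p s l : normal_frame_at X N p -> `|entry (N s) l p| <= 1.
Proof.
move=> [NN _ _]; have h : N s p 0 l * N s p 0 l + \sum_(k | k != l) N s p 0 k * N s p 0 k = 1.
  by have := NN s s; rewrite eqxx /dot (bigD1 l).
rewrite -(@ler_sqr _ `|_|) ?nnegrE// real_normK ?num_real// expr1n -[leRHS]h expr2 lerDl.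
by apply: sumr_ge0 => k _; rewrite -expr2 sqr_ge0.
Qed.

Lemma weak_field_frame N s i : weak_normal_frame X N -> weak_field i (N s) (vweak_pd i (N s)).
Proof.
move=> [hN fN] l; have [hl _] := hN s l; have [/Lp_disc2P [ml _] _] := hl; split => //.
  by exists 1; apply: aeS fN => p h Dp; apply: frame_entry_le1; exact: h.
have -> : entry (vweak_pd i (N s)) l = weak_pd i (entry (N s) l).
  by apply/funext => p; rewrite /entry mxE.
exact: weak_pdP.
Qed.

Lemma torsion_antisym N s t i : weak_normal_frame X N ->
  {ae m2, forall p, D p -> torsion N s t i p = - torsion N t s i p}.
Proof.
move=> wN; apply: (weak_dot_const (c := (s == t)%:R) (weak_field_frame s i wN) (weak_field_frame t i wN)).
by case: wN => _; apply: aeS => p h Dp; case: (h Dp).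
Qed.

Lemma sqint_torsion N s t i : weak_normal_frame X N -> sqint (torsion N s t i).
Proof. by move=> wN; exact: (sqint_dot (weak_field_frame s i wN) (weak_field_frame t i wN)). Qed.

(** The squared length of the normal part of d_i d_j X, divided by W and summed over j. *)
Definition curvature i p := \sum_(j < 2) (dot (vpd i (vpd j X) p) (vpd i (vpd j X) p) -
  \sum_(k < 2) dot (vpd i (vpd j X) p) (vpd k X p) ^+ 2 / area X p) / area X p.

(** Parseval is used twice: for d_i N_s it separates the torsion from the tangential part, and for
    d_i d_j X it expresses the sum of the (d_i d_j X . N_s)^2 through X alone. *)
Lemma weak_frame_density N i : weak_normal_frame X N ->
  {ae m2, forall p, D p -> \sum_s dot (vweak_pd i (N s) p) (vweak_pd i (N s) p) -
     \sum_s \sum_t torsion N s t i p ^+ 2 = curvature i p}.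
Proof.
move=> wN; have fN := wN.2.
have normal : {ae m2, forall p, forall s j, D p -> dot (vweak_pd i (N s) p) (vpd j X p) = - dot (vpd i (vpd j X) p) (N s p)}.
  have : {ae m2, forall p, forall z : 'I_n * 'I_2, D p -> dot (vweak_pd i (N z.1) p) (vpd z.2 X p) = - dot (vpd i (vpd z.2 X) p) (N z.1 p)}.
    apply: ae_forall_count => -[s j] /=.
    apply: (weak_dot_const (c := 0) (weak_field_frame s i wN) (wX i j)).
    by apply: aeS fN => p h Dp; case: (h Dp).
  by apply: aeS => p h s j; exact: (h (s, j)).
apply: aeS (aeI fN normal) => p [h1 h2] Dp.
have fp := h1 Dp; have cp := cX Dp.
rewrite (eq_bigr (fun s => \sum_(j < 2) dot (vpd i (vpd j X) p) (N s p) ^+ 2 / area X p + \sum_t torsion N s t i p ^+ 2)); last first.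
  move=> s _; rewrite (frame_expansion _ cp fp); congr (_ + _).
  by apply: eq_bigr => j _; rewrite h2// sqrrN.
rewrite big_split/= addrK exchange_big/=; apply: eq_bigr => j _.
by rewrite (frame_expansion (vpd i (vpd j X) p) cp fp) [X in (X - _) / _]addrC addrK mulr_suml.
Qed.

Definition wgrad N (c : 'I_n * 'I_(2 + n)) i := weak_pd i (entry (N c.1) c.2).

Definition rtorsion N : R := \sum_(i < 2) \sum_(s < n) \sum_(t < n) \int[m2]_(p in D) (torsion N s t i p ^+ 2).

Lemma total_torsionE N : weak_normal_frame X N -> total_torsion N = (rtorsion N)%:E.
Proof.
move=> wN; rewrite /total_torsion /rtorsion -sumEFin; apply: eq_bigr => i _.
rewrite -sumEFin; apply: eq_bigr => s _; rewrite -sumEFin; apply: eq_bigr => t _.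
by rewrite EFin_Rintegral//; case: (sqint_torsion s t i wN).
Qed.

Lemma energy_density (g : 'I_n * 'I_(2 + n) -> 'I_2 -> R * R -> R) : (forall c i, sqint (g c i)) ->
  energy g = \sum_(i < 2) \int[m2]_(p in D) (\sum_s \sum_l g (s, l) i p ^+ 2) /\
  forall i, m2.-integrable D (EFin \o (fun p => \sum_s \sum_l g (s, l) i p ^+ 2)).
Proof.
move=> sg; have h i : m2.-integrable D (EFin \o (fun p => \sum_s \sum_l g (s, l) i p ^+ 2)) /\
    \int[m2]_(p in D) (\sum_s \sum_l g (s, l) i p ^+ 2) = \sum_s \sum_l \int[m2]_(p in D) (g (s, l) i p ^+ 2).
  have h1 s := @Rintegral_sum_fin R _ _ m2 D _ (index_enum 'I_(2 + n)) (fun l p => g (s, l) i p ^+ 2) mD (fun l => (sg (s, l) i).2).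
  have [h2 h3] := @Rintegral_sum_fin R _ _ m2 D _ (index_enum 'I_n) _ mD (fun s => (h1 s).1).
  by split => //; rewrite h3; apply: eq_bigr => s _; case: (h1 s).
split; last by move=> i; case: (h i).
rewrite /energy -(pair_bigA _ (fun c i => \int[m2]_(p in D) (g c i p ^+ 2)))/= exchange_big/=.
apply: eq_bigr => i _; rewrite (h i).2.
by rewrite (pair_bigA _ (fun s l => \int[m2]_(p in D) (g (s, l) i p ^+ 2)))/=; apply: eq_bigr => -[].
Qed.

Lemma sqint_wgrad N c i : weak_normal_frame X N -> sqint (wgrad N c i).
Proof.
move=> wN; have [_ ] := weak_field_sqint c.2 (weak_field_frame c.1 i wN).
by rewrite (_ : entry _ _ = wgrad N c i)//; apply/funext => p; rewrite /entry mxE.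
Qed.

Lemma energy_torsion N N' : weak_normal_frame X N -> weak_normal_frame X N' ->
  energy (wgrad N) - rtorsion N = energy (wgrad N') - rtorsion N'.
Proof.
have step M : weak_normal_frame X M -> (forall i, m2.-integrable D (EFin \o (fun p => \sum_s dot (vweak_pd i (M s) p) (vweak_pd i (M s) p) -
     \sum_s \sum_t torsion M s t i p ^+ 2))) /\ energy (wgrad M) - rtorsion M = \sum_(i < 2) \int[m2]_(p in D)
     (\sum_s dot (vweak_pd i (M s) p) (vweak_pd i (M s) p) - \sum_s \sum_t torsion M s t i p ^+ 2).
  move=> wM; have [-> h2] := energy_density (fun c i => sqint_wgrad c i wM).
  have E i : (fun p => \sum_s dot (vweak_pd i (M s) p) (vweak_pd i (M s) p)) = (fun p => \sum_s \sum_l wgrad M (s, l) i p ^+ 2).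
    by apply/funext => p; apply: eq_bigr => s _; apply: eq_bigr => l _; rewrite /wgrad !mxE expr2.
  have i1 i s := @Rintegral_sum_fin R _ _ m2 D _ (index_enum 'I_n) (fun t p => torsion M s t i p ^+ 2) mD (fun t => (sqint_torsion s t i wM).2).
  have i2 i := @Rintegral_sum_fin R _ _ m2 D _ (index_enum 'I_n) _ mD (fun s => (i1 i s).1).
  have h2' i : m2.-integrable D (EFin \o (fun p => \sum_s dot (vweak_pd i (M s) p) (vweak_pd i (M s) p))) by rewrite E.
  split; first by move=> i; exact: (integrable_RB mD (h2' i) (i2 i).1).
  rewrite /rtorsion -sumrB; apply: eq_bigr => i _.
  rewrite (RintegralB mD (h2' i) (i2 i).1) E; congr (_ - _).
  by rewrite (i2 i).2; apply: eq_bigr => s _; rewrite (i1 i s).2.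
move=> wN wN'; have [m1 e1] := step N wN; have [m3 e3] := step N' wN'.
apply: (eq_trans e1); apply: (eq_trans _ (esym e3)).
apply: eq_bigr => i _; apply: ae_eq_Rintegral => //.
- by apply/measurable_EFinP; exact: measurable_int (m1 i).
- by apply/measurable_EFinP; exact: measurable_int (m3 i).
- by apply: aeS (aeI (weak_frame_density i wN) (weak_frame_density i wN')) => p [h1 h2] Dp; rewrite h1// h2.
Qed.
End WeakFrame.

(** * Variation of the energy and the weak Euler-Lagrange equations *)

Section EulerLagrange.
Variables (R : realType) (n : nat).
Local Notation vec := 'rV[R]_(2 + n).
Local Notation D := (@disc R).
Local Notation plane := (measurableTypeR R * measurableTypeR R)%type.
Local Notation m2 := (leb2 R).
Let mD : measurable (D : set plane) := @measurable_disc R.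
Implicit Types (X : R * R -> vec) (N : 'I_n -> R * R -> vec) (i : 'I_2) (phi : R * R -> R).

(** Makes the energy independent of the representative chosen by [weak_pd]. *)
Lemma energy_unique (I : finType) (f : I -> R * R -> R) (g h : I -> 'I_2 -> R * R -> R) :
  (forall c, sqint (f c)) -> (forall c i, is_weak_pd i (f c) (g c i)) ->
  (forall c i, is_weak_pd i (f c) (h c i)) -> energy g = energy h.
Proof.
move=> sf wg wh; apply: eq_bigr => -[c i] _ /=.
have [/Lp_disc2P sg _] := wg c i; have [/Lp_disc2P sh _] := wh c i.
apply: ae_eq_Rintegral => //.
- by apply: measurable_funX; case: sg.
- by apply: measurable_funX; case: sh.
by apply: aeS (weak_pd_unique (sf c) (wg c i) (wh c i)) => p e Dp; rewrite e.
Qed.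

Lemma is_weak_pd_comp i phi (h h' : R -> R) (K : R) : Ck_cdisc 1 phi ->
  (forall x, is_derive x (1 : R) h (h' x)) -> continuous h' ->
  (forall x, `|h x| <= K) -> (forall x, `|h' x| <= K) ->
  is_weak_pd i (fun p => h (phi p)) (fun p => h' (phi p) * pd i phi p).
Proof.
move=> sphi dh ch hK h'K; have [cphi /(_ i)[dphi [cpd _]]] := sphi.
have [C C0 bpd] := within_cdisc_bounded cpd.
have K0 : 0 <= K by apply: le_trans (hK 0); exact: normr_ge0.
apply: (weak_pd_classical (C := K + K * C)) => p Dp.
- have d1 := dphi p Dp; have [x [y pE]] := pt_surj i p; rewrite pE in d1 *; apply/is_derive_ptP.
  exact: (@is_derive1_comp _ h (fun t => phi (pt i t y)) x _ _ (dh _) ((is_derive_ptP _ _ _ _ _).1 d1)).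
- apply: (@continuous_comp _ _ _ phi h); first exact: within_cdisc_continuous.
  exact: (is_derive_continuous dh).
- apply: continuousM; last exact: within_cdisc_continuous.
  by apply: (@continuous_comp _ _ _ phi h'); [exact: within_cdisc_continuous|exact: ch].
- by apply: le_trans (hK _) _; rewrite lerDl mulr_ge0.
- rewrite normrM; apply: (@le_trans _ _ (K * C)); last by rewrite lerDr.
  by rewrite ler_pM//; apply: bpd; exact: subset_closure.
Qed.

Lemma rotate_frame_at X N (B : 'M[R]_n) p : normal_frame_at X N p -> B *m B^T = 1%:M -> 0 < \det B ->
  normal_frame_at X (fun u p => row u (B *m \matrix_v N v p)) p.
Proof.
move=> [NN NX dN] BB dB; have NN1 : (\matrix_v N v p) *m (\matrix_v N v p)^T = 1%:M :> 'M[R]_n.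
  by apply/matrixP => u v; rewrite mul_tr_row !rowK NN mxE.
split.
- move=> u v; rewrite -mul_tr_row trmx_mul mulmxA -(mulmxA B) NN1 mulmx1 BB.
  by rewrite mxE.
- move=> u i; rewrite dotE -row_mul mxE -mulmxA mxE big1// => v _.
  have -> : ((\matrix_v N v p) *m (vpd i X p)^T) v 0 = dot (N v p) (vpd i X p).
    by rewrite dotE !mxE; apply: eq_bigr => l _; rewrite !mxE.
  by rewrite NX mulr0.
have -> : frame_mx X (fun u p => row u (B *m \matrix_v N v p)) p = block_mx 1%:M 0 0 B *m frame_mx X N p.
  rewrite /frame_mx mul_block_col mul1mx !mul0mx addr0 add0r; congr col_mx.
  by apply/row_matrixP => u; rewrite rowK.
by rewrite det_mulmx det_ublock det1 mul1r mulr_gt0.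
Qed.

Variable X : R * R -> vec.
Section Rotated.
Variables (N : 'I_n -> R * R -> vec) (s t : 'I_n) (phi : R * R -> R) (e : R).
Hypotheses (wN : weak_normal_frame X N) (st : s != t) (sphi : Ck_cdisc 1 phi).

Let B p := givens s t (cos (e * phi p)) (sin (e * phi p)).
Let Nm p : 'M[R]_(n, 2 + n) := \matrix_v N v p.
Let Vm i p : 'M[R]_(n, 2 + n) := \matrix_v vweak_pd i (N v) p.
Let N' u p := row u (B p *m Nm p).
(** For the rotation B by the angle e phi one has d_i B = e (d_i phi) B J, so the derivative of B N
    is B (d_i N + e (d_i phi) J N). *)
Let g' (c : 'I_n * 'I_(2 + n)) i p :=
  (B p *m (Vm i p + (e * pd i phi p) *: (rotJ R s t *m Nm p))) c.1 c.2.

Let derive_scale x : is_derive x (1 : R) (fun x => e * x) e.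
Proof.
have -> : (fun x => e * x) = (e \*: (id : R -> R)) :> (R -> R) by [].
by apply: is_derive_eq; rewrite /GRing.scale /= mulr1.
Qed.

Lemma rotation_bounded (c z : R) : c ^+ 2 + z ^+ 2 = 1 -> `|c| <= 1 /\ `|z| <= 1.
Proof.
move=> h; have := sqr_ge0 c; have := sqr_ge0 z => h1 h2.
rewrite -(@ler_sqr _ `|c|) ?nnegrE// -(@ler_sqr _ `|z|) ?nnegrE// !real_normK ?num_real// expr1n.
by split; lra.
Qed.

Lemma weak_rotation u v i :
  [/\ measurable_fun (D : set plane) (fun p => B p u v), exists C, {ae m2, forall p, D p -> `|B p u v| <= C} &
      is_weak_pd i (fun p => B p u v) (fun p => (e * pd i phi p) * (B p *m rotJ R s t) u v)].
Proof.
have cphi := within_cdisc_continuous sphi.1.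
have b1 x : `|cos (e * x)| <= 1 + `|e| /\ `|sin (e * x)| <= 1 + `|e|.
  have [h1 h2] := rotation_bounded (cos2Dsin2 (e * x)).
  by split; [apply: le_trans h1 _|apply: le_trans h2 _]; rewrite lerDl.
have b2 x : `|- sin (e * x) * e| <= 1 + `|e| /\ `|cos (e * x) * e| <= 1 + `|e|.
  have [h1 h2] := rotation_bounded (cos2Dsin2 (e * x)); rewrite !normrM normrN.
  by split; apply: (@le_trans _ _ `|e|); rewrite ?ler_piMl// lerDr.
have wc : is_weak_pd i (fun p => cos (e * phi p)) (fun p => - sin (e * phi p) * e * pd i phi p).
  apply: (@is_weak_pd_comp i phi (fun x => cos (e * x)) (fun x => - sin (e * x) * e) (1 + `|e|)) => //.
  - by move=> x; exact: (@is_derive1_comp _ (@cos R) (fun x => e * x)).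
  - move=> x; apply: (@continuousM _ _ (fun x => - sin (e * x)) (cst e)); last exact: cvg_cst.
    apply: continuousN; apply: (@continuous_comp _ _ _ (fun x => e * x) (@sin R)); last exact: continuous_sin.
    exact: (is_derive_continuous derive_scale).
  - by move=> x; case: (b1 x).
  - by move=> x; case: (b2 x).
have wz : is_weak_pd i (fun p => sin (e * phi p)) (fun p => cos (e * phi p) * e * pd i phi p).
  apply: (@is_weak_pd_comp i phi (fun x => sin (e * x)) (fun x => cos (e * x) * e) (1 + `|e|)) => //.
  - by move=> x; exact: (@is_derive1_comp _ (@sin R) (fun x => e * x)).
  - move=> x; apply: (@continuousM _ _ (fun x => cos (e * x)) (cst e)); last exact: cvg_cst.
    apply: (@continuous_comp _ _ _ (fun x => e * x) (@cos R)); last exact: continuous_cos.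
    exact: (is_derive_continuous derive_scale).
  - by move=> x; case: (b1 x).
  - by move=> x; case: (b2 x).
have mh (h : R -> R) : continuous h -> measurable_fun (D : set plane) (fun p => h (e * phi p)).
  move=> ch; apply: open_continuous_measurable_plane; first exact: open_disc.
  move=> p Dp; apply: (@continuous_comp _ _ _ phi (fun x => h (e * x))); first exact: cphi.
  apply: (@continuous_comp _ _ _ (fun x => e * x) h); last exact: ch.
  exact: (is_derive_continuous derive_scale).
have mc := mh _ (@continuous_cos R); have mz := mh _ (@continuous_sin R).
have sc : sqint (fun p => cos (e * phi p)) by apply: sqint_bounded mc _; apply: aeW => p _; exact: (b1 (phi p)).1.
have sz : sqint (fun p => sin (e * phi p)) by apply: sqint_bounded mz _; apply: aeW => p _; exact: (b1 (phi p)).2.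
pose a : R := rotP R s t u v; pose b : R := rotJ R s t u v.
(* Each entry is an affine combination of the cosine and the sine of the angle, so the two scalar
   chain rules suffice. *)
have BE : (fun p => B p u v) = (fun p => ((u == v)%:R - a) + (a * cos (e * phi p) + b * sin (e * phi p))).
  apply/funext => p; rewrite /B /givens /a /b; move: (rotP R s t) (rotJ R s t) => P J.
  by rewrite !mxE; ring.
have E' : (fun p => (e * pd i phi p) * (B p *m rotJ R s t) u v) =
    (fun p => 0 + (a * (- sin (e * phi p) * e * pd i phi p) + b * (cos (e * phi p) * e * pd i phi p))).
  apply/funext => p; rewrite /B givens_rotJ// /a /b; move: (rotP R s t) (rotJ R s t) => P J.
  by rewrite !mxE; ring.
split.
- by rewrite BE; apply: measurable_funD => //; apply: measurable_funD; exact: measurable_funM.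
- exists (`|(u == v)%:R - a| + (`|a| * (1 + `|e|) + `|b| * (1 + `|e|))); apply: aeW => p _.
  have := congr1 (fun h => h p) BE => /= ->; apply: le_trans (ler_normD _ _) _; rewrite lerD2l.
  apply: le_trans (ler_normD _ _) _; rewrite !normrM.
  by apply: lerD; rewrite ler_wpM2l//; case: (b1 (phi p)).
rewrite BE E'; apply: is_weak_pdD.
- exact: sqint_cst.
- by apply: sqintD; exact: sqintZ.
- exact: is_weak_pd_cst.
- by apply: is_weak_pdD; [exact: sqintZ|exact: sqintZ|exact: is_weak_pdZ|exact: is_weak_pdZ].
Qed.

Lemma weak_rotated_frame u l i : measurable_fun (D : set plane) (entry (N' u) l) /\
  is_weak_pd i (entry (N' u) l) (g' (u, l) i).
Proof.
have eE : entry (N' u) l = (fun p => \sum_v B p u v * N v p 0 l).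
  by apply/funext => p; rewrite /entry /N' [LHS]mxE [LHS]mxE; apply: eq_bigr => v _; rewrite [X in _ * X]mxE.
have gE : g' (u, l) i = (fun p => \sum_v ((e * pd i phi p) * (B p *m rotJ R s t) u v * N v p 0 l + entry (vweak_pd i (N v)) l p * B p u v)).
  apply/funext => p; rewrite /g' mulmxDr -scalemxAr mulmxA [LHS]mxE [X in _ + X]mxE [X in X + _]mxE [X in _ + _ * X]mxE.
  rewrite mulr_sumr addrC -big_split/=; apply: eq_bigr => v _.
  by rewrite /Nm /Vm ![(\matrix_v _) _ _]mxE mulrA; congr (_ + _); rewrite mulrC.
have wf v := weak_field_frame v i wN.
rewrite eE gE; split.
  have ms v : sqint (fun p => B p u v * N v p 0 l).
    have [mB [C BC] _] := weak_rotation u v i; have [mN [K NK] _] := wf v l.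
    have sB := sqint_bounded mB BC.
    exact: (sqint_mul_bounded sB mN NK).
  by case: (@sqint_sum R _ (index_enum 'I_n) _ ms).
apply: is_weak_pd_sum => v.
  have [mB [C BC] _] := weak_rotation u v i; have [mN [K NK] _] := wf v l.
  have sB := sqint_bounded mB BC.
  exact: (sqint_mul_bounded sB mN NK).
have [mB [C BC] wB] := weak_rotation u v i; have [mN [K NK] wNl] := wf v l.
exact: (weak_pdM mB mN BC NK wB wNl).
Qed.

Lemma rotated_frame : weak_normal_frame X N'.
Proof.
have fN' : {ae m2, forall p, D p -> normal_frame_at X N' p}.
  apply: aeS wN.2 => p h Dp; apply: (rotate_frame_at (h Dp)).
    by apply: givens_orthogonal => //; exact: cos2Dsin2.
  exact: det_givens_gt0.
have b1 u l : {ae m2, forall p, D p -> `|entry (N' u) l p| <= 1}.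
  by apply: aeS fN' => p h Dp; apply: (frame_entry_le1 _ _ (h Dp)).
split => // u l; split; last first.
  by apply: (@Lp_disc_bounded R _ 1) => //; case: (weak_rotated_frame u l 0).
split; last by move=> i; exists (g' (u, l) i); case: (weak_rotated_frame u l i).
by apply/Lp_disc2P; apply: (@sqint_bounded R _ 1) => //; case: (weak_rotated_frame u l 0).
Qed.

Lemma energy_rotated : energy (wgrad N') = energy (wgrad N) +
  (e * (2 * \sum_(i < 2) \int[m2]_(p in D) (pd i phi p * (torsion N s t i p - torsion N t s i p))) +
   e ^+ 2 * (2 * \sum_(i < 2) \int[m2]_(p in D) (pd i phi p ^+ 2))).
Proof.
have wr := rotated_frame.
have -> : energy (wgrad N') = energy g'.
  apply: (@energy_unique _ (fun c : 'I_n * 'I_(2 + n) => entry (N' c.1) c.2)).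
  - by move=> c; case: (weak_field_sqint c.2 (weak_field_frame c.1 0 wr)).
  - by move=> c i; apply: weak_pdP; case: (wr.1 c.1 c.2).
  - by move=> -[u l] i; case: (weak_rotated_frame u l i).
have sg' c i : sqint (g' c i).
  by case: c => u l; have [_ [/Lp_disc2P]] := weak_rotated_frame u l i.
have [-> ig'] := energy_density sg'.
have [-> ig] := energy_density (fun c i => sqint_wgrad c i wN).
rewrite !mulr_sumr -!big_split/=; apply: eq_bigr => i _.
have [cp /(_ i)[_ [cpd _]]] := sphi.
have [C C0 bpd] := within_cdisc_bounded cpd.
have mpd : measurable_fun (D : set plane) (pd i phi).
  apply: open_continuous_measurable_plane; first exact: open_disc.
  exact: within_cdisc_continuous.
have spd : sqint (pd i phi).
  by apply: (@sqint_bounded R _ C) => //; apply: aeW => p Dp; apply: bpd; exact: subset_closure.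
have sT := sqintB (sqint_torsion s t i wN) (sqint_torsion t s i wN).
have i1 := sqint_mul spd sT.
have i2 := @integrable_RZ _ _ _ m2 D _ (e * 2) mD i1.
have i3 := @integrable_RZ _ _ _ m2 D _ (e ^+ 2 * 2) mD spd.2.
have i4 := integrable_RD mD i2 i3.
rewrite !mulrA -(RintegralZl _ mD i1) -(RintegralZl _ mD spd.2) -(RintegralD mD i2 i3) -(RintegralD mD (ig i) i4).
apply: ae_eq_Rintegral => //.
- by apply/measurable_EFinP; exact: measurable_int (ig' i).
- by apply/measurable_EFinP; exact: measurable_int (integrable_RD mD (ig i) i4).
apply: aeS wN.2 => p h Dp; have [NN _ _] := h Dp.
have NN1 : Nm p *m (Nm p)^T = 1%:M by apply/matrixP => u v; rewrite mul_tr_row !rowK NN mxE.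
have trE (A : 'M[R]_(n, 2 + n)) : \tr (A *m A^T) = \sum_u \sum_l A u l ^+ 2.
  by apply: eq_bigr => u _; rewrite mxE; apply: eq_bigr => l _; rewrite mxE expr2.
have := energy_givens st (Vm i p) (e * pd i phi p) (cos2Dsin2 (e * phi p)) NN1.
rewrite /= !trE !mul_tr_row !rowK -/(B p) => ->.
rewrite /torsion -!addrA; congr (_ + _); last by ring.
by apply: eq_bigr => u _; apply: eq_bigr => l _; rewrite /wgrad !mxE.
Qed.
End Rotated.

(** Testing with e = z and e = - z for z = d / (1 + |b|) gives |a| <= z |b| <= d for every d > 0;
    the summand 1 covers b = 0. *)
Lemma quadratic_ge0_eq0 (a b : R) : (forall e, 0 <= e * a + e ^+ 2 * b) -> a = 0.
Proof.
move=> h; apply/eqP; rewrite -normr_le0; apply/ler_addgt0Pl => d d0; rewrite addr0.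
have b1 : 0 < 1 + `|b| by rewrite ltr_wpDr.
have z0 : 0 < d / (1 + `|b|) by rewrite divr_gt0.
set z := d / (1 + `|b|) in z0 *.
have zb : z * `|b| <= d by rewrite /z mulrAC ler_pdivrMr// ler_pM2l// lerDr.
have h1 := h z; have h2 := h (- z).
have hb : z * b <= z * `|b| by rewrite ler_pM2l// ler_norm.
rewrite ler_norml; apply/andP; split.
  have : 0 <= a + z * b by rewrite -(pmulr_rge0 _ z0); move: h1; rewrite expr2; congr (_ <= _); ring.
  by lra.
have : 0 <= - a + z * b by rewrite -(pmulr_rge0 _ z0); move: h2; rewrite expr2; congr (_ <= _); ring.
by lra.
Qed.

Lemma sum_ord2 (F : 'I_2 -> R) : \sum_(i < 2) F i = F 0 + F 1.
Proof. by rewrite !big_ord_recl big_ord0 addr0; congr (F _ + F _); exact: val_inj. Qed.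

Lemma euler_lagrange N : weak_normal_frame X N ->
  (forall N', weak_normal_frame X N' -> energy (wgrad N) <= energy (wgrad N')) ->
  forall phi s t, smooth_cdisc phi ->
  \int[m2]_(p in D) (pd 0 phi p * torsion N s t 0 p + pd 1 phi p * torsion N s t 1 p) = 0.
Proof.
move=> wN minN phi s t /(_ 1%N) sphi.
have spd i : sqint (pd i phi).
  have [cp /(_ i)[_ [cpd _]]] := sphi.
  have [C C0 bpd] := within_cdisc_bounded cpd.
  apply: (@sqint_bounded R _ C); last by apply: aeW => p Dp; apply: bpd; exact: subset_closure.
  by apply: open_continuous_measurable_plane; [exact: open_disc|exact: within_cdisc_continuous].
have sT u v i := sqint_torsion u v i wN.
rewrite RintegralD//; [|exact: sqint_mul|exact: sqint_mul].
(* The first variation contains the antisymmetrized torsion, which is twice the torsion. *)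
have half i : \int[m2]_(p in D) (pd i phi p * (torsion N s t i p - torsion N t s i p)) =
    2 * \int[m2]_(p in D) (pd i phi p * torsion N s t i p).
  have i1 := sqint_mul (spd i) (sT s t i).
  rewrite -(RintegralZl _ mD i1); apply: ae_eq_Rintegral => //.
  - by apply: measurable_funM; [case: (spd i)|case: (sqintB (sT s t i) (sT t s i))].
  - by apply: measurable_funM => //; apply: measurable_funM; [case: (spd i)|case: (sT s t i)].
  apply: aeS (torsion_antisym t s i wN) => p h Dp; rewrite h//; ring.
have key : \sum_(i < 2) \int[m2]_(p in D) (pd i phi p * (torsion N s t i p - torsion N t s i p)) = 0.
  (* A rotation needs two distinct vectors; for s = t the difference is identically 0. *)
  have [->|st] := eqVneq s t.
    by apply: big1 => i _; under eq_Rintegral do rewrite subrr mulr0; rewrite Rintegral_cst// mul0r.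
  have : 2 * \sum_(i < 2) \int[m2]_(p in D) (pd i phi p * (torsion N s t i p - torsion N t s i p)) = 0.
    apply: (@quadratic_ge0_eq0 _ (2 * \sum_(i < 2) \int[m2]_(p in D) (pd i phi p ^+ 2))) => e.
    have := minN _ (rotated_frame e wN st sphi); rewrite (energy_rotated e wN st sphi) lerDl.
    by [].
  by move=> /eqP; rewrite mulf_eq0 pnatr_eq0/= => /eqP.
move: key; rewrite (sum_ord2 (fun i => \int[m2]_(p in D) (pd i phi p * (torsion N s t i p - torsion N t s i p)))).
move=> h; apply/eqP; rewrite -(@mulrI_eq0 _ (2 : R)); last by apply/lregP; rewrite pnatr_eq0.
by rewrite mulrDr; apply/eqP; exact: etrans (esym (f_equal2 +%R (half 0) (half 1))) h.
Qed.
End EulerLagrange.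

(** * Existence of a minimizer *)

Section Existence.
Variables (R : realType) (n : nat).
Local Notation vec := 'rV[R]_(2 + n).
Local Notation D := (@disc R).
Local Notation plane := (measurableTypeR R * measurableTypeR R)%type.
Local Notation m2 := (leb2 R).
Let mD : measurable (D : set plane) := @measurable_disc R.
Implicit Types (N : 'I_n -> R * R -> vec) (i : 'I_2) (p : R * R).

Lemma C1b_measurable (f : R * R -> R) : C1b f -> measurable_fun (D : set plane) f.
Proof.
move=> cf; apply: open_continuous_measurable_plane; first exact: open_disc.
exact: C1b_continuous.
Qed.

Lemma C1b_H12 (f : R * R -> R) : C1b f -> H12_disc f /\ Lp_disc +oo%E f.
Proof.
move=> cf; have [C C0 bf] := C1b_bounded cf; have mf := C1b_measurable cf.
have aef : {ae m2, forall p, D p -> `|f p| <= C} by exact: aeW.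
split; last exact: (Lp_disc_bounded mf aef).
split; first by apply/Lp_disc2P; exact: sqint_bounded mf aef.
by move=> i; have [g [K [wg _ _ _]]] := C1b_weak i cf; exists g.
Qed.

(** The last n rows of the orthogonal matrix P are normal to the surface. The determinant of P is 1
    or -1 at each point; multiplying the last row by it corrects the orientation, and it is as
    regular as P, being a polynomial in its entries. The lower bound c keeps the normalization of
    the tangent vectors regular up to the boundary. *)
Lemma exists_weak_normal_frame (X : R * R -> vec) (c : R) : (0 < n)%N -> 0 < c ->
  (forall p, D p -> conformal_at X p) -> (forall p, D p -> c <= area X p) ->
  (forall i, C1bmx (vpd i X)) -> exists N, weak_normal_frame X N.
Proof.
move=> n0 c0 cX cA cY.
have cS := C1b_dot (cY 0) (cY 0).
have s0 : 0 < Num.sqrt c by rewrite sqrtr_gt0.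
have cR : C1b (fun p => (Num.sqrt (area X p))^-1).
  apply: (C1bV s0); first by move=> p Dp; apply: ler_wsqrtr; exact: cA.
  exact: (C1b_sqrt c0 cA cS).
pose x i p : vec := (Num.sqrt (area X p))^-1 *: vpd i X p.
have cx i : C1bmx (x i) by exact: C1bmxZ.
have xx i j p : D p -> dot (x i p) (x j p) = (i == j)%:R.
  move=> Dp; have A0 : 0 < area X p by exact: lt_le_trans (cA p Dp).
  rewrite /x dotZl dotZr (dot_vpd i j (cX p Dp)) mulrA -invfM -expr2 sqr_sqrtr ?ltW//.
  by rewrite mulrnAr mulVf//; exact: lt0r_neq0.
have [P cP hP] : exists2 P : R * R -> 'M[R]_(2 + n), C1bmx P & forall p, D p ->
    [/\ P p *m (P p)^T = 1%:M, row (lshift n 0) (P p) = x 0 p & row (lshift n 1) (P p) = x 1 p].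
  by apply: regular_frame => // p Dp; split; rewrite xx.
have nl : (n.-1 < n)%N by rewrite prednK.
pose last : 'I_n := Ordinal nl.
pose sgn (u : 'I_n) p := if u == last then \det (P p) else 1.
pose N (u : 'I_n) p : vec := sgn u p *: row (rshift 2 u) (P p).
have cN u l : C1b (entry (N u) l).
  have -> : entry (N u) l = (fun p => sgn u p * P p (rshift 2 u) l).
    by apply/funext => p; rewrite /entry /N !mxE.
  apply: C1bM => //; rewrite /sgn; case: (u == last); [exact: C1b_det|exact: C1b_cst].
exists N; split; first by move=> u l; exact: C1b_H12.
apply: aeW => p Dp; have [PP P0 P1] := hP p Dp.
have A0 : 0 < area X p by exact: lt_le_trans (cA p Dp).
have sA0 : Num.sqrt (area X p) != 0 by rewrite gt_eqF// sqrtr_gt0.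
have det2 : \det (P p) * \det (P p) = 1 by rewrite -[X in _ * X]det_tr -det_mulmx PP det1.
have sgn2 u : sgn u p * sgn u p = 1 by rewrite /sgn; case: (u == last); rewrite ?det2 ?mulr1.
have rowE a b : dot (row a (P p)) (row b (P p)) = (a == b)%:R.
  by rewrite -mul_tr_row PP mxE.
have Yi i : vpd i X p = Num.sqrt (area X p) *: row (lshift n i) (P p).
  have -> : row (lshift n i) (P p) = x i p by case: (ord2P i) => ->.
  by rewrite /x scalerA (mulfV sA0) scale1r.
split.
- move=> u v; rewrite dotZl dotZr rowE (inj_eq (@rshift_inj _ _)).
  by have [->|_] := eqVneq u v; rewrite ?mulr1 ?sgn2// !mulr0.
- by move=> u i; rewrite Yi dotZl dotZr rowE eq_rlshift !mulr0.
(* The frame matrix is P with rescaled rows: the square root of W twice, then the signs. Its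
   determinant is W (det P)^2 = W. *)
pose d : vec := row_mx (const_mx (Num.sqrt (area X p))) (\row_u sgn u p).
have -> : frame_mx X N p = diag_mx d *m P p.
  apply/row_matrixP => i; rewrite -(splitK i); case: (fintype.split i) => a /=.
    rewrite row_frame_l Yi; apply/rowP => l.
    by rewrite [RHS]mxE mul_diag_mx [RHS]mxE row_mxEl !mxE.
  rewrite row_frame_r /N; apply/rowP => l.
  by rewrite [RHS]mxE mul_diag_mx [RHS]mxE row_mxEr !mxE.
rewrite det_mulmx det_diag big_split_ord/= (eq_bigr (fun=> Num.sqrt (area X p))); last first.
  by move=> i _; rewrite row_mxEl mxE.
rewrite prodr_const card_ord sqr_sqrtr ?ltW// (eq_bigr (sgn ^~ p)); last first.
  by move=> i _; rewrite row_mxEr mxE.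
rewrite (bigD1 last)//= big1 => [|u ul]; last by rewrite /sgn (negbTE ul).
by rewrite mulr1 {1}/sgn eqxx -mulrA det2 mulr1.
Qed.

Lemma normal_frame_limit (X : R * R -> vec) (N_ : nat -> 'I_n -> R * R -> vec) N p :
  conformal_at X p -> (forall k, normal_frame_at X (N_ k) p) ->
  (forall s l, N_ k s p 0 l @[k --> \oo] --> N s p 0 l) -> normal_frame_at X N p.
Proof.
move=> cX hN cN.
have csum (I : finType) (F_ : nat -> I -> R) (F : I -> R) : (forall j, F_ k j @[k --> \oo] --> F j) ->
    \sum_j F_ k j @[k --> \oo] --> \sum_j F j.
  by move=> h; apply: (@cvg_big _ _ +%R 0 xpredT) => //; exact: add_continuous.
have cprod (I : finType) (F_ : nat -> I -> R) (F : I -> R) : (forall j, F_ k j @[k --> \oo] --> F j) ->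
    \prod_j F_ k j @[k --> \oo] --> \prod_j F j.
  move=> h; apply: (@cvg_big R I (@GRing.mul R) 1 xpredT _ nat \oo (index_enum I) (fun j k => F_ k j) F) => //.
  exact: mul_continuous.
have NN s t : dot (N s p) (N t p) = (s == t)%:R.
  apply: (@cvg_cst_eq R (fun k => dot (N_ k s p) (N_ k t p))); last by move=> k; case: (hN k).
  by apply: csum => l; apply: cvgM; exact: cN.
have NX s i : dot (N s p) (vpd i X p) = 0.
  apply: (@cvg_cst_eq R (fun k => dot (N_ k s p) (vpd i X p))); last by move=> k; case: (hN k).
  by apply: csum => l; apply: cvgM; [exact: cN|exact: cvg_cst].
split => //.
have A0 : 0 < area X p by case: cX.
have entl M (a : 'I_2) l : frame_mx X M p (lshift n a) l = vpd a X p 0 l.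
  by rewrite -(row_frame_l X M p a) [RHS]mxE.
have entr M (a : 'I_n) l : frame_mx X M p (rshift 2 a) l = M a p 0 l.
  by rewrite -(row_frame_r X M p a) [RHS]mxE.
have cent (i l : 'I_(2 + n)) : frame_mx X (N_ k) p i l @[k --> \oo] --> frame_mx X N p i l.
  rewrite -(splitK i); case: (fintype.split i) => a /=.
    rewrite entl (_ : (fun k => _) = (fun=> vpd a X p 0 l)); first exact: cvg_cst.
    by apply/funext => k; rewrite entl.
  rewrite entr (_ : (fun k => _) = (fun k => N_ k a p 0 l)); first exact: cN.
  by apply/funext => k; rewrite entr.
have d0 : 0 <= \det (frame_mx X N p).
  have cd : \det (frame_mx X (N_ k) p) @[k --> \oo] --> \det (frame_mx X N p).
    apply: csum => s; apply: cvgM; first exact: cvg_cst.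
    by apply: cprod => i; exact: cent.
  by apply: (cvgr_to_ge cd); apply: nearW => k; case: (hN k) => _ _ /ltW.
have := det_frame_sqr cX NN NX => h; rewrite lt_def d0 andbT -sqrf_eq0 h sqrf_eq0.
by rewrite gt_eqF.
Qed.

(** The image of the compact closed disc under the positive continuous area is closed and misses 0,
    hence also a neighbourhood of 0. *)
Lemma area_lower_bound (X : R * R -> vec) : (forall l, {within @cdisc R, continuous (pd 0 (entry X l))}) ->
  (forall p, cdisc p -> 0 < area X p) -> exists2 c : R, 0 < c & forall p, cdisc p -> c <= area X p.
Proof.
move=> cX A0.
have cA : {within @cdisc R, continuous (area X)}.
  have -> : area X = (fun p => \sum_l pd 0 (entry X l) p * pd 0 (entry X l) p).
    by apply/funext => p; apply: eq_bigr => l _; rewrite !mxE.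
  move=> p; apply: (@cvg_big _ _ +%R 0 xpredT); first exact: add_continuous.
  by move=> l _; apply: cvgM; exact: cX.
have [e e0 he] : exists2 e : R, 0 < e & forall p, cdisc p -> e <= `|area X p|.
  have cl : closed (area X @` @cdisc R).
    apply: compact_closed; first exact: Rhausdorff.
    exact: continuous_compact cA (@compact_cdisc R).
  have : nbhs (0 : R) (~` (area X @` @cdisc R)).
    apply: open_nbhs_nbhs; split; first exact: closed_openC.
    by move=> [p cp h]; have := A0 p cp; rewrite h ltxx.
  move=> /nbhs_ballP[e e0 he]; exists e => // p cp; rewrite leNgt; apply/negP => h.
  by apply: (he (area X p)); [rewrite /ball/= sub0r normrN|exists p].
by exists e => // p cp; rewrite -[area X p]gtr0_norm ?A0// he.
Qed.

Lemma energy_term (I : finType) (g : I -> 'I_2 -> R * R -> R) c i :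
  \int[m2]_(p in D) (g c i p ^+ 2) <= energy g.
Proof.
rewrite /energy (bigD1 (c, i))//= lerDl; apply: sumr_ge0 => z _.
by apply: Rintegral_ge0 => p _; exact: sqr_ge0.
Qed.

Lemma minimizing_frame (X : R * R -> vec) : (forall p, D p -> conformal_at X p) ->
  (exists N, weak_normal_frame X N) ->
  exists2 N, weak_normal_frame X N &
    forall N', weak_normal_frame X N' -> energy (wgrad N) <= energy (wgrad N').
Proof.
move=> cX [N0 wN0].
pose S := [set energy (wgrad N) | N in weak_normal_frame X].
have hS : has_inf S.
  split; first by exists (energy (wgrad N0)), N0.
  by exists 0 => _ [N _ <-]; exact: energy_ge0.
have /choice[N_ hN] : forall k, exists N, weak_normal_frame X N /\ energy (wgrad N) <= inf S + k.+1%:R^-1.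
  move=> k; have k0 : 0 < k.+1%:R^-1 :> R by rewrite invr_gt0.
  by have [_ [N wN <-] h] := inf_adherent k0 hS; exists N; split => //; exact: ltW.
have wN k : weak_normal_frame X (N_ k) by case: (hN k).
pose u_ k (c : 'I_n * 'I_(2 + n)) := entry (N_ k c.1) c.2.
have wf k (c : 'I_n * 'I_(2 + n)) i := weak_field_frame c.1 i (wN k).
have mu_ k c : measurable_fun (D : set plane) (u_ k c) by case: (wf k c 0 c.2).
have u1 k c : {ae m2, forall p, D p -> `|u_ k c p| <= 1}.
  by apply: aeS (wN k).2 => p h Dp; apply: (frame_entry_le1 _ _ (h Dp)).
have wg k c i : is_weak_pd i (u_ k c) (wgrad (N_ k) c i).
  by apply: weak_pdP; case: ((wN k).1 c.1 c.2).
have sg k (c : 'I_n * 'I_(2 + n)) i := sqint_wgrad c i (wN k).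
pose vol := \int[m2]_(p in D) (1 : R).
(* The compactness lemma asks for L1 bounds on the gradients, which follow from |a| <= a^2 + 1 and
   the finite measure of the disc. *)
have L1 k c i : \int[m2]_(p in D) `|wgrad (N_ k) c i p| <= inf S + 1 + vol.
  have s2 := (sg k c i).2; have i1 := @integrable_cst_disc R 1.
  apply: (@le_trans _ _ (\int[m2]_(p in D) (wgrad (N_ k) c i p ^+ 2 + 1))).
    apply: le_Rintegral => //; [exact: (integrable_norm (sqint_integrable (sg k c i)))|exact: (integrable_RD mD s2 i1)|].
    move=> p _; rewrite -(real_normK (num_real (wgrad (N_ k) c i p))).
    by have := sqr_ge0 (`|wgrad (N_ k) c i p| - 1); have := normr_ge0 (wgrad (N_ k) c i p); rewrite sqrrB1; nra.
  rewrite (RintegralD mD s2 i1) lerD2r; apply: le_trans (energy_term _ c i) _.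
  apply: le_trans (hN k).2 _; rewrite lerD2l invf_le1// ler1n.
  by [].
have [k_ [u [nk hu]]] := rellich mu_ u1 wg L1.
have Elim (e : R) : 0 < e -> exists J, forall j, (J <= j)%N -> energy (wgrad (N_ (k_ j))) <= inf S + e.
  move=> e0; have /cvgrPdist_le/(_ _ e0)[J _ hJ] := @cvg_harmonic R.
  exists J => j Jj; apply: le_trans (hN (k_ j)).2 _; rewrite lerD2l.
  apply: (@le_trans _ _ j.+1%:R^-1); first by rewrite lef_pV2 ?posrE// ler_nat ltnS.
  by have := hJ j Jj; rewrite sub0r normrN /harmonic/=; apply: le_trans; exact: ler_norm.
have [G [wG GS]] := @direct_method R _ (fun k => u_ (k_ k)) (fun k => wgrad (N_ (k_ k))) u (inf S)
  (fun k => mu_ (k_ k)) (fun k => u1 (k_ k)) (fun k => wg (k_ k)) (fun c => (hu c).1) (fun c => (hu c).2) Elim.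
pose N s p : vec := \row_l u (s, l) p.
have eN s l : entry (N s) l = u (s, l) by apply/funext => p; rewrite /entry mxE.
have fN : {ae m2, forall p, D p -> normal_frame_at X N p}.
  have a1 : {ae m2, forall p, forall k, D p -> normal_frame_at X (N_ (k_ k)) p}.
    by apply: ae_forall_count => k; exact: (wN (k_ k)).2.
  have a2 : {ae m2, forall p, forall c, D p -> u_ (k_ k) c p @[k --> \oo] --> u c p}.
    by apply: ae_forall_count => c; exact: (hu c).2.
  apply: aeS (aeI a1 a2) => p [h1 h2] Dp.
  apply: (normal_frame_limit (cX p Dp) (fun k => h1 k Dp)) => s l.
  by rewrite mxE; exact: (h2 (s, l) Dp).
have uN1 c : {ae m2, forall p, D p -> `|u c p| <= 1}.
  case: c => s l; rewrite -eN.
  by apply: aeS fN => p h Dp; apply: (frame_entry_le1 _ _ (h Dp)).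
have su c : sqint (u c) by exact: sqint_bounded (hu c).1 (uN1 c).
have wN' : weak_normal_frame X N.
  split => // s l; rewrite eN; split; last exact: (Lp_disc_bounded (hu (s, l)).1 (uN1 (s, l))).
  by split; [exact/Lp_disc2P|move=> i; exists (G (s, l) i)].
exists N; first exact: wN'.
move=> N2 wN2; apply: (@le_trans _ _ (inf S)); last by apply: ge_inf; [case: hS|exists N2].
apply: le_trans GS; rewrite le_eqVlt; apply/orP; left; apply/eqP.
(* G and the gradient chosen by [weak_pd] are both weak gradients of u, so their energies agree. *)
apply: (@energy_unique R _ u) => // -[s l] i.
by rewrite /wgrad/= eN; apply: weak_pdP; rewrite -eN; case: (wN'.1 s l).
Qed.
End Existence.

Lemma le_of_subr_eq (R : realType) (a b c d : R) : a - c = b - d -> a <= b -> c <= d.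
Proof. lra. Qed.

Lemma Ck_cdiscS (R : realType) k (f : R * R -> R) : Ck_cdisc k.+1 f -> Ck_cdisc 1 f.
Proof. by move=> [cf df]; split => // i; have [d1 d2] := df i; split => //; case: k d2 {df} => [|k] []. Qed.

Theorem proposition32 (R : realType) (n : nat) (hn : (2 <= n)%N)
    (k : nat) (hk : (3 <= k)%N) (alpha : R) (ha : 0 < alpha < 1)
    (X : R * R -> 'rV[R]_(2 + n))
    (hX : Cka_surface k alpha X) (hXimm : immersion X)
    (hXconf : conformal X) :
  exists N : 'I_n -> R * R -> 'rV[R]_(2 + n),
    weak_Coulomb_frame X N /\
    forall N' : 'I_n -> R * R -> 'rV[R]_(2 + n),
      weak_normal_frame X N' -> (total_torsion N <= total_torsion N')%E.
Proof.
have [k' kE] : exists k', k = k'.+3 by exists (k - 3)%N; lia.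
have dX l : Ck_cdisc k'.+3 (entry X l) by rewrite -kE; case: (hX l).
have d1 i l : Ck_cdisc k'.+2 (pd i (entry X l)) by have [_ /(_ i)[]] := dX l.
have d2 i j l : Ck_cdisc k'.+1 (pd i (pd j (entry X l))) by have [_ /(_ i)[]] := d1 j l.
have eY i l : entry (vpd i X) l = pd i (entry X l) by apply/funext => p; rewrite /entry mxE.
have eZ i j l : entry (vpd i (vpd j X)) l = pd i (pd j (entry X l)).
  by apply/funext => p; rewrite /entry mxE eY.
have cconf p : cdisc p -> conformal_at X p.
  by move=> cp; have [W /(_ p cp)[h1 h2 h3 h4]] := hXconf; split;
    [exact: etrans h1 (esym h2)|exact: (eq_ind_r (fun z => 0 < z) h3 h1)|exact: h4].
have Dc (p : R * R) : disc p -> cdisc p by exact: subset_closure.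
have conf p : disc p -> conformal_at X p by move=> /Dc; exact: cconf.
have cY i : C1bmx (vpd i X).
  by move=> a l; rewrite (ord1 a); have := Ck_C1b (Ck_cdiscS (d1 i l)); rewrite -eY.
have wX i j : weak_field i (vpd j X) (vpd i (vpd j X)).
  move=> l; rewrite eY eZ; have cf := Ck_C1b (Ck_cdiscS (d1 j l)).
  have [C C0 bf] := C1b_bounded cf; split; first exact: C1b_measurable.
    by exists C; exact: aeW.
  have [_ /(_ i)[df [cpd _]]] := d1 j l.
  have [K K0 bpd] := within_cdisc_bounded cpd.
  apply: (weak_pd_classical (C := C + K)) => //.
  - exact: C1b_continuous.
  - exact: within_cdisc_continuous.
  - by move=> p Dp; apply: le_trans (bf p Dp) _; rewrite lerDl.
  - by move=> p /Dc cp; apply: le_trans (bpd p cp) _; rewrite lerDr.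
have [c c0 cA] : exists2 c : R, 0 < c & forall p, cdisc p -> c <= area X p.
  apply: area_lower_bound; first by move=> l; case: (d1 0 l).
  by move=> p /cconf[].
have n0 : (0 < n)%N by lia.
have [N wN minN] := minimizing_frame conf (exists_weak_normal_frame n0 c0 conf (fun p Dp => cA p (Dc p Dp)) cY).
exists N; split; first by split => // phi s t sphi; exact: (euler_lagrange wN minN).
move=> N' wN'; rewrite !(total_torsionE (X := X))// lee_fin.
(* Energy minus torsion is the same number for both frames, so the order of the energies is that of
   the torsions. *)
exact: (le_of_subr_eq (energy_torsion conf wX wN wN') (minN N' wN')).
Qed.
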